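(* For each of the five Mukai threefolds below, consider the three-term linear recurrence $$n^3 u_n = P(n)\,u_{n-1} + Q(n)\,u_{n-2},$$ with $P,Q$ given by: - $V_{10}$: $P(n)=2(2n-1)(11n^2-11n+3)$, $Q(n)=4(n-1)(2n-1)(2n-3)$; - $V_{12}$: $P(n)=(2n-1)(17n^2-17n+5)$, $Q(n)=-(n-1)^3$; - $V_{14}$: $P(n)=(2n-1)(13n^2-13n+4)$, $Q(n)=3(n-1)(3n-2)(3n-4)$; - $V_{16}$: $P(n)=4(2n-1)(3n^2-3n+1)$, $Q(n)=-16(n-1)^3$; - $V_{18}$: $P(n)=3(2n-1)(3n^2-3n+1)$, $Q(n)=27(n-1)^3$. Define two rational sequences for each case. - $(a_n)_{n\ge 0}$ is the solution with $a_0=1$ that satisfies the recurrence for all $n\ge 1$, with the convention $a_{-1}=0$. - $(b_n)_{n\ge 0}$ is the solution with $b_0=0$, $b_1=1$ that satisfies the recurrence for all $n\ge 2$. Then the limit $\lim_{n\to+\infty} b_n/a_n$ exists and equals: - $\frac{1}{10}\zeta(2)$ for $V_{10}$; - $\frac16\zeta(3)$ for $V_{12}$; - $\frac17\zeta(2)$ for $V_{14}$; - $\frac{7}{32}\zeta(3)$ for $V_{16}$; - $\frac13 L(\chi_3,3)$ for $V_{18}$.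
   Context: These recurrences are the regularized quantum recurrences of the Mukai threefolds $V_{10},\dots,V_{18}$. Each is the recurrence on the coefficients $u_n$ of a power series $\sum_n u_n t^n$ annihilated by the corresponding operator below, where $D=t\,\frac{d}{dt}$: - $V_{10}$: $D^3-2t(2D+1)(11D^2+11D+3)-4t^2(D+1)(2D+3)(2D+1)$; - $V_{12}$: $D^3-t(2D+1)(17D^2+17D+5)+t^2(D+1)^3$; - $V_{14}$: $D^3-t(2D+1)(13D^2+13D+4)-3t^2(D+1)(3D+4)(3D+2)$; - $V_{16}$: $D^3-4t(2D+1)(3D^2+3D+1)+16t^2(D+1)^3$; - $V_{18}$: $D^3-3t(2D+1)(3D^2+3D+1)-27t^2(D+1)^3$. Here $\zeta$ is the Riemann zeta function. $L(\chi_3,s)=\sum_{n\ge1}\chi_3(n)n^{-s}$ is the Dirichlet $L$-function of the nontrivial Dirichlet character $\chi_3(n)=\left(\frac{n}{3}\right)$ modulo $3$. *)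

(* Defs.v *)
From Stdlib Require Import Reals Lra.
From Coquelicot Require Import Coquelicot.
Open Scope R_scope.

Definition zeta (s : nat) : R := Series (fun n : nat => / (INR (S n)) ^ s).

Definition chi3 (n : nat) : R :=
  match (n mod 3)%nat with
  | 0%nat => 0
  | 1%nat => 1
  | _ => -1
  end.

Definition L_chi3 (s : nat) : R :=
  Series (fun n : nat => chi3 (S n) / (INR (S n)) ^ s).

Inductive Mukai := V10 | V12 | V14 | V16 | V18.

(** Coefficients of the recurrence n^3 u_n = P(n) u_{n-1} + Q(n) u_{n-2}. *)
Definition recP (V : Mukai) (n : R) : R :=
  match V with
  | V10 => 2 * (2*n - 1) * (11*n^2 - 11*n + 3)
  | V12 => (2*n - 1) * (17*n^2 - 17*n + 5)
  | V14 => (2*n - 1) * (13*n^2 - 13*n + 4)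
  | V16 => 4 * (2*n - 1) * (3*n^2 - 3*n + 1)
  | V18 => 3 * (2*n - 1) * (3*n^2 - 3*n + 1)
  end.

Definition recQ (V : Mukai) (n : R) : R :=
  match V with
  | V10 => 4 * (n - 1) * (2*n - 1) * (2*n - 3)
  | V12 => - (n - 1)^3
  | V14 => 3 * (n - 1) * (3*n - 2) * (3*n - 4)
  | V16 => -16 * (n - 1)^3
  | V18 => 27 * (n - 1)^3
  end.

Definition mukai_limit (V : Mukai) : R :=
  match V with
  | V10 => zeta 2 / 10
  | V12 => zeta 3 / 6
  | V14 => zeta 2 / 7
  | V16 => 7 / 32 * zeta 3
  | V18 => L_chi3 3 / 3
  end.

(* Main.v *)
Require Import Defs.
From Stdlib Require Import Reals Lra Lia ZArith.
From Coquelicot Require Import Coquelicot.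
Open Scope R_scope.

(** For [V10], [V12], [V14] and [V16] there is a third solution [I n] of the recurrence, given by an
    explicit series of rational functions (or of derivatives of their squares).  The recurrence for
    [I] is proved by creative telescoping, the first two values of [I] are rational combinations of
    [1] and the zeta value, and [I n = O(n 4^n)] while [a n] grows at least like [5^n]; hence
    [I = c (b - l a)] gives [b n / a n -> l].

    For [V18], [a n] and [b n] are pairings [sum_k p_(n,k) e_k] of the nonnegative coefficients of
    Legendre-type polynomials with solutions of [k^3 e_k = k (k-1) (k-2) e_(k-3) + s_k], where [s = 0]
    for [a] and [s = chi3] for [b].  The weights [p_(n,k) / (k+1)] escape to infinity and equidistribute
    modulo [3], so the limit only depends on the limits of [k e_k] in the residue classes.  These
    are expressed by [P = prod (1 - 1/(9 k^2))] and [sum 1/((3l+1)(3l+2))] through a two-sided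
    partial fraction kernel, and all constants, including [L_chi3 3], are evaluated in terms of [PI]. *)

(** * Solutions of the recurrences *)

(** The limit is read off from the first two values of any solution that grows more slowly than [a],
    so no sharp asymptotics of [I] are needed and crude termwise bounds suffice. A sum must start
    where its telescoping certificate vanishes: at [1] for factors [s - k], at [1 / 2] for a factor
    [2 * s - 1]. This decides whether it runs over integers, half-odd numbers, or both. Half-odd
    numbers bring in [2 ^ t - 1], the origin of the 7 in [7 / 32]. A double pole at 0 yields
    [zeta 2]; the derivative of a squared simple pole yields [zeta 3]. For [V18], the Legendre-type
    polynomials miss the recurrence by a differential operator in [psi], and the adjoint of this
    operator is the recurrence imposed on [e]. The primitive cube roots of unity are the points
    where the Legendre argument is [1] or [-1]; there the polynomials are pure powers, small beside
    their sum of coefficients, which is why residue classes modulo 3 are weighted equally. *)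

Definition solves (V : Mukai) (u : nat -> R) : Prop := forall n : nat,
  (INR n + 2) ^ 3 * u (S (S n)) =
  recP V (INR n + 2) * u (S n) + recQ V (INR n + 2) * u n.

Lemma solves_of_shifted (V : Mukai) (u : nat -> R) :
  (forall n : nat, (2 <= n)%nat ->
     INR n ^ 3 * u n = recP V (INR n) * u (n - 1)%nat + recQ V (INR n) * u (n - 2)%nat) ->
  solves V u.
Proof.
intros H n; generalize (H (S (S n)) ltac:(lia)).
replace (S (S n) - 1)%nat with (S n) by lia.
replace (S (S n) - 2)%nat with n by lia.
now replace (INR (S (S n))) with (INR n + 2) by (rewrite !S_INR; ring).
Qed.

Lemma solves_lin (V : Mukai) (u v : nat -> R) (x y : R) :
  solves V u -> solves V v -> solves V (fun n => x * u n + y * v n).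
Proof.
intros Hu Hv n.
replace ((INR n + 2) ^ 3 * (x * u (S (S n)) + y * v (S (S n)))) with
  (x * ((INR n + 2) ^ 3 * u (S (S n))) + y * ((INR n + 2) ^ 3 * v (S (S n)))) by ring.
rewrite (Hu n), (Hv n); ring.
Qed.

Lemma solves_unique (V : Mukai) (u v : nat -> R) :
  solves V u -> solves V v -> u 0%nat = v 0%nat -> u 1%nat = v 1%nat ->
  forall n, u n = v n.
Proof.
intros Hu Hv H0 H1 n.
enough (u n = v n /\ u (S n) = v (S n)) by tauto.
induction n as [|n [IH IH']]; [tauto | split; [exact IH'|]].
assert (Hn := pos_INR n).
apply Rmult_eq_reg_l with ((INR n + 2) ^ 3); [|apply pow_nonzero; lra].
now rewrite (Hu n), (Hv n), IH, IH'.
Qed.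

Lemma apery_limit (V : Mukai) (a b I : nat -> R) (c l : R) :
  solves V a -> solves V b -> solves V I ->
  a 0%nat = 1 -> b 0%nat = 0 -> b 1%nat = 1 -> c <> 0 ->
  I 0%nat = - c * l -> I 1%nat = c * (1 - l * a 1%nat) ->
  (forall n, a n <> 0) ->
  is_lim_seq (fun n => I n / a n) 0 -> is_lim_seq (fun n => b n / a n) l.
Proof.
intros Ha Hb HI a0 b0 b1 Hc I0 I1 Hnz Hlim.
assert (E : forall n, I n = c * b n + (- c * l) * a n).
{ apply (solves_unique V); auto using solves_lin.
  - rewrite I0, a0, b0; ring.
  - rewrite I1, b1; ring. }
apply is_lim_seq_ext with (fun n => l + / c * (I n / a n)).
- intros n; rewrite E; field; auto.
- replace (Finite l) with (Finite (l + / c * 0)) by (f_equal; ring).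
  apply is_lim_seq_plus'; [apply is_lim_seq_const|].
  apply is_lim_seq_mult'; [apply is_lim_seq_const | exact Hlim].
Qed.

(** Where [recQ] is negative ([V12], [V16]), the bound [4 * B <= A] limits the loss to a quarter of
    its coefficient times [A]. The ratio 4 assumed improves to 5. *)
Lemma solves_growth_step (V : Mukai) (x A B : R) :
  V <> V18 -> 0 <= x -> 0 < B -> 4 * B <= A ->
  5 * (x + 2) ^ 3 * A <= recP V (x + 2) * A + recQ V (x + 2) * B.
Proof.
intros HV Hx HB HA.
assert (H2 : 0 <= x * x) by nra.
assert (H3 : 0 <= x * x * x) by nra.
destruct V; try congruence; simpl.
- assert (0 <= 2 * (2 * (x + 2) - 1) * (11 * (x + 2) ^ 2 - 11 * (x + 2) + 3)
     - 5 * (x + 2) ^ 3) by nra.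
  assert (0 <= 4 * (x + 2 - 1) * (2 * (x + 2) - 1) * (2 * (x + 2) - 3)) by nra.
  nra.
- assert (0 <= (2 * (x + 2) - 1) * (17 * (x + 2) ^ 2 - 17 * (x + 2) + 5)
     - 5 * (x + 2) ^ 3 - (x + 2 - 1) ^ 3 / 4) by nra.
  assert (0 <= (x + 2 - 1) ^ 3) by (apply pow_le; lra).
  nra.
- assert (0 <= (2 * (x + 2) - 1) * (13 * (x + 2) ^ 2 - 13 * (x + 2) + 4)
     - 5 * (x + 2) ^ 3) by nra.
  assert (0 <= 3 * (x + 2 - 1) * (3 * (x + 2) - 2) * (3 * (x + 2) - 4)) by nra.
  nra.
- assert (0 <= 4 * (2 * (x + 2) - 1) * (3 * (x + 2) ^ 2 - 3 * (x + 2) + 1)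
     - 5 * (x + 2) ^ 3 - 16 * (x + 2 - 1) ^ 3 / 4) by nra.
  assert (0 <= (x + 2 - 1) ^ 3) by (apply pow_le; lra).
  nra.
Qed.

(** The ratio 4 is what the start allows: [a 1] is 6, 5, 4, 4 for [V10], [V12], [V14], [V16], but 3
    for [V18]. All later ratios are at least 5, which beats a growth of order [n * 4 ^ n]. *)
Lemma solves_growth (V : Mukai) (a : nat -> R) :
  V <> V18 -> solves V a -> a 0%nat = 1 -> a 1%nat = recP V 1 ->
  forall n, 0 < a n /\ 4 * a n <= a (S n) /\ 4 * 5 ^ n <= a (S n).
Proof.
intros HV Ha a0 a1 n.
induction n as [|n [IH [IH' IH'']]].
- rewrite a0, a1; destruct V; simpl; repeat split; try lra; congruence.
- assert (Hn := pos_INR n).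
  assert (0 < (INR n + 2) ^ 3) by (apply pow_lt; lra).
  assert (5 * a (S n) <= a (S (S n))).
  { apply Rmult_le_reg_l with ((INR n + 2) ^ 3); [lra|].
    rewrite (Ha n).
    generalize (solves_growth_step V (INR n) (a (S n)) (a n) HV Hn IH IH'); lra. }
  simpl pow; lra.
Qed.

Lemma is_lim_seq_poly_geom (C q : R) :
  0 <= q < 1 -> is_lim_seq (fun n => C * (INR n + 1) * q ^ n) 0.
Proof.
intros Hq.
(* The ratio test below needs nonzero terms. *)
destruct (Req_dec q 0) as [->|Hq0].
{ apply is_lim_seq_ext_loc with (fun _ => 0); [|apply is_lim_seq_const].
  exists 1%nat; intros n Hn; rewrite pow_i; [ring|lia]. }
apply is_lim_seq_ext with (fun n => C * ((INR n + 1) * q ^ n)); [intros n; ring|].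
replace (Finite 0) with (Rbar_mult C 0) by (simpl; f_equal; ring).
apply is_lim_seq_scal_l.
apply ex_series_lim_0.
apply ex_series_ext with (fun n => Rabs ((INR n + 1) * q ^ n)).
{ intros n; apply Rabs_pos_eq. apply Rmult_le_pos; [generalize (pos_INR n); lra|].
  apply pow_le; lra. }
apply ex_series_DAlembert with q; [lra| |].
{ intros n; apply Rmult_integral_contrapositive_currified;
    [generalize (pos_INR n); lra | now apply pow_nonzero]. }
apply is_lim_seq_ext with (fun n => q + q * / (INR n + 1)).
{ intros n; assert (Hn := pos_INR n); rewrite S_INR; simpl pow.
  replace (_ / _) with (q + q * / (INR n + 1)).
  - rewrite Rabs_pos_eq; [reflexivity|].
    assert (0 < / (INR n + 1)) by (apply Rinv_0_lt_compat; lra); nra.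
  - field; split; [now apply pow_nonzero | lra]. }
replace (Finite q) with (Finite (q + q * 0)) by (f_equal; ring).
apply is_lim_seq_plus'; [apply is_lim_seq_const|].
apply is_lim_seq_mult'; [apply is_lim_seq_const|].
apply (is_lim_seq_inv (fun n => INR n + 1) p_infty); [|discriminate].
apply is_lim_seq_ext with (fun n => INR (S n)); [intros; now rewrite S_INR|].
apply (is_lim_seq_incr_1 INR p_infty), is_lim_seq_INR.
Qed.

Lemma apery_limit_geom (V : Mukai) (a b I : nat -> R) (c l C : R) :
  V <> V18 -> solves V a -> solves V b -> solves V I ->
  a 0%nat = 1 -> a 1%nat = recP V 1 -> b 0%nat = 0 -> b 1%nat = 1 -> c <> 0 ->
  I 0%nat = - c * l -> I 1%nat = c * (1 - l * recP V 1) ->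
  (forall n, Rabs (I n) <= C * (INR n + 1) * 4 ^ n) ->
  is_lim_seq (fun n => b n / a n) l.
Proof.
intros HV Ha Hb HI a0 a1 b0 b1 Hc I0 I1 HC.
assert (G := solves_growth V a HV Ha a0 a1).
apply (apery_limit V a b I c l); auto.
- now rewrite a1.
- intros n; destruct (G n); lra.
- apply is_lim_seq_abs_0.
  (* The growth bound reads [4 * 5 ^ (n - 1) <= a n]; its index shift gives the factor [5 / 4] and
     excludes [n = 0]. *)
  apply is_lim_seq_le_le_loc with (fun _ => 0) (fun n => (5 / 4 * C) * (INR n + 1) * (4 / 5) ^ n).
  + exists 1%nat; intros n Hn. destruct n as [|n]; [lia|].
    destruct (G n) as [_ [_ Gn]].
    assert (0 < 5 ^ n) by (apply pow_lt; lra).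
    assert (0 < a (S n)) by lra.
    split; [apply Rabs_pos|].
    unfold Rdiv at 1; rewrite Rabs_mult, Rabs_inv, (Rabs_pos_eq (a (S n))) by lra.
    apply Rmult_le_reg_r with (a (S n)); [lra|].
    rewrite Rmult_assoc, Rinv_l, Rmult_1_r by lra.
    eapply Rle_trans; [apply HC|].
    assert (Cp : 0 <= C * (INR (S n) + 1) * 4 ^ S n)
      by (eapply Rle_trans; [apply Rabs_pos | apply HC]).
    replace ((4 / 5) ^ S n) with (4 ^ S n * / 5 ^ S n)
      by (unfold Rdiv; rewrite Rpow_mult_distr, pow_inv; reflexivity).
    simpl (5 ^ S n).
    replace (5 / 4 * C * (INR (S n) + 1) * (4 ^ S n * / (5 * 5 ^ n)) * a (S n)) with
      ((C * (INR (S n) + 1) * 4 ^ S n) * (a (S n) * / (4 * 5 ^ n))) by (field; lra).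
    rewrite <- (Rmult_1_r (C * _ * _)) at 1.
    apply Rmult_le_compat_l; [exact Cp|].
    apply Rmult_le_reg_r with (4 * 5 ^ n); [lra|].
    rewrite Rmult_assoc, Rinv_l; lra.
  + apply is_lim_seq_const.
  + apply is_lim_seq_poly_geom; lra.
Qed.

(** * Series *)

Lemma is_series_lim (f : nat -> R) (l : R) : is_lim_seq (sum_n f) l -> is_series f l.
Proof. exact (fun H => H). Qed.

Lemma is_lim_series (f : nat -> R) (l : R) : is_series f l -> is_lim_seq (sum_n f) l.
Proof. exact (fun H => H). Qed.

Lemma is_series_lin (f g : nat -> R) (x y l k : R) :
  is_series f l -> is_series g k -> is_series (fun m => x * f m + y * g m) (x * l + y * k).
Proof.
intros Hf Hg.
exact (is_series_plus _ _ _ _ (is_series_scal_l x _ _ Hf) (is_series_scal_l y _ _ Hg)).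
Qed.

Lemma ex_series_Rscal (c : R) (f : nat -> R) :
  ex_series f -> ex_series (fun m => c * f m).
Proof.
intros [l Hl]; exists (c * l + 0 * l).
eapply is_series_ext; [|exact (is_series_lin f f c 0 l l Hl Hl)].
intros m; simpl; ring.
Qed.

Lemma is_series_telescope (g : nat -> R) (l : R) :
  is_lim_seq g l -> is_series (fun m => g (S m) - g m) (l - g 0%nat).
Proof.
intros Hg; apply is_series_lim.
apply (is_lim_seq_ext (fun n => g (S n) - g 0%nat)).
- intros n; induction n as [|n IH].
  + now rewrite sum_O.
  + rewrite sum_Sn, <- IH; unfold plus; simpl; ring.
- apply is_lim_seq_minus'; [now apply (is_lim_seq_incr_1 g) | apply is_lim_seq_const].
Qed.

(** Creative telescoping: the sums inherit the recurrence because both boundary values of the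
    certificate [g] are zero. *)
Lemma Series_telescope2 (f0 f1 f2 g : nat -> R) (x y z : R) :
  ex_series f0 -> ex_series f1 -> ex_series f2 ->
  (forall m, x * f2 m - y * f1 m - z * f0 m = g (S m) - g m) ->
  g 0%nat = 0 -> is_lim_seq g 0 ->
  x * Series f2 = y * Series f1 + z * Series f0.
Proof.
intros H0 H1 H2 E g0 Hg.
assert (A := is_series_telescope g 0 Hg); rewrite g0, Rminus_0_r in A.
apply Series_correct in H0; apply Series_correct in H1; apply Series_correct in H2.
assert (B := is_series_lin _ _ 1 (- z) _ _ (is_series_lin _ _ x (- y) _ _ H2 H1) H0).
assert (C : is_series (fun m => g (S m) - g m)
  (1 * (x * Series f2 + - y * Series f1) + - z * Series f0)).
{ eapply is_series_ext; [|exact B]; intros m; simpl; rewrite <- E; ring. }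
generalize (is_series_unique _ _ A), (is_series_unique _ _ C); lra.
Qed.

Lemma Series_telescope1 (f0 f1 g : nat -> R) (y : R) :
  ex_series f0 -> (forall m, f1 m - y * f0 m = g (S m) - g m) ->
  is_lim_seq g 0 -> Series f1 = y * Series f0 - g 0%nat.
Proof.
intros H0 E Hg.
assert (A := is_series_telescope g 0 Hg).
apply Series_correct in H0.
apply is_series_unique.
generalize (is_series_lin _ _ y 1 _ _ H0 A).
replace (y * Series f0 + 1 * (0 - g 0%nat)) with (y * Series f0 - g 0%nat) by ring.
apply is_series_ext; intros m; simpl; rewrite <- E; ring.
Qed.

Lemma is_lim_seq_inv_shift (h : R) : is_lim_seq (fun m => / (INR m + h)) 0.
Proof.
apply (is_lim_seq_inv (fun n => INR n + h) p_infty); [|discriminate].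
eapply is_lim_seq_plus; [apply is_lim_seq_INR | apply is_lim_seq_const | reflexivity].
Qed.

Lemma ex_series_inv_sq_shift (h : R) : 0 < h -> ex_series (fun m => (/ (INR m + h)) ^ 2).
Proof.
intros Hh.
(* The comparison series telescopes; [1 + / h] bounds the ratio [1 + / (INR m + h)] of the
   summands. *)
assert (A : ex_series (fun m => (1 + / h) * (/ (INR m + h) - / (INR (S m) + h)))).
{ apply ex_series_Rscal.
  eexists; apply is_series_ext with (fun m => (- / (INR (S m) + h)) - (- / (INR m + h)));
    [intros m; simpl; ring|].
  apply (is_series_telescope (fun m => - / (INR m + h)) (-0)).
  apply (is_lim_seq_opp _ 0), is_lim_seq_inv_shift. }
apply (ex_series_le (K := R_AbsRing) (V := R_CompleteNormedModule)) with (2 := A).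
intros m; assert (Hm := pos_INR m).
change (Rabs ((/ (INR m + h)) ^ 2) <= (1 + / h) * (/ (INR m + h) - / (INR (S m) + h))).
rewrite S_INR, Rabs_pos_eq by (apply pow_le; left; apply Rinv_0_lt_compat; lra).
replace ((1 + / h) * (/ (INR m + h) - / (INR m + 1 + h))) with
  ((/ (INR m + h)) * ((1 + / h) * / (INR m + 1 + h))) by (field; lra).
simpl pow; rewrite Rmult_1_r.
apply Rmult_le_compat_l; [left; apply Rinv_0_lt_compat; lra|].
apply Rmult_le_reg_r with ((INR m + h) * (INR m + 1 + h)); [nra|].
replace (/ (INR m + h) * ((INR m + h) * (INR m + 1 + h))) with (INR m + h + 1) by (field; lra).
replace ((1 + / h) * / (INR m + 1 + h) * ((INR m + h) * (INR m + 1 + h))) with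
  (INR m + h + 1 + INR m * / h) by (field; lra).
assert (0 < / h) by (apply Rinv_0_lt_compat; lra). nra.
Qed.

Lemma ex_series_bound_sq (f : nat -> R) (h C : R) : 0 < h ->
  (forall m, Rabs (f m) <= C * (/ (INR m + h)) ^ 2) -> ex_series f.
Proof.
intros Hh H.
apply (ex_series_le (K := R_AbsRing) (V := R_CompleteNormedModule)) with
  (fun m => C * (/ (INR m + h)) ^ 2); [exact H|].
apply ex_series_Rscal; now apply ex_series_inv_sq_shift.
Qed.

Lemma Series_bound_sq (f : nat -> R) (h C : R) : 0 < h ->
  (forall m, Rabs (f m) <= C * (/ (INR m + h)) ^ 2) ->
  Rabs (Series f) <= C * Series (fun m => (/ (INR m + h)) ^ 2).
Proof.
intros Hh H.
assert (E : ex_series (fun m => C * (/ (INR m + h)) ^ 2))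
  by (apply ex_series_Rscal; now apply ex_series_inv_sq_shift).
assert (A : ex_series (fun m => Rabs (f m))).
{ apply (ex_series_le (K := R_AbsRing) (V := R_CompleteNormedModule)) with (2 := E).
  intros m; unfold norm; simpl; unfold abs; simpl; rewrite Rabs_Rabsolu; apply H. }
eapply Rle_trans; [now apply Series_Rabs|].
rewrite <- Series_scal_l.
apply Series_le; [|exact E].
intros m; split; [apply Rabs_pos | apply H].
Qed.

Lemma ex_series_zeta (s : nat) : ex_series (fun n => / INR (S n) ^ S (S s)).
Proof.
apply ex_series_bound_sq with 1 1; [lra|].
intros m; rewrite Rmult_1_l, S_INR, pow_inv.
assert (Hm := pos_INR m).
assert (0 < (INR m + 1) ^ 2) by (apply pow_lt; lra).
assert (0 < (INR m + 1) ^ S (S s)) by (apply pow_lt; lra).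
rewrite Rabs_pos_eq by (left; now apply Rinv_0_lt_compat).
apply Rinv_le_contravar; [lra|].
apply Rle_pow; [lra|lia].
Qed.

Lemma sum_n_even_odd (f : nat -> R) (N : nat) :
  sum_n f (2 * N + 1) =
  sum_n (fun m => f (2 * m)%nat) N + sum_n (fun m => f (2 * m + 1)%nat) N.
Proof.
induction N as [|N IH].
- simpl (2 * 0 + 1)%nat; rewrite sum_Sn, !sum_O; reflexivity.
- replace (2 * S N + 1)%nat with (S (S (2 * N + 1))) by lia.
  rewrite !sum_Sn, IH.
  replace (S (2 * N + 1)) with (2 * S N)%nat by lia.
  replace (S (2 * S N)) with (2 * S N + 1)%nat by lia.
  unfold plus; simpl; ring.
Qed.

Lemma is_lim_seq_even_odd_sum (f : nat -> R) (l : R) : is_series f l ->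
  is_lim_seq (fun N => sum_n (fun m => f (2 * m)%nat) N + sum_n (fun m => f (2 * m + 1)%nat) N) l.
Proof.
intros Hf; apply is_lim_series in Hf.
apply (is_lim_seq_ext (fun N => sum_n f (2 * N + 1))); [apply sum_n_even_odd|].
apply (is_lim_seq_subseq (sum_n f) l (fun N => (2 * N + 1)%nat)); [|exact Hf].
intros P [n Hn]; exists n; intros m Hm; apply Hn; lia.
Qed.

(** Even integers carry the share [/ 2 ^ t] of [zeta t], odd ones the rest; rescaling by [2 ^ t]
    turns odd integers into half-odd numbers. *)
Lemma is_series_half_odd (s : nat) :
  is_series (fun m => (/ (INR m + 1 / 2)) ^ S (S s)) ((2 ^ S (S s) - 1) * zeta (S (S s))).
Proof.
set (t := S (S s)).
set (f := fun n => / INR (S n) ^ t).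
assert (Hf := Series_correct _ (ex_series_zeta s)); fold t in Hf.
change (is_series f (zeta t)) in Hf.
assert (H := is_lim_seq_even_odd_sum f _ Hf).
apply is_lim_series in Hf.
assert (Ht : 2 ^ t <> 0) by (apply pow_nonzero; lra).
apply is_series_lim.
apply (is_lim_seq_ext (fun N => 2 ^ t * (sum_n (fun m => f (2 * m)%nat) N +
   sum_n (fun m => f (2 * m + 1)%nat) N) - sum_n f N)).
- intros N.
  rewrite (sum_n_ext (fun m => f (2 * m + 1)%nat) (fun m => / 2 ^ t * f m)).
  2: { intros m; unfold f; rewrite !S_INR, plus_INR, mult_INR; simpl (INR 1); simpl (INR 2).
       rewrite <- Rinv_mult, <- Rpow_mult_distr; do 2 f_equal; ring. }
  rewrite (sum_n_ext (fun m => f (2 * m)%nat) (fun m => / 2 ^ t * (/ (INR m + 1 / 2)) ^ t)).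
  2: { intros m; unfold f; rewrite S_INR, mult_INR; simpl (INR 2).
       rewrite pow_inv, <- Rinv_mult, <- Rpow_mult_distr; do 2 f_equal; field. }
  rewrite !(sum_n_mult_l (K := R_Ring)).
  match goal with |- ?p * (mult ?q ?x + mult ?q ?y) - ?y' = ?x' =>
    change (p * (q * x + q * y) - y = x) end.
  field; exact Ht.
- replace (Finite ((2 ^ t - 1) * zeta t)) with (Finite (2 ^ t * zeta t - zeta t)) by (f_equal; ring).
  apply is_lim_seq_minus'; [|exact Hf].
  apply is_lim_seq_mult'; [apply is_lim_seq_const | exact H].
Qed.

(** In the variable [u = / s] the limit at infinity of a rational function is a value at 0. *)
Lemma is_lim_seq_at_infinity (F G : R -> R) (h : R) : 0 < h -> continuous G 0 ->
  (forall s, 0 < s -> F s = G (/ s)) -> is_lim_seq (fun m => F (INR m + h)) (G 0).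
Proof.
intros Hh HG E.
apply is_lim_seq_ext with (fun m => G (/ (INR m + h))).
{ intros m; rewrite E; [reflexivity|]; generalize (pos_INR m); lra. }
apply is_lim_seq_continuous; [|apply is_lim_seq_inv_shift].
apply continuity_pt_filterlim; exact HG.
Qed.

Lemma Rabs_le_mult (x y a b : R) :
  Rabs x <= a -> Rabs y <= b -> Rabs (x * y) <= a * b.
Proof.
intros Hx Hy; rewrite Rabs_mult; apply Rmult_le_compat; auto using Rabs_pos.
Qed.

Lemma Rabs_div_le (x y c : R) : 0 < y -> Rabs x <= c * y -> Rabs (x / y) <= c.
Proof.
intros Hy Hx; unfold Rdiv; rewrite Rabs_mult, Rabs_inv, (Rabs_pos_eq y) by lra.
apply Rmult_le_reg_r with y; [lra|].
rewrite Rmult_assoc, Rinv_l; lra.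
Qed.

(** * Degree 14 *)

(** The rational function 2s(2s+1)...(2s+n-1) (s-1)...(s-n) / (s(s+1)...(s+n))^2. *)
Fixpoint c14 (n : nat) (s : R) : R := match n with
  | O => (/ s) ^ 2
  | S k => c14 k s * ((2 * s + INR k) * (s - (INR k + 1)) / (s + INR k + 1) ^ 2)
  end.

(** The quotient of [c14 n] at [s + 1] and at [s] is rational in [n] and [s]. It is stated without
    division because [s - INR n] may vanish. *)
Lemma c14_shift (n : nat) (s : R) : 0 < s ->
  c14 n (s + 1) * (2 * (2 * s + 1) * (s - INR n) * (s + INR n + 1) ^ 2) =
  c14 n s * ((2 * s + INR n) * (2 * s + INR n + 1) * s ^ 2).
Proof.
intros Hs; induction n as [|n IH].
- simpl; field; lra.
- assert (Hn := pos_INR n); simpl c14; rewrite S_INR.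
  replace (c14 n (s + 1) * _ * _) with
    (c14 n (s + 1) * (2 * (2 * s + 1) * (s - INR n) * (s + INR n + 1) ^ 2) *
     ((2 * (s + 1) + INR n) * (s - INR n - 1) / (s + INR n + 1) ^ 2)) by (field; lra).
  rewrite IH; field; lra.
Qed.

(* [G14] is a creative telescoping certificate for [c14]; [x14] was found by solving the linear
   system for its coefficients. *)
Definition x14 (n s : R) : R :=
  - ((15 * n + 7) * s ^ 2 + (26 * n ^ 2 + 9 * n - 1) * s + (7 * n ^ 3 - 8 * n ^ 2 - 9 * n - 2)).

Definition G14 (k : nat) (s : R) : R :=
  2 * (2 * s - 1) * (s - (INR k + 1)) * c14 k s * x14 (INR k + 1) s / (s + INR k + 1) ^ 2.

Lemma c14_telescope (k : nat) (s : R) : 0 < s ->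
  (INR k + 2) ^ 3 * c14 (S (S k)) s - recP V14 (INR k + 2) * c14 (S k) s
    - recQ V14 (INR k + 2) * c14 k s = G14 k (s + 1) - G14 k s.
Proof.
intros Hs; assert (Hk := pos_INR k).
assert (H := c14_shift k s Hs).
unfold G14.
(* After the shift, the factors [2 * s - 1] and [s - (INR k + 1)] of [G14] are [2 * s + 1] and
   [s - INR k], just those of [c14_shift]; so every term becomes [c14 k s] times a rational function
   without poles at [s > 0]. *)
replace (2 * (2 * (s + 1) - 1) * (s + 1 - (INR k + 1)) * c14 k (s + 1)) with
  (c14 k (s + 1) * (2 * (2 * s + 1) * (s - INR k) * (s + INR k + 1) ^ 2) / (s + INR k + 1) ^ 2)
  by (field; lra).
rewrite H; unfold x14; cbn [c14]; rewrite S_INR; unfold recP, recQ.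
field; lra.
Qed.

(* [c14] in the variable [u = 1 / s], which gives its behaviour at infinity. *)
Fixpoint B14 (n : nat) (u : R) : R := match n with
  | O => 1
  | S k => B14 k u * ((2 + INR k * u) * (1 - (INR k + 1) * u) / (1 + (INR k + 1) * u) ^ 2)
  end.

Lemma c14_B14 (n : nat) (s : R) : 0 < s -> c14 n s = (/ s) ^ 2 * B14 n (/ s).
Proof.
intros Hs; induction n as [|n IH]; [simpl; ring|].
assert (Hn := pos_INR n); simpl c14; simpl B14; rewrite IH; field; lra.
Qed.

Lemma continuous_B14 (n : nat) : continuous (B14 n) 0.
Proof.
induction n as [|n IH]; [apply continuous_const|].
apply (continuous_mult (B14 n)); [exact IH|].
apply (ex_derive_continuous (V := R_NormedModule)); auto_derive; lra.
Qed.

Lemma c14_bound (n : nat) (s : R) : 0 < s -> Rabs (c14 n s) <= 2 ^ n * (/ s) ^ 2.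
Proof.
intros Hs; induction n as [|n IH].
- simpl; rewrite Rmult_1_l; apply Req_le, Rabs_pos_eq.
  assert (0 < / s) by now apply Rinv_0_lt_compat. nra.
- assert (Hn := pos_INR n).
  replace (2 ^ S n * (/ s) ^ 2) with (2 ^ n * (/ s) ^ 2 * 2) by (simpl; ring).
  apply Rabs_le_mult; [exact IH|].
  apply Rabs_div_le; [apply pow_lt; lra|].
  replace (2 * (s + INR n + 1) ^ 2) with ((2 * (s + INR n + 1)) * (s + INR n + 1)) by ring.
  apply Rabs_le_mult; apply Rabs_le; lra.
Qed.

Lemma c14_at_1 (n : nat) : c14 (S n) 1 = 0.
Proof.
induction n as [|n IH]; [simpl; field|].
replace (c14 (S (S n)) 1) with
  (c14 (S n) 1 * ((2 * 1 + INR (S n)) * (1 - (INR (S n) + 1)) / (1 + INR (S n) + 1) ^ 2))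
  by reflexivity.
rewrite IH; ring.
Qed.

(** Its sum is the alternating sum of [c14 n] over the positive multiples of [1 / 2]. The
    certificate [G14] has a nonzero limit at infinity, the same along both progressions, so it
    cancels in the difference. *)
Definition f14 (n m : nat) : R := c14 n (INR m + 1) - c14 n (INR m + 1 / 2).

Lemma f14_bound (n m : nat) : Rabs (f14 n m) <= 2 * 2 ^ n * (/ (INR m + 1 / 2)) ^ 2.
Proof.
assert (Hm := pos_INR m); unfold f14.
eapply Rle_trans; [apply Rabs_triang|]; rewrite Rabs_Ropp.
assert (H1 := c14_bound n (INR m + 1) ltac:(lra)).
assert (H2 := c14_bound n (INR m + 1 / 2) ltac:(lra)).
assert (0 < / (INR m + 1)) by (apply Rinv_0_lt_compat; lra).
assert (/ (INR m + 1) <= / (INR m + 1 / 2)) by (apply Rinv_le_contravar; lra).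
assert (0 < 2 ^ n) by (apply pow_lt; lra).
assert ((/ (INR m + 1)) ^ 2 <= (/ (INR m + 1 / 2)) ^ 2) by (apply pow_incr; lra).
nra.
Qed.

Lemma ex_series_f14 (n : nat) : ex_series (f14 n).
Proof. apply ex_series_bound_sq with (1 / 2) (2 * 2 ^ n); [lra | apply f14_bound]. Qed.

Lemma G14_lim (k : nat) (h : R) : 0 < h ->
  is_lim_seq (fun m => G14 k (INR m + h)) (- 4 * (15 * (INR k + 1) + 7) * B14 k 0).
Proof.
intros Hh; assert (Hk := pos_INR k).
set (n := INR k + 1).
set (G := fun u => (2 * (2 - u) * (1 - n * u) * - ((15 * n + 7) + (26 * n ^ 2 + 9 * n - 1) * u
   + (7 * n ^ 3 - 8 * n ^ 2 - 9 * n - 2) * u ^ 2) / (1 + n * u) ^ 2) * B14 k u).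
replace (- 4 * (15 * n + 7) * B14 k 0) with (G 0) by (unfold G; field).
apply is_lim_seq_at_infinity; [exact Hh| |].
- apply (continuous_mult (K := R_AbsRing)); [|apply continuous_B14].
  apply (ex_derive_continuous (V := R_NormedModule)); auto_derive; lra.
- intros s Hs; unfold G14, G, x14; fold n; rewrite c14_B14 by exact Hs.
  replace (s + INR k + 1) with (s + n) by (unfold n; ring).
  assert (0 < n) by (unfold n; lra).
  field; lra.
Qed.

Lemma Series_f14_solves : solves V14 (fun n => Series (f14 n)).
Proof.
intros k.
apply Series_telescope2 with (fun m => G14 k (INR m + 1) - G14 k (INR m + 1 / 2));
  try apply ex_series_f14.
- intros m; assert (Hm := pos_INR m); rewrite S_INR; unfold f14.
  replace (INR m + 1 + 1 / 2) with (INR m + 1 / 2 + 1) by ring.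
  assert (A := c14_telescope k (INR m + 1) ltac:(lra)).
  assert (B := c14_telescope k (INR m + 1 / 2) ltac:(lra)).
  lra.
(* At the start, [2 * s - 1] kills the half-odd progression; the integral one is killed by
   [s - (INR k + 1)] for [k = 0] and by the zero of [c14 k] at 1 otherwise. *)
- simpl INR; rewrite !Rplus_0_l; unfold G14 at 2.
  replace (2 * (1 / 2) - 1) with 0 by field.
  replace (G14 k 1) with 0; [field; generalize (pos_INR k); lra|].
  unfold G14; destruct k as [|k]; [simpl; field|].
  rewrite c14_at_1; field; generalize (pos_INR (S k)); lra.
- replace (Finite 0) with (Finite (- 4 * (15 * (INR k + 1) + 7) * B14 k 0 -
     - 4 * (15 * (INR k + 1) + 7) * B14 k 0)) by (f_equal; ring).
  apply is_lim_seq_minus'; apply G14_lim; lra.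
Qed.

Lemma is_series_zeta (s : nat) : is_series (fun m => (/ (INR m + 1)) ^ S (S s)) (zeta (S (S s))).
Proof.
eapply is_series_ext; [|apply Series_correct, ex_series_zeta].
intros m.
change (/ INR (S m) ^ S (S s) = (/ (INR m + 1)) ^ S (S s)).
now rewrite S_INR, pow_inv.
Qed.

Lemma Series_f14_0 : Series (f14 0) = - 2 * zeta 2.
Proof.
apply is_series_unique.
replace (- 2 * zeta 2) with (1 * zeta 2 + -1 * ((2 ^ 2 - 1) * zeta 2)) by ring.
eapply is_series_ext; [|apply is_series_lin; [apply (is_series_zeta 0) | apply (is_series_half_odd 0)]].
intros m; unfold f14; simpl; ring.
Qed.

Lemma is_lim_seq_pole (h x y z : R) : 0 < h ->
  is_lim_seq (fun m => x / (INR m + h) ^ 3 + y / (INR m + h) ^ 2 + z / (INR m + h)) 0.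
Proof.
intros Hh.
set (G := fun u => x * u ^ 3 + y * u ^ 2 + z * u).
replace (Finite 0) with (Finite (G 0)) by (f_equal; unfold G; ring).
apply (is_lim_seq_at_infinity (fun s => x / s ^ 3 + y / s ^ 2 + z / s)); [exact Hh| |].
- apply (ex_derive_continuous (V := R_NormedModule)); unfold G; auto_derive; auto.
- intros s Hs; unfold G; field; lra.
Qed.

(** By partial fractions [c14 1 s] is -2/s + 2/(s+1) + 4/(s+1)^2, so subtracting 4/s^2 leaves a
    difference of 4/s^2 + 2/s. *)
Lemma Series_f14_1 : Series (f14 1) = 4 * Series (f14 0) + 14.
Proof.
rewrite (Series_telescope1 (f14 0) (f14 1) (fun m =>
  (0 / (INR m + 1) ^ 3 + 4 / (INR m + 1) ^ 2 + 2 / (INR m + 1)) -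
  (0 / (INR m + 1 / 2) ^ 3 + 4 / (INR m + 1 / 2) ^ 2 + 2 / (INR m + 1 / 2))) 4).
- simpl; field.
- apply ex_series_f14.
- intros m; assert (Hm := pos_INR m); unfold f14; rewrite S_INR; simpl; field; lra.
- replace (Finite 0) with (Finite (0 - 0)) by (f_equal; ring).
  apply is_lim_seq_minus'; apply is_lim_seq_pole; lra.
Qed.

Lemma limit_V14 (a b : nat -> R) :
  solves V14 a -> solves V14 b -> a 0%nat = 1 -> a 1%nat = recP V14 1 ->
  b 0%nat = 0 -> b 1%nat = 1 -> is_lim_seq (fun n => b n / a n) (zeta 2 / 7).
Proof.
intros Ha Hb a0 a1 b0 b1.
set (S0 := Series (fun m => (/ (INR m + 1 / 2)) ^ 2)).
assert (HS : 0 <= S0).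
{ apply Rle_trans with (Series (fun m => 0 * (/ (INR m + 1 / 2)) ^ 2)).
  - rewrite Series_scal_l; lra.
  - apply Series_le; [|apply ex_series_inv_sq_shift; lra].
    intros m; assert (0 <= (/ (INR m + 1 / 2)) ^ 2) by apply pow2_ge_0; lra. }
(* The constants come from the first two sums, [- 2 * zeta 2] and [14 - 8 * zeta 2]. *)
apply (apery_limit_geom V14 a b (fun n => Series (f14 n)) 14 (zeta 2 / 7) (2 * S0));
  auto using Series_f14_solves; try discriminate; try lra.
- rewrite Series_f14_0; field.
- rewrite Series_f14_1, Series_f14_0; simpl; field.
- intros n.
  eapply Rle_trans; [apply (Series_bound_sq _ (1 / 2) (2 * 2 ^ n)); [lra | apply f14_bound]|].
  fold S0.
  assert (Hn := pos_INR n).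
  assert (2 ^ n <= 4 ^ n) by (apply pow_incr; lra).
  assert (0 < 2 ^ n) by (apply pow_lt; lra).
  apply Rle_trans with (2 * S0 * 1 * 4 ^ n); [nra|].
  apply Rmult_le_compat_r; [lra|]. nra.
Qed.

(** * Degree 10 *)

(** The function (-1)^n n! (s-1)...(s-n) / (s(s+1)...(s+n))^2 behind Apery's approximations to
    [zeta 2]. *)
Fixpoint c10 (n : nat) (s : R) : R := match n with
  | O => (/ s) ^ 2
  | S k => c10 k s * (- (INR k + 1) * (s - (INR k + 1)) / (s + INR k + 1) ^ 2)
  end.

Lemma c10_shift (n : nat) (s : R) : 0 < s ->
  c10 n (s + 1) * ((s - INR n) * (s + INR n + 1) ^ 2) = c10 n s * s ^ 3.
Proof.
intros Hs; induction n as [|n IH].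
- simpl; field; lra.
- assert (Hn := pos_INR n); simpl c10; rewrite S_INR.
  replace (c10 n (s + 1) * _ * _) with
    (c10 n (s + 1) * ((s - INR n) * (s + INR n + 1) ^ 2) *
     (- (INR n + 1) * (s - INR n - 1) / (s + INR n + 1) ^ 2)) by (field; lra).
  rewrite IH; field; lra.
Qed.

Definition x10 (n s : R) : R :=
  n * (s ^ 2 - (6 * n + 3) * s - (11 * n ^ 2 + 9 * n + 2)).

Definition G10 (k : nat) (s : R) : R :=
  (s - (INR k + 1)) * c10 k s * x10 (INR k + 1) s / (s + INR k + 1) ^ 2.

Lemma c10_telescope (k : nat) (s : R) : 0 < s ->
  (INR k + 2) ^ 2 * c10 (S (S k)) s
    - (11 * (INR k + 2) ^ 2 - 11 * (INR k + 2) + 3) * c10 (S k) s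
    - (INR k + 1) ^ 2 * c10 k s = G10 k (s + 1) - G10 k s.
Proof.
intros Hs; assert (Hk := pos_INR k).
assert (H := c10_shift k s Hs).
unfold G10.
replace ((s + 1 - (INR k + 1)) * c10 k (s + 1)) with
  (c10 k (s + 1) * ((s - INR k) * (s + INR k + 1) ^ 2) / (s + INR k + 1) ^ 2)
  by (field; lra).
rewrite H; unfold x10; cbn [c10]; rewrite S_INR.
field; lra.
Qed.

Fixpoint B10 (n : nat) (u : R) : R := match n with
  | O => 1
  | S k => B10 k u * (- (INR k + 1) * u * (1 - (INR k + 1) * u) / (1 + (INR k + 1) * u) ^ 2)
  end.

Lemma c10_B10 (n : nat) (s : R) : 0 < s -> c10 n s = (/ s) ^ 2 * B10 n (/ s).
Proof.
intros Hs; induction n as [|n IH]; [simpl; ring|].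
assert (Hn := pos_INR n); simpl c10; simpl B10; rewrite IH; field; lra.
Qed.

Lemma continuous_B10 (n : nat) : continuous (B10 n) 0.
Proof.
induction n as [|n IH]; [apply continuous_const|].
apply (continuous_mult (B10 n)); [exact IH|].
apply (ex_derive_continuous (V := R_NormedModule)); auto_derive; lra.
Qed.

Lemma c10_bound (n : nat) (s : R) : 0 < s -> Rabs (c10 n s) <= 1 * (/ s) ^ 2.
Proof.
intros Hs; rewrite Rmult_1_l; induction n as [|n IH].
- simpl; apply Req_le, Rabs_pos_eq.
  assert (0 < / s) by now apply Rinv_0_lt_compat. nra.
- assert (Hn := pos_INR n).
  rewrite <- (Rmult_1_r ((/ s) ^ 2)).
  apply Rabs_le_mult; [exact IH|].
  apply Rabs_div_le; [apply pow_lt; lra|].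
  replace (1 * (s + INR n + 1) ^ 2) with ((s + INR n + 1) * (s + INR n + 1)) by ring.
  apply Rabs_le_mult; apply Rabs_le; lra.
Qed.

Lemma c10_at_1 (n : nat) : c10 (S n) 1 = 0.
Proof.
induction n as [|n IH]; [simpl; field|].
replace (c10 (S (S n)) 1) with
  (c10 (S n) 1 * (- (INR (S n) + 1) * (1 - (INR (S n) + 1)) / (1 + INR (S n) + 1) ^ 2))
  by reflexivity.
rewrite IH; ring.
Qed.

Definition f10 (n m : nat) : R := c10 n (INR m + 1).

Lemma f10_bound (n m : nat) : Rabs (f10 n m) <= 1 * (/ (INR m + 1)) ^ 2.
Proof. apply c10_bound; generalize (pos_INR m); lra. Qed.

Lemma ex_series_f10 (n : nat) : ex_series (f10 n).
Proof. apply ex_series_bound_sq with 1 1; [lra | apply f10_bound]. Qed.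

(** Unlike [G14], this certificate vanishes at infinity, so the positive integers alone suffice. *)
Lemma G10_lim (k : nat) : is_lim_seq (fun m => G10 k (INR m + 1)) 0.
Proof.
assert (Hk := pos_INR k).
set (n := INR k + 1).
set (G := fun u => (u * (1 - n * u) * (n * (1 - (6 * n + 3) * u
   - (11 * n ^ 2 + 9 * n + 2) * u ^ 2)) / (1 + n * u) ^ 2) * B10 k u).
replace (Finite 0) with (Finite (G 0)) by (f_equal; unfold G; field).
apply is_lim_seq_at_infinity; [lra| |].
- apply (continuous_mult (K := R_AbsRing)); [|apply continuous_B10].
  apply (ex_derive_continuous (V := R_NormedModule)); auto_derive; lra.
- intros s Hs; unfold G10, G, x10; fold n; rewrite c10_B10 by exact Hs.
  replace (s + INR k + 1) with (s + n) by (unfold n; ring).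
  assert (0 < n) by (unfold n; lra).
  field; lra.
Qed.

Lemma Series_f10_rec (k : nat) :
  (INR k + 2) ^ 2 * Series (f10 (S (S k))) =
  (11 * (INR k + 2) ^ 2 - 11 * (INR k + 2) + 3) * Series (f10 (S k))
    + (INR k + 1) ^ 2 * Series (f10 k).
Proof.
apply Series_telescope2 with (fun m => G10 k (INR m + 1)); try apply ex_series_f10.
- intros m; assert (Hm := pos_INR m); rewrite S_INR; unfold f10.
  apply c10_telescope; lra.
- simpl INR; rewrite !Rplus_0_l.
  unfold G10; destruct k as [|k]; [simpl; field|].
  rewrite c10_at_1; field; generalize (pos_INR (S k)); lra.
- apply G10_lim.
Qed.

Lemma Series_f10_0 : Series (f10 0) = zeta 2.
Proof. apply is_series_unique, (is_series_zeta 0). Qed.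

Lemma Series_f10_1 : Series (f10 1) = 3 * Series (f10 0) - 5.
Proof.
rewrite (Series_telescope1 (f10 0) (f10 1) (fun m =>
  0 / (INR m + 1) ^ 3 + 2 / (INR m + 1) ^ 2 + 3 / (INR m + 1)) 3).
- simpl; field.
- apply ex_series_f10.
- intros m; assert (Hm := pos_INR m); unfold f10; rewrite S_INR; simpl; field; lra.
- apply is_lim_seq_pole; lra.
Qed.

(* The series satisfies the second-order recurrence of Apery for [zeta 2]; multiplying by the
   central binomial coefficients turns it into the recurrence of [V10]. *)
Fixpoint central_binom (n : nat) : R := match n with
  | O => 1
  | S k => central_binom k * (2 * (2 * INR k + 1) / (INR k + 1))
  end.

Lemma central_binom_bound (n : nat) : 0 < central_binom n <= 4 ^ n.
Proof.
induction n as [|n IH]; [simpl; lra|].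
assert (Hn := pos_INR n); simpl.
assert (0 < 2 * (2 * INR n + 1) / (INR n + 1)) by (apply Rdiv_lt_0_compat; lra).
assert (2 * (2 * INR n + 1) / (INR n + 1) <= 4).
{ apply Rmult_le_reg_r with (INR n + 1); [lra|].
  unfold Rdiv; rewrite Rmult_assoc, Rinv_l; lra. }
nra.
Qed.

Lemma limit_V10 (a b : nat -> R) :
  solves V10 a -> solves V10 b -> a 0%nat = 1 -> a 1%nat = recP V10 1 ->
  b 0%nat = 0 -> b 1%nat = 1 -> is_lim_seq (fun n => b n / a n) (zeta 2 / 10).
Proof.
intros Ha Hb a0 a1 b0 b1.
set (S0 := Series (fun m => (/ (INR m + 1)) ^ 2)).
assert (HS : 0 <= 1 * S0).
{ eapply Rle_trans; [apply Rabs_pos|].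
  apply (Series_bound_sq (f10 0)); [lra | apply f10_bound]. }
apply (apery_limit_geom V10 a b (fun n => central_binom n * Series (f10 n)) (-10) (zeta 2 / 10) S0);
  auto; try discriminate; try lra.
- intros k; assert (Hk := pos_INR k); assert (E := Series_f10_rec k).
  cbn [central_binom]; rewrite S_INR.
  (* The ratio of central binomials absorbs one factor [INR k + 2] and leaves the coefficient of
     [Series_f10_rec]. *)
  replace ((INR k + 2) ^ 3 * _) with
    (central_binom k * (2 * (2 * INR k + 1) / (INR k + 1)) * (2 * (2 * INR k + 3)) *
      ((INR k + 2) ^ 2 * Series (f10 (S (S k))))) by (field; lra).
  rewrite E; unfold recP, recQ; field; lra.
- rewrite Series_f10_0; simpl; field.
- rewrite Series_f10_1, Series_f10_0; simpl; field.
- intros n.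
  assert (H := Series_bound_sq (f10 n) 1 1 ltac:(lra) (f10_bound n)); fold S0 in H.
  destruct (central_binom_bound n) as [H1 H2].
  rewrite Rabs_mult, (Rabs_pos_eq (central_binom n)) by lra.
  assert (Hn := pos_INR n).
  apply Rle_trans with (4 ^ n * (1 * S0)).
  + apply Rmult_le_compat; auto using Rabs_pos; lra.
  + assert (0 < 4 ^ n) by (apply pow_lt; lra). assert (0 <= S0 * INR n) by nra. nra.
Qed.

(** * Series of derivatives of squares *)

(** The summands [2 * f * df] are derivatives of [f ^ 2]; for [f = / s] they are third powers,
    whence [zeta 3]. The constants stay explicit because their dependence on the index of the
    solution decides its growth. *)
Definition tame (f df : R -> R) (C D : R) : Prop := forall s, 0 < s ->
  is_derive f s (df s) /\ Rabs (f s) <= C * / s /\ Rabs (df s) <= D * (/ s) ^ 2.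

Lemma tame_sq_bound (f df : R -> R) (C D h : R) (m : nat) : 0 < h -> tame f df C D ->
  Rabs (2 * f (INR m + h) * df (INR m + h)) <= 2 * (C * D) * / h * (/ (INR m + h)) ^ 2.
Proof.
intros Hh T; assert (Hm := pos_INR m).
destruct (T (INR m + h) ltac:(lra)) as [_ [H1 H2]].
set (u := / (INR m + h)) in *.
assert (Hu : 0 < u) by (apply Rinv_0_lt_compat; lra).
assert (Hu' : u <= / h) by (apply Rinv_le_contravar; lra).
rewrite Rmult_assoc, Rabs_mult, (Rabs_pos_eq 2) by lra.
assert (H3 := Rabs_le_mult _ _ _ _ H1 H2).
apply Rle_trans with (2 * (C * u * (D * u ^ 2))); [lra|].
replace (2 * (C * u * (D * u ^ 2))) with (2 * (C * D) * u ^ 2 * u) by ring.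
replace (2 * (C * D) * / h * u ^ 2) with (2 * (C * D) * u ^ 2 * / h) by ring.
apply Rmult_le_compat_l; [|exact Hu'].
assert (Hu2 : 0 < u ^ 2) by (apply pow_lt; lra).
assert (0 <= C * u) by (eapply Rle_trans; [apply Rabs_pos | exact H1]).
assert (0 <= D * u ^ 2) by (eapply Rle_trans; [apply Rabs_pos | exact H2]).
assert (0 <= C) by (apply Rmult_le_reg_r with u; lra).
assert (0 <= D) by (apply Rmult_le_reg_r with (u ^ 2); lra).
assert (0 <= C * D) by now apply Rmult_le_pos.
nra.
Qed.

Lemma is_derive_square (f df : R -> R) (s : R) :
  is_derive f s (df s) -> is_derive (fun t => f t ^ 2) s (2 * f s * df s).
Proof.
intros H; generalize (is_derive_pow f 2 s _ H); simpl.
replace ((1 + 1) * df s * (f s * 1)) with (2 * f s * df s) by ring; auto.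
Qed.

(** The telescoping identity between squares is differentiated in [s] before it is summed. As the
    certificate contains [g ^ 2], the single condition [g h = 0] makes its derivative vanish at the
    start as well. *)
Lemma Series_derive_rec (f0 f1 f2 df0 df1 df2 g dg x dx : R -> R)
  (al be ga h C0 C1 C2 Cg D0 D1 D2 Dg Cx : R) : 0 < h ->
  tame f0 df0 C0 D0 -> tame f1 df1 C1 D1 -> tame f2 df2 C2 D2 -> tame g dg Cg Dg ->
  (forall s, is_derive x s (dx s)) ->
  (forall s, h <= s -> Rabs (x s) <= Cx * s ^ 2 /\ Rabs (dx s) <= Cx * s) ->
  (forall s, 0 < s ->
    al * f2 s ^ 2 - be * f1 s ^ 2 - ga * f0 s ^ 2
    = x (s + 1) * g (s + 1) ^ 2 - x s * g s ^ 2) ->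
  g h = 0 ->
  al * Series (fun m => 2 * f2 (INR m + h) * df2 (INR m + h)) =
  be * Series (fun m => 2 * f1 (INR m + h) * df1 (INR m + h)) +
  ga * Series (fun m => 2 * f0 (INR m + h) * df0 (INR m + h)).
Proof.
intros Hh T0 T1 T2 Tg Dx Bx E gh.
apply Series_telescope2 with (fun m =>
  dx (INR m + h) * g (INR m + h) ^ 2 + x (INR m + h) * (2 * g (INR m + h) * dg (INR m + h))).
- apply ex_series_bound_sq with h (2 * (C0 * D0) * / h); [lra|]; intros; now apply tame_sq_bound.
- apply ex_series_bound_sq with h (2 * (C1 * D1) * / h); [lra|]; intros; now apply tame_sq_bound.
- apply ex_series_bound_sq with h (2 * (C2 * D2) * / h); [lra|]; intros; now apply tame_sq_bound.
- intros m; rewrite S_INR; assert (Hm := pos_INR m).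
  replace (INR m + 1 + h) with (INR m + h + 1) by ring.
  set (s := INR m + h) in *; assert (Hs : 0 < s) by (unfold s; lra).
  assert (L : is_derive (fun t => al * f2 t ^ 2 - be * f1 t ^ 2 - ga * f0 t ^ 2) s
     (al * (2 * f2 s * df2 s) - be * (2 * f1 s * df1 s) - ga * (2 * f0 s * df0 s))).
  { apply (is_derive_minus (K := R_AbsRing) (V := R_NormedModule)
      (fun t => al * f2 t ^ 2 - be * f1 t ^ 2) (fun t => ga * f0 t ^ 2)).
    - apply (is_derive_minus (K := R_AbsRing) (V := R_NormedModule)
        (fun t => al * f2 t ^ 2) (fun t => be * f1 t ^ 2)).
      + apply (is_derive_scal (fun t => f2 t ^ 2)), is_derive_square, T2, Hs.
      + apply (is_derive_scal (fun t => f1 t ^ 2)), is_derive_square, T1, Hs.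
    - apply (is_derive_scal (fun t => f0 t ^ 2)), is_derive_square, T0, Hs. }
  assert (D : forall t, 0 < t -> is_derive (fun t => x t * g t ^ 2) t
     (dx t * g t ^ 2 + x t * (2 * g t * dg t))).
  { intros t Ht; apply (is_derive_mult (K := R_AbsRing) x (fun t => g t ^ 2)).
    - apply Dx.
    - apply is_derive_square, Tg, Ht.
    - intros; apply Rmult_comm. }
  assert (R : is_derive (fun t => x (t + 1) * g (t + 1) ^ 2 - x t * g t ^ 2) s
     (dx (s + 1) * g (s + 1) ^ 2 + x (s + 1) * (2 * g (s + 1) * dg (s + 1))
       - (dx s * g s ^ 2 + x s * (2 * g s * dg s)))).
  { apply (is_derive_minus (K := R_AbsRing) (V := R_NormedModule)
      (fun t => x (t + 1) * g (t + 1) ^ 2)); [|now apply D].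
    generalize (is_derive_comp (fun t => x t * g t ^ 2) (fun t => t + 1) s _ 1
      (D (s + 1) ltac:(lra)) ltac:(auto_derive; [exact I | ring])).
    unfold scal; simpl; unfold mult; simpl; rewrite Rmult_1_l; auto. }
  rewrite <- (is_derive_unique _ _ _ L), <- (is_derive_unique _ _ _ R).
  apply Derive_ext_loc.
  (* The identity [E] holds on the ball of radius [s] about [s], which stays among positive
     numbers. *)
  exists (mkposreal s Hs); intros t Ht; apply E.
  unfold ball in Ht; simpl in Ht; unfold AbsRing_ball, abs, minus, plus, opp in Ht; simpl in Ht.
  apply Rabs_def2 in Ht; lra.
- simpl INR; rewrite !Rplus_0_l, gh; ring.
- apply is_lim_seq_abs_0.
  (* A quadratic times [g ^ 2] is bounded, and differentiation gains one power of [s]. *)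
  apply is_lim_seq_le_le with (fun _ => 0) (fun m => Cx * Cg * (Cg + 2 * Dg) * / (INR m + h)).
  + intros m; split; [apply Rabs_pos|].
    assert (Hm := pos_INR m); set (s := INR m + h) in *.
    assert (Hs : 0 < s) by (unfold s; lra).
    destruct (Tg s Hs) as [_ [H1 H2]].
    destruct (Bx s ltac:(unfold s; lra)) as [H3 H4].
    eapply Rle_trans; [apply Rabs_triang|].
    assert (K1 := Rabs_le_mult _ _ _ _ H4 (Rabs_le_mult _ _ _ _ H1 H1)).
    assert (K2 := Rabs_le_mult _ _ _ _ H3 (Rabs_le_mult _ _ _ _ H1 H2)).
    replace (dx s * g s ^ 2) with (dx s * (g s * g s)) by ring.
    replace (x s * (2 * g s * dg s)) with (2 * (x s * (g s * dg s))) by ring.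
    rewrite (Rabs_mult 2), (Rabs_pos_eq 2) by lra.
    replace (Cx * Cg * (Cg + 2 * Dg) * / s) with
      (Cx * s * (Cg * / s * (Cg * / s)) + 2 * (Cx * s ^ 2 * (Cg * / s * (Dg * (/ s) ^ 2))))
      by (field; lra).
    lra.
  + apply is_lim_seq_const.
  + replace (Finite 0) with (Rbar_mult (Cx * Cg * (Cg + 2 * Dg)) 0) by (simpl; f_equal; ring).
    apply is_lim_seq_scal_l, is_lim_seq_inv_shift.
Qed.

Lemma tame_mult (f df q dq : R -> R) (C D A B C' D' : R) : tame f df C D ->
  (forall s, 0 < s -> is_derive q s (dq s) /\ Rabs (q s) <= A /\ Rabs (dq s) <= B * / s) ->
  C * A <= C' -> D * A + C * B <= D' ->
  tame (fun s => f s * q s) (fun s => df s * q s + f s * dq s) C' D'.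
Proof.
intros T Q HA HB s Hs.
destruct (T s Hs) as [T1 [T2 T3]], (Q s Hs) as [Q1 [Q2 Q3]].
assert (Hu : 0 < / s) by now apply Rinv_0_lt_compat.
split; [|split].
- apply (is_derive_mult (K := R_AbsRing)); auto; intros; apply Rmult_comm.
- eapply Rle_trans; [apply (Rabs_le_mult _ _ _ _ T2 Q2)|].
  replace (C * / s * A) with (C * A * / s) by ring.
  apply Rmult_le_compat_r; lra.
- eapply Rle_trans; [apply Rabs_triang|].
  assert (K1 := Rabs_le_mult _ _ _ _ T3 Q2).
  assert (K2 := Rabs_le_mult _ _ _ _ T2 Q3).
  apply Rle_trans with ((D * A + C * B) * (/ s) ^ 2); [lra|].
  apply Rmult_le_compat_r; [apply pow2_ge_0 | lra].
Qed.

Lemma tame_inv : tame (fun s => / s) (fun s => - (/ s) ^ 2) 1 1.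
Proof.
intros s Hs; assert (Hu : 0 < / s) by now apply Rinv_0_lt_compat.
split; [|split].
- auto_derive; [lra | field; lra].
- rewrite Rabs_pos_eq; lra.
- rewrite Rabs_Ropp, Rabs_pos_eq; [lra | apply pow2_ge_0].
Qed.

Lemma Series_tame_bound (f df : R -> R) (C D h : R) : 0 < h -> tame f df C D ->
  Rabs (Series (fun m => 2 * f (INR m + h) * df (INR m + h))) <=
  C * D * (2 * / h * Series (fun m => (/ (INR m + h)) ^ 2)).
Proof.
intros Hh T.
eapply Rle_trans; [apply (Series_bound_sq _ h (2 * (C * D) * / h)); [exact Hh|]|].
- intros m; now apply tame_sq_bound.
- right; ring.
Qed.

Lemma ex_series_tame (f df : R -> R) (C D h : R) : 0 < h -> tame f df C D ->
  ex_series (fun m => 2 * f (INR m + h) * df (INR m + h)).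
Proof.
intros Hh T; apply ex_series_bound_sq with h (2 * (C * D) * / h); [exact Hh|].
intros m; now apply tame_sq_bound.
Qed.

Lemma Series_inv_sq_pos (h : R) : 0 < h -> 0 <= Series (fun m => (/ (INR m + h)) ^ 2).
Proof.
intros Hh.
apply Rle_trans with (Series (fun m => 0 * (/ (INR m + h)) ^ 2)).
- rewrite Series_scal_l; lra.
- apply Series_le; [|now apply ex_series_inv_sq_shift].
  intros m; assert (0 <= (/ (INR m + h)) ^ 2) by apply pow2_ge_0; lra.
Qed.

(** * Degree 12 *)

(** The function (s-1)...(s-n) / (s(s+1)...(s+n)), whose square is the classical one for
    [zeta 3]. *)
Fixpoint r12 (n : nat) (s : R) : R := match n with
  | O => / s
  | S k => r12 k s * ((s - (INR k + 1)) / (s + INR k + 1))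
  end.

Fixpoint dr12 (n : nat) (s : R) : R := match n with
  | O => - (/ s) ^ 2
  | S k => dr12 k s * ((s - (INR k + 1)) / (s + INR k + 1))
           + r12 k s * (2 * (INR k + 1) / (s + INR k + 1) ^ 2)
  end.

Lemma tame_r12 (n : nat) : tame (r12 n) (dr12 n) 1 (2 * INR n + 1).
Proof.
induction n as [|n IH].
- simpl INR; replace (2 * 0 + 1) with 1 by ring; exact tame_inv.
- apply (tame_mult _ _ (fun s => (s - (INR n + 1)) / (s + INR n + 1))
    (fun s => 2 * (INR n + 1) / (s + INR n + 1) ^ 2) _ _ 1 2 _ _ IH).
  + intros s Hs; assert (Hn := pos_INR n); split; [|split].
    * auto_derive; [lra | field; lra].
    * apply Rabs_div_le; [lra|]; apply Rabs_le; lra.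
    * apply Rabs_div_le; [apply pow_lt; lra|].
      rewrite Rabs_pos_eq by lra.
      apply Rmult_le_reg_l with s; [exact Hs|].
      replace (s * (2 * / s * (s + INR n + 1) ^ 2)) with (2 * (s + INR n + 1) ^ 2) by (field; lra).
      nra.
  + lra.
  + rewrite S_INR; lra.
Qed.

Lemma r12_shift (n : nat) (s : R) : 0 < s ->
  r12 n (s + 1) * ((s - INR n) * (s + INR n + 1)) = r12 n s * s ^ 2.
Proof.
intros Hs; induction n as [|n IH].
- simpl; field; lra.
- assert (Hn := pos_INR n); simpl r12; rewrite S_INR.
  replace (r12 n (s + 1) * _ * _) with
    (r12 n (s + 1) * ((s - INR n) * (s + INR n + 1)) * ((s - INR n - 1) / (s + INR n + 1)))
    by (field; lra).
  rewrite IH; field; lra.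
Qed.

Lemma r12_at_1 (n : nat) : r12 (S n) 1 = 0.
Proof.
induction n as [|n IH]; [simpl; field|].
replace (r12 (S (S n)) 1) with
  (r12 (S n) 1 * ((1 - (INR (S n) + 1)) / (1 + INR (S n) + 1))) by reflexivity.
rewrite IH; ring.
Qed.

Definition I12 (n : nat) : R := Series (fun m => 2 * r12 n (INR m + 1) * dr12 n (INR m + 1)).

(** One constant serves the quadratic and its derivative: for [h <= s] lower powers of [s] are
    raised by [1 <= s * / h]. *)
Lemma quadratic_bound (a b c s h : R) : 0 < h -> h <= s ->
  Rabs (a * s ^ 2 + b * s + c) <= (2 * Rabs a + Rabs b * / h + Rabs b + Rabs c * / h ^ 2) * s ^ 2
  /\ Rabs (2 * a * s + b) <= (2 * Rabs a + Rabs b * / h + Rabs b + Rabs c * / h ^ 2) * s.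
Proof.
intros Hh Hs.
assert (Ha := Rabs_pos a); assert (Hb := Rabs_pos b); assert (Hc := Rabs_pos c).
assert (H1 : 1 <= s * / h).
{ apply Rmult_le_reg_r with h; [lra|]; rewrite Rmult_assoc, Rinv_l; lra. }
assert (H2 : 1 <= s ^ 2 * / h ^ 2).
{ rewrite <- pow_inv, <- Rpow_mult_distr; apply pow_R1_Rle; lra. }
assert (Hi : 0 < / h) by now apply Rinv_0_lt_compat.
assert (Hi2 : 0 < / h ^ 2) by (apply Rinv_0_lt_compat, pow_lt; lra).
split.
- eapply Rle_trans; [apply Rabs_triang|].
  eapply Rle_trans; [apply Rplus_le_compat_r, Rabs_triang|].
  rewrite !Rabs_mult, (Rabs_pos_eq (s ^ 2)), (Rabs_pos_eq s) by (try apply pow2_ge_0; lra).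
  assert (Rabs b * s <= Rabs b * / h * s ^ 2).
  { replace (Rabs b * / h * s ^ 2) with (Rabs b * s * (s * / h)) by ring.
    rewrite <- (Rmult_1_r (Rabs b * s)) at 1; apply Rmult_le_compat_l; [nra | lra]. }
  assert (Rabs c <= Rabs c * / h ^ 2 * s ^ 2).
  { replace (Rabs c * / h ^ 2 * s ^ 2) with (Rabs c * (s ^ 2 * / h ^ 2)) by ring.
    rewrite <- (Rmult_1_r (Rabs c)) at 1; apply Rmult_le_compat_l; lra. }
  assert (0 <= s ^ 2) by apply pow2_ge_0.
  assert (0 <= Rabs a * s ^ 2) by (apply Rmult_le_pos; lra).
  assert (0 <= Rabs b * s ^ 2) by (apply Rmult_le_pos; lra).
  lra.
- eapply Rle_trans; [apply Rabs_triang|].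
  rewrite !Rabs_mult, (Rabs_pos_eq s), (Rabs_pos_eq 2) by lra.
  assert (Rabs b <= Rabs b * / h * s).
  { replace (Rabs b * / h * s) with (Rabs b * (s * / h)) by ring.
    rewrite <- (Rmult_1_r (Rabs b)) at 1; apply Rmult_le_compat_l; lra. }
  assert (0 <= Rabs b * s) by (apply Rmult_le_pos; lra).
  assert (0 <= Rabs c * / h ^ 2 * s) by (apply Rmult_le_pos; [apply Rmult_le_pos|]; lra).
  lra.
Qed.

Lemma I12_solves : solves V12 I12.
Proof.
intros k; assert (Hk := pos_INR k); unfold I12.
set (n := INR k + 1).
(* The quadratic is -4(2n+1)(s(2s-1) - (2n+1)^2): the known certificate for Apery's recurrence with
   the summation index replaced by -s. *)
pose (A := -8 * (2 * n + 1)); pose (B := 4 * (2 * n + 1)); pose (C := 4 * (2 * n + 1) ^ 3).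
apply (Series_derive_rec _ _ _ _ _ _ (r12 (S k)) (dr12 (S k)) (fun s => A * s ^ 2 + B * s + C)
  (fun s => 2 * A * s + B) _ _ _ 1 _ _ _ _ _ _ _ _
  (2 * Rabs A + Rabs B * / 1 + Rabs B + Rabs C * / 1 ^ 2) Rlt_0_1
  (tame_r12 _) (tame_r12 _) (tame_r12 _) (tame_r12 _)).
- intros s; auto_derive; [exact I | ring].
- intros s Hs; apply quadratic_bound; lra.
- intros s Hs; assert (H := r12_shift k s Hs).
  cbn [r12]; rewrite S_INR.
  replace (r12 k (s + 1) * ((s + 1 - (INR k + 1)) / (s + 1 + INR k + 1))) with
    (r12 k (s + 1) * ((s - INR k) * (s + INR k + 1)) / ((s + INR k + 1) * (s + INR k + 2)))
    by (field; lra).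
  rewrite H; unfold A, B, C, n, recP, recQ; field; lra.
- apply r12_at_1.
Qed.

Lemma I12_0 : I12 0 = - 2 * zeta 3.
Proof.
apply is_series_unique.
replace (- 2 * zeta 3) with (- 2 * zeta 3 + 0 * zeta 3) by ring.
eapply is_series_ext; [|apply (is_series_lin _ _ (-2) 0 _ _ (is_series_zeta 1) (is_series_zeta 1))].
intros m; simpl; ring.
Qed.

Lemma I12_1 : I12 1 = 5 * I12 0 + 12.
Proof.
unfold I12.
rewrite (Series_telescope1 (fun m => 2 * r12 0 (INR m + 1) * dr12 0 (INR m + 1)) _ (fun m =>
  (-8) / (INR m + 1) ^ 3 + (-4) / (INR m + 1) ^ 2 + 0 / (INR m + 1)) 5).
- simpl; field.
- apply ex_series_tame with (2 := tame_r12 0); lra.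
- intros m; assert (Hm := pos_INR m); rewrite S_INR; simpl; field; lra.
- apply is_lim_seq_pole; lra.
Qed.

Lemma limit_V12 (a b : nat -> R) :
  solves V12 a -> solves V12 b -> a 0%nat = 1 -> a 1%nat = recP V12 1 ->
  b 0%nat = 0 -> b 1%nat = 1 -> is_lim_seq (fun n => b n / a n) (zeta 3 / 6).
Proof.
intros Ha Hb a0 a1 b0 b1.
set (S0 := 2 * / 1 * Series (fun m => (/ (INR m + 1)) ^ 2)).
assert (HS : 0 <= S0) by (assert (H := Series_inv_sq_pos 1 Rlt_0_1); unfold S0; lra).
apply (apery_limit_geom V12 a b I12 12 (zeta 3 / 6) (2 * S0));
  auto using I12_solves; try discriminate; try lra.
- rewrite I12_0; field.
- rewrite I12_1, I12_0; simpl; field.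
- intros n.
  eapply Rle_trans; [apply (Series_tame_bound _ _ _ _ 1 Rlt_0_1 (tame_r12 n))|].
  fold S0; assert (Hn := pos_INR n).
  assert (1 <= 4 ^ n) by (apply pow_R1_Rle; lra).
  assert (0 <= S0 * INR n) by (apply Rmult_le_pos; lra).
  apply Rle_trans with (2 * S0 * (INR n + 1) * 1); [lra|].
  apply Rmult_le_compat_l; [|lra]. lra.
Qed.

(** * Degree 16 *)

(** The function 2s(2s+1)...(2s+n-1) / (s(s+1)...(s+n)). It has no positive zero, so the certificate
    needs a factor of its own that vanishes at the start. *)
Fixpoint r16 (n : nat) (s : R) : R := match n with
  | O => / s
  | S k => r16 k s * ((2 * s + INR k) / (s + INR k + 1))
  end.

Fixpoint dr16 (n : nat) (s : R) : R := match n with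
  | O => - (/ s) ^ 2
  | S k => dr16 k s * ((2 * s + INR k) / (s + INR k + 1))
           + r16 k s * ((INR k + 2) / (s + INR k + 1) ^ 2)
  end.

Lemma tame_r16 (n : nat) : tame (r16 n) (dr16 n) (2 ^ n) ((INR n + 1) * 2 ^ n).
Proof.
induction n as [|n IH].
- simpl INR; simpl pow; replace ((0 + 1) * 1) with 1 by ring; exact tame_inv.
- apply (tame_mult _ _ (fun s => (2 * s + INR n) / (s + INR n + 1))
    (fun s => (INR n + 2) / (s + INR n + 1) ^ 2) _ _ 2 2 _ _ IH).
  + intros s Hs; assert (Hn := pos_INR n); split; [|split].
    * auto_derive; [lra | field; lra].
    * apply Rabs_div_le; [lra|]; apply Rabs_le; lra.
    * apply Rabs_div_le; [apply pow_lt; lra|].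
      rewrite Rabs_pos_eq by lra.
      apply Rmult_le_reg_l with s; [exact Hs|].
      replace (s * (2 * / s * (s + INR n + 1) ^ 2)) with (2 * (s + INR n + 1) ^ 2) by (field; lra).
      nra.
  + simpl; lra.
  + rewrite S_INR; simpl; lra.
Qed.

Lemma r16_shift (n : nat) (s : R) : 0 < s ->
  r16 n (s + 1) * (2 * (2 * s + 1) * (s + INR n + 1)) =
  r16 n s * ((2 * s + INR n) * (2 * s + INR n + 1)).
Proof.
intros Hs; induction n as [|n IH].
- simpl; field; lra.
- assert (Hn := pos_INR n); simpl r16; rewrite S_INR.
  replace (r16 n (s + 1) * _ * _) with
    (r16 n (s + 1) * (2 * (2 * s + 1) * (s + INR n + 1)) * ((2 * (s + 1) + INR n) / (s + INR n + 1)))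
    by (field; lra).
  rewrite IH; field; lra.
Qed.

Definition I16 (n : nat) : R :=
  Series (fun m => 2 * r16 n (INR m + 1 / 2) * dr16 n (INR m + 1 / 2)).

Lemma I16_solves : solves V16 I16.
Proof.
intros k; assert (Hk := pos_INR k); unfold I16.
set (n := INR k + 1).
pose (A := -4 * (8 * n + 4)); pose (B := -4 * (16 * n ^ 2 + 8 * n));
pose (C := -4 * (7 * n ^ 3 + n ^ 2 - 3 * n - 1)).
(* This function enters the certificate squared. Its factor [2 * s - 1] vanishes at [1 / 2], and
   shifted it is the factor [2 * s + 1] of [r16_shift]. *)
assert (Tg : tame (fun s => r16 k s * ((2 * s - 1) / (s + n)))
  (fun s => dr16 k s * ((2 * s - 1) / (s + n)) + r16 k s * ((2 * n + 1) / (s + n) ^ 2))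
  (2 ^ k * 2) ((INR k + 1) * 2 ^ k * 2 + 2 ^ k * 3)).
{ assert (Hn : 1 <= n) by (unfold n; lra).
  apply (tame_mult _ _ (fun s => (2 * s - 1) / (s + n)) (fun s => (2 * n + 1) / (s + n) ^ 2)
    _ _ 2 3 _ _ (tame_r16 k)); try lra.
  intros s Hs; split; [|split].
  - auto_derive; [lra | field; lra].
  - apply Rabs_div_le; [lra|]; apply Rabs_le; lra.
  - apply Rabs_div_le; [apply pow_lt; lra|].
    rewrite Rabs_pos_eq by lra.
    apply Rmult_le_reg_l with s; [exact Hs|].
    replace (s * (3 * / s * (s + n) ^ 2)) with (3 * (s + n) ^ 2) by (field; lra).
    nra. }
apply (Series_derive_rec _ _ _ _ _ _ _ _ (fun s => A * s ^ 2 + B * s + C)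
  (fun s => 2 * A * s + B) _ _ _ (1 / 2) _ _ _ _ _ _ _ _
  (2 * Rabs A + Rabs B * / (1 / 2) + Rabs B + Rabs C * / (1 / 2) ^ 2) ltac:(lra)
  (tame_r16 _) (tame_r16 _) (tame_r16 _) Tg).
- intros s; auto_derive; [exact I | ring].
- intros s Hs; apply quadratic_bound; lra.
- intros s Hs; assert (H := r16_shift k s Hs).
  cbn [r16]; rewrite S_INR.
  replace (r16 k (s + 1) * ((2 * (s + 1) - 1) / (s + 1 + n))) with
    (r16 k (s + 1) * (2 * (2 * s + 1) * (s + INR k + 1)) / (2 * (s + n) * (s + n + 1)))
    by (unfold n; field; lra).
  rewrite H; unfold A, B, C, n, recP, recQ; field; lra.
- replace (2 * (1 / 2) - 1) with 0 by field; unfold Rdiv; ring.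
Qed.

Lemma I16_0 : I16 0 = - 14 * zeta 3.
Proof.
apply is_series_unique.
replace (- 14 * zeta 3) with (- 2 * ((2 ^ 3 - 1) * zeta 3) + 0 * ((2 ^ 3 - 1) * zeta 3)) by ring.
eapply is_series_ext;
  [|apply (is_series_lin _ _ (-2) 0 _ _ (is_series_half_odd 1) (is_series_half_odd 1))].
intros m; simpl; ring.
Qed.

(** Since [r16 1 s = 2 / (s + 1)], the summands are 4 times those of [I16 0] shifted by one; the
    missing first term, -16, accounts for the 64. *)
Lemma I16_1 : I16 1 = 4 * I16 0 + 64.
Proof.
unfold I16.
rewrite (Series_telescope1 (fun m => 2 * r16 0 (INR m + 1 / 2) * dr16 0 (INR m + 1 / 2)) _
  (fun m => (-8) / (INR m + 1 / 2) ^ 3 + 0 / (INR m + 1 / 2) ^ 2 + 0 / (INR m + 1 / 2)) 4).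
- simpl; field.
- apply ex_series_tame with (2 := tame_r16 0); lra.
- intros m; assert (Hm := pos_INR m); rewrite S_INR; simpl; field; lra.
- apply is_lim_seq_pole; lra.
Qed.

Lemma limit_V16 (a b : nat -> R) :
  solves V16 a -> solves V16 b -> a 0%nat = 1 -> a 1%nat = recP V16 1 ->
  b 0%nat = 0 -> b 1%nat = 1 -> is_lim_seq (fun n => b n / a n) (7 / 32 * zeta 3).
Proof.
intros Ha Hb a0 a1 b0 b1.
set (S0 := 2 * / (1 / 2) * Series (fun m => (/ (INR m + 1 / 2)) ^ 2)).
apply (apery_limit_geom V16 a b I16 64 (7 / 32 * zeta 3) S0);
  auto using I16_solves; try discriminate; try lra.
- rewrite I16_0; field.
- rewrite I16_1, I16_0; simpl; field.
- intros n.
  eapply Rle_trans; [apply (Series_tame_bound _ _ _ _ (1 / 2) ltac:(lra) (tame_r16 n))|].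
  fold S0; right.
  replace (4 ^ n) with (2 ^ n * 2 ^ n) by (rewrite <- Rpow_mult_distr; f_equal; ring).
  ring.
Qed.

(** * Degree 18: the coefficients *)

(* [p18 n k] is the coefficient of [psi^k] in [(3 i sqrt 3)^n P_n((1 + 2 psi) / (i sqrt 3))] with [P_n]
   the Legendre polynomial; [p18_prev n] stands for [p18 (n - 1)], with [p18 (-1) = 0].  The
   identities below are polynomial identities in [psi], read coefficientwise. *)
Fixpoint p18_pair (n : nat) : (Z -> R) * (Z -> R) := match n with
  | O => (fun k => if Z.eqb k 0 then 1 else 0, fun _ => 0)
  | S m => let (u, v) := p18_pair m in
     (fun k => (3 * (2 * INR m + 1) * (u k + 2 * u (k - 1)%Z) + 27 * INR m * v k) / (INR m + 1), u)
  end.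

Definition p18 (n : nat) : Z -> R := fst (p18_pair n).
Definition p18_prev (n : nat) : Z -> R := snd (p18_pair n).

Lemma p18_prev_S (n : nat) (k : Z) : p18_prev (S n) k = p18 n k.
Proof. unfold p18_prev, p18; simpl; now destruct (p18_pair n). Qed.

Lemma p18_rec (n : nat) (k : Z) :
  (INR n + 1) * p18 (S n) k =
  3 * (2 * INR n + 1) * (p18 n k + 2 * p18 n (k - 1)) + 27 * INR n * p18_prev n k.
Proof.
unfold p18, p18_prev; simpl; destruct (p18_pair n) as [u v]; simpl.
generalize (pos_INR n); intros; field; lra.
Qed.

Lemma p18_0 (k : Z) : p18 0 k = if Z.eqb k 0 then 1 else 0.
Proof. reflexivity. Qed.

Lemma p18_prev_0 (k : Z) : p18_prev 0 k = 0.
Proof. reflexivity. Qed.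

Ltac shift_simpl := repeat match goal with |- context [(?k + ?a + ?b)%Z] =>
   let c := eval compute in (a + b)%Z in replace (k + a + b)%Z with (k + c)%Z by ring
 | |- context [(?k + ?a - ?b)%Z] =>
   let c := eval compute in (a - b)%Z in replace (k + a - b)%Z with (k + c)%Z by ring
 | |- context [(?k - ?a)%Z] =>
   let c := eval compute in (- a)%Z in replace (k - a)%Z with (k + c)%Z by ring
 | |- context [(?k + 0)%Z] => replace (k + 0)%Z with k by ring
 end.

(** Legendre's (x^2 - 1) P_n' = n (x P_n - P_(n-1)) and (x^2 - 1) P_(n-1)' = n (P_n - x P_(n-1)); in
    [psi], x^2 - 1 is a multiple of 1 + psi + psi^2. They are proved jointly because the induction
    step for the first uses the second. *)
Lemma p18_first_order (n : nat) :
  (forall k : Z, 2 * (IZR (k + 1) * p18 n (k + 1) + IZR k * p18 n k + IZR (k - 1) * p18 n (k - 1))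
     = INR n * (9 * p18_prev n k + 2 * p18 n (k - 1) + p18 n k)) /\
  (forall k : Z, 2 * (IZR (k + 1) * p18_prev n (k + 1) + IZR k * p18_prev n k
       + IZR (k - 1) * p18_prev n (k - 1))
     = INR n * (p18 n k / 3 - 2 * p18_prev n (k - 1) - p18_prev n k)).
Proof.
induction n as [|n [IH1 IH2]].
- split; intros k; rewrite !p18_prev_0, ?p18_0; simpl (INR 0); [|ring].
  destruct (Z.eqb_spec (k + 1) 0) as [E|E]; destruct (Z.eqb_spec k 0) as [F|F];
    destruct (Z.eqb_spec (k - 1) 0) as [G|G]; try lia; try rewrite E; try rewrite F;
    try rewrite G; ring.
- assert (Hn := pos_INR n).
  assert (E3 : forall k : Z, 2 * (IZR (k + 1) * p18 n (k + 1) + IZR k * p18 n k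
       + IZR (k - 1) * p18 n (k - 1))
     = (INR n + 1) * (p18 (S n) k / 3 - 2 * p18 n (k - 1) - p18 n k)).
  { intros k; rewrite IH1; generalize (p18_rec n k); lra. }
  split; intros k; rewrite ?p18_prev_S, S_INR.
  + apply Rmult_eq_reg_l with (INR n + 1); [|lra].
    (* The first three equations form 2 (1 + psi + psi^2) times the derivative of the recurrence;
       the induction hypotheses replace the derivatives on its right side. *)
    generalize (f_equal (Rmult (2 * IZR (k + 1))) (p18_rec n (k + 1))),
      (f_equal (Rmult (2 * IZR k)) (p18_rec n k)),
      (f_equal (Rmult (2 * IZR (k - 1))) (p18_rec n (k - 1))),
      (f_equal (Rmult (3 * (2 * INR n + 1))) (IH1 k)),
      (f_equal (Rmult (6 * (2 * INR n + 1))) (IH1 (k - 1)%Z)),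
      (f_equal (Rmult (27 * INR n)) (IH2 k)),
      (f_equal (Rmult (INR n + 1)) (p18_rec n k)),
      (f_equal (Rmult (2 * (INR n + 1))) (p18_rec n (k - 1))).
    shift_simpl; rewrite !plus_IZR. lra.
  + apply E3.
Qed.

Lemma p18_deriv_prev (n : nat) (k : Z) :
  2 * (IZR (k + 1) * p18 n (k + 1) + IZR k * p18 n k + IZR (k - 1) * p18 n (k - 1))
     = INR n * (9 * p18_prev n k + 2 * p18 n (k - 1) + p18 n k).
Proof. apply p18_first_order. Qed.

Lemma p18_deriv_next (n : nat) (k : Z) :
  2 * (IZR (k + 1) * p18 n (k + 1) + IZR k * p18 n k + IZR (k - 1) * p18 n (k - 1))
     = (INR n + 1) * (p18 (S n) k / 3 - 2 * p18 n (k - 1) - p18 n k).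
Proof. rewrite p18_deriv_prev; generalize (p18_rec n k); lra. Qed.

(** The identities x P_n' - P_(n-1)' = n P_n and P_n' - x P_(n-1)' = n P_(n-1). *)
Lemma p18_derivatives (n : nat) :
  (forall k : Z, 2 * IZR k * p18 n k + IZR (k + 1) * (p18 n (k + 1) + 9 * p18_prev n (k + 1))
     = 2 * INR n * p18 n k) /\
  (forall k : Z, IZR (k + 1) * p18 n (k + 1) =
     3 * (2 * IZR k * p18_prev n k + IZR (k + 1) * p18_prev n (k + 1)) + 6 * INR n * p18_prev n k).
Proof.
induction n as [|n [F1 F2]].
- split; intros k; rewrite !p18_prev_0, ?p18_0; simpl (INR 0);
  destruct (Z.eqb_spec (k + 1) 0) as [E|E]; destruct (Z.eqb_spec k 0) as [F|F];
    try lia; try rewrite E; try rewrite F; ring.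
- assert (Hn := pos_INR n).
  assert (F2' : forall k : Z, IZR (k + 1) * p18 (S n) (k + 1) =
     3 * (2 * IZR k * p18 n k + IZR (k + 1) * p18 n (k + 1)) + 6 * (INR n + 1) * p18 n k).
  { intros k; apply Rmult_eq_reg_l with (INR n + 1); [|lra].
    generalize (f_equal (Rmult (IZR (k + 1))) (p18_rec n (k + 1))),
     (f_equal (Rmult (3 * INR n)) (F1 k)).
    shift_simpl; rewrite !plus_IZR; lra. }
  split; intros k; rewrite ?p18_prev_S, S_INR; [|apply F2'].
  generalize (F2' k), (F2' (k - 1)%Z), (p18_deriv_next n k).
  shift_simpl; rewrite !plus_IZR; lra.
Qed.

(** The identity P_(n+1)' - P_(n-1)' = (2n+1) P_n; it supplies the antiderivative used in
    [pair18_balanced]. *)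
Lemma p18_deriv_sum (n : nat) (k : Z) :
  IZR (k + 1) * (p18 (S n) (k + 1) + 27 * p18_prev n (k + 1)) = 6 * (2 * INR n + 1) * p18 n k.
Proof.
destruct (p18_derivatives n) as [F1 _]; destruct (p18_derivatives (S n)) as [_ F2].
generalize (F1 k), (F2 k); rewrite !p18_prev_S, S_INR; lra.
Qed.

(** Legendre's differential equation, here ((1 + psi + psi^2) p')' = n (n+1) p. *)
Lemma p18_ode (n : nat) (k : Z) :
  IZR (k + 2) * IZR (k + 1) * p18 n (k + 2) + IZR (k + 1) * IZR (k + 1) * p18 n (k + 1)
   + IZR k * IZR (k + 1) * p18 n k = INR n * (INR n + 1) * p18 n k.
Proof.
destruct (p18_derivatives n) as [F1 _].
generalize (f_equal (Rmult (INR n)) (F1 k)), (f_equal (Rmult (IZR (k + 1))) (p18_deriv_prev n (k + 1))).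
shift_simpl; rewrite !plus_IZR; lra.
Qed.

(** The polynomials miss the recurrence of [V18] by 6 (2n+1) times theta^2 (psi p) - p'', with theta
    = psi d/dpsi. This operator links coefficients three places apart, hence so does its adjoint,
    the recurrence for [e]. *)
Lemma p18_key (n : nat) (k : Z) :
  (INR n + 1) ^ 3 * p18 (S n) k - 3 * (2 * INR n + 1) * (3 * INR n ^ 2 + 3 * INR n + 1) * p18 n k
    - 27 * INR n ^ 3 * p18_prev n k =
  6 * (2 * INR n + 1) * (IZR k ^ 2 * p18 n (k - 1) - IZR (k + 1) * IZR (k + 2) * p18 n (k + 2)).
Proof.
generalize (f_equal (Rmult ((INR n + 1) ^ 2)) (p18_rec n k)),
  (f_equal (Rmult (6 * (2 * INR n + 1))) (p18_ode n (k - 1))),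
  (f_equal (Rmult (6 * (2 * INR n + 1))) (p18_ode n k)),
  (f_equal (Rmult (3 * (2 * INR n + 1))) (p18_deriv_prev n k)),
  (f_equal (Rmult (3 * (2 * INR n + 1) * INR n)) (p18_deriv_prev n k)).
shift_simpl; rewrite !plus_IZR; simpl pow.
lra.
Qed.

Lemma p18_support (n : nat) (k : Z) : (k < 0 \/ Z.of_nat n < k)%Z ->
  p18 n k = 0 /\ p18_prev n k = 0.
Proof.
revert k; induction n as [|n IH]; intros k Hk.
- rewrite p18_0, p18_prev_0; destruct (Z.eqb_spec k 0); [lia | auto].
- rewrite p18_prev_S; assert (Hn := pos_INR n).
  destruct (IH k) as [E1 E2]; [lia|]; destruct (IH (k - 1)%Z) as [E3 _]; [lia|].
  split; [|exact E1].
  apply Rmult_eq_reg_l with (INR n + 1); [|lra].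
  rewrite p18_rec, E1, E2, E3; ring.
Qed.

Lemma p18_nonneg (n : nat) (k : Z) : 0 <= p18 n k /\ 0 <= p18_prev n k.
Proof.
revert k; induction n as [|n IH]; intros k.
- rewrite p18_0, p18_prev_0; destruct (Z.eqb k 0); lra.
- rewrite p18_prev_S; assert (Hn := pos_INR n); split; [|apply IH].
  destruct (IH k), (IH (k - 1)%Z).
  apply Rmult_le_reg_l with (INR n + 1); [lra|].
  rewrite p18_rec, Rmult_0_r.
  apply Rplus_le_le_0_compat; apply Rmult_le_pos; try apply Rmult_le_pos; lra.
Qed.

(** * Pairing the coefficients with sequences *)

Definition q18 (n k : nat) : R := p18 n (Z.of_nat k).

Lemma q18_support (n k : nat) : (n < k)%nat -> q18 n k = 0.
Proof. intros H; apply p18_support; lia. Qed.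

Lemma q18_nonneg (n k : nat) : 0 <= q18 n k.
Proof. apply p18_nonneg. Qed.

Definition pair18 (c : nat -> R) (n : nat) : R := sum_f_R0 (fun k => q18 n k * c k) n.

Lemma pair18_extend (c : nat -> R) (n d : nat) :
  sum_f_R0 (fun k => q18 n k * c k) (n + d) = pair18 c n.
Proof.
induction d as [|d IH]; [now rewrite Nat.add_0_r|].
rewrite Nat.add_succ_r; simpl; rewrite IH, q18_support by lia; ring.
Qed.

Lemma pair18_extend_le (c : nat -> R) (n N : nat) : (n <= N)%nat ->
  sum_f_R0 (fun k => q18 n k * c k) N = pair18 c n.
Proof.
intros H; rewrite <- (pair18_extend c n (N - n)); f_equal; lia.
Qed.

Lemma sum_f_R0_lin (f g : nat -> R) (x y : R) (N : nat) :
  sum_f_R0 (fun k => x * f k + y * g k) N = x * sum_f_R0 f N + y * sum_f_R0 g N.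
Proof. induction N as [|N IH]; simpl; [|rewrite IH]; ring. Qed.

Lemma pair18_lin (c d : nat -> R) (x y : R) (n : nat) :
  pair18 (fun k => x * c k + y * d k) n = x * pair18 c n + y * pair18 d n.
Proof.
unfold pair18; rewrite <- sum_f_R0_lin; apply sum_eq; intros; ring.
Qed.

Lemma pair18_ext (c d : nat -> R) (n : nat) :
  (forall k, c k = d k) -> pair18 c n = pair18 d n.
Proof. intros H; unfold pair18; apply sum_eq; intros; now rewrite H. Qed.

(* Summation by parts against the right-hand side of [p18_key]. *)
Lemma pair18_defect (e tau : nat -> R) (n N : nat) :
  (forall k, (INR k + 1) ^ 2 * e (S k) - INR k * (INR k - 1) * e (k - 2)%nat = tau k) ->
  sum_f_R0 (fun k => (INR k ^ 2 * p18 n (Z.of_nat k - 1)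
    - (INR k + 1) * (INR k + 2) * p18 n (Z.of_nat k + 2)) * e k) N =
  sum_f_R0 (fun k => q18 n k * tau k) N - (q18 n N * (INR N + 1) ^ 2 * e (S N)
    + (INR N + 1) * INR N * q18 n (S N) * e (N - 1)%nat
    + (INR N + 2) * (INR N + 1) * q18 n (S (S N)) * e N).
Proof.
intros He; induction N as [|N IH].
- simpl sum_f_R0; rewrite <- (He 0%nat); simpl INR; simpl (Z.of_nat 0 + 2)%Z.
  change (q18 n 2) with (p18 n 2); simpl Nat.sub; ring.
- rewrite !tech5, IH, <- (He (S N)), !S_INR.
  replace (Z.of_nat (S N) - 1)%Z with (Z.of_nat N) by lia.
  replace (Z.of_nat (S N) + 2)%Z with (Z.of_nat (S (S (S N)))) by lia.
  change (p18 n (Z.of_nat N)) with (q18 n N).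
  change (p18 n (Z.of_nat (S (S (S N))))) with (q18 n (S (S (S N)))).
  replace (S N - 1)%nat with N by lia; replace (S N - 2)%nat with (N - 1)%nat by lia.
  ring.
Qed.

(** Moved onto [e], the defect of [p18_key] becomes the pairing with [tau]. Its vanishing is asked
    from index 1 on: at index 0 it would impose the recurrence at [n = 1], which [b] violates. The
    truncated [k - 2] is harmless because its coefficient vanishes for [k < 2]. *)
Lemma pair18_solves (e tau : nat -> R) :
  (forall k, (INR k + 1) ^ 2 * e (S k) - INR k * (INR k - 1) * e (k - 2)%nat = tau k) ->
  (forall n, pair18 tau (S n) = 0) -> solves V18 (pair18 e).
Proof.
intros He H0 n.
(* Beyond the degree of all three polynomials, so that the boundary terms of [pair18_defect] are
   zero. *)
set (N := (n + 3)%nat).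
assert (D := pair18_defect e tau (S n) N He).
rewrite pair18_extend_le in D by (unfold N; lia).
rewrite H0, !q18_support in D by (unfold N; lia).
rewrite <- (pair18_extend_le e (S (S n)) N), <- (pair18_extend_le e (S n) N),
  <- (pair18_extend_le e n N) by (unfold N; lia).
assert (E : forall M, (INR n + 2) ^ 3 * sum_f_R0 (fun k => q18 (S (S n)) k * e k) M
  - recP V18 (INR n + 2) * sum_f_R0 (fun k => q18 (S n) k * e k) M
  - recQ V18 (INR n + 2) * sum_f_R0 (fun k => q18 n k * e k) M =
  6 * (2 * INR n + 3) * sum_f_R0 (fun k => (INR k ^ 2 * p18 (S n) (Z.of_nat k - 1)
    - (INR k + 1) * (INR k + 2) * p18 (S n) (Z.of_nat k + 2)) * e k) M).
{ assert (K : forall k : nat, (INR n + 2) ^ 3 * q18 (S (S n)) k - recP V18 (INR n + 2) * q18 (S n) k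
    - recQ V18 (INR n + 2) * q18 n k = 6 * (2 * INR n + 3) * (INR k ^ 2 * p18 (S n) (Z.of_nat k - 1)
    - (INR k + 1) * (INR k + 2) * p18 (S n) (Z.of_nat k + 2))).
  { intros k; generalize (p18_key (S n) (Z.of_nat k)).
    rewrite p18_prev_S, !S_INR, !plus_IZR, <- INR_IZR_INZ; unfold q18; simpl recP; simpl recQ.
    intros K; ring_simplify in K; ring_simplify; exact K. }
  induction M as [|M IH]; [unfold sum_f_R0 | rewrite !tech5].
  - generalize (f_equal (Rmult (e 0%nat)) (K 0%nat)); lra.
  - generalize (f_equal (Rmult (e (S M))) (K (S M))); lra. }
specialize (E N); rewrite D in E; lra.
Qed.

(** * Degree 18: distribution of the weights *)

(** These are the combinations of the powers of the two primitive cube roots of unity; pairing with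
    them evaluates the polynomial where the Legendre argument is 1 or -1. *)
Definition balanced (c : nat -> R) : Prop := forall k, c k + c (S k) + c (S (S k)) = 0.

(* The value of [p18_deriv_next] at the primitive cube roots of unity, where [1 + psi + psi^2 = 0]. *)
Lemma pair18_balanced_step (c : nat -> R) (n : nat) : balanced c ->
  pair18 c (S n) = 3 * (pair18 c n + 2 * pair18 (fun k => c (S k)) n).
Proof.
intros Hc; assert (Hn := pos_INR n).
assert (E : forall N, (INR n + 1) * (sum_f_R0 (fun k => q18 (S n) k * c k) N / 3
   - 2 * (sum_f_R0 (fun k => q18 n k * c (S k)) N - q18 n N * c (S N))
   - sum_f_R0 (fun k => q18 n k * c k) N) =
   2 * (c N * (INR N + 1) * q18 n (S N) - c (S N) * INR N * q18 n N)).
{ induction N as [|N IH].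
  - unfold sum_f_R0; generalize (p18_deriv_next n 0).
    destruct (p18_support n (-1)) as [E _]; [lia|].
    simpl (0 - 1)%Z; simpl (0 + 1)%Z; rewrite E.
    change (p18 n 1) with (q18 n 1); change (p18 n 0) with (q18 n 0).
    change (p18 (S n) 0) with (q18 (S n) 0); simpl INR; intros H.
    apply (f_equal (Rmult (c 0%nat))) in H; lra.
  - rewrite !tech5; generalize (p18_deriv_next n (Z.of_nat (S N))).
    replace (Z.of_nat (S N) - 1)%Z with (Z.of_nat N) by lia.
    replace (Z.of_nat (S N) + 1)%Z with (Z.of_nat (S (S N))) by lia.
    change (p18 n (Z.of_nat ?k)) with (q18 n k).
    change (p18 (S n) (Z.of_nat ?k)) with (q18 (S n) k).
    rewrite <- !INR_IZR_INZ, !S_INR; intros H.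
    apply (f_equal (Rmult (c (S N)))) in H.
    generalize (f_equal (Rmult (INR N * q18 n N)) (Hc N)),
     (f_equal (Rmult ((INR N + 1) * q18 n (S N))) (Hc N)); lra. }
specialize (E (S (S n))).
rewrite !q18_support, (pair18_extend_le c (S n)), (pair18_extend_le c n),
  (pair18_extend_le (fun k => c (S k)) n) in E by lia.
assert (E' : pair18 c (S n) / 3 - 2 * pair18 (fun k => c (S k)) n - pair18 c n = 0).
{ apply Rmult_eq_reg_l with (INR n + 1); lra. }
lra.
Qed.

(** The pairing on the left integrates the polynomial from 0 to the primitive cube roots. By
    [p18_deriv_sum] an antiderivative is a multiple of p_(n+2) + 27 p_n, which vanishes there
    because p_n equals the n-th power of a square root of -27; only the value at 0 is left. *)
Lemma pair18_balanced (c : nat -> R) (n : nat) : balanced c ->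
  6 * (2 * INR n + 3) * pair18 (fun k => c (S k) / (INR k + 1)) (S n) =
  - c 0%nat * (q18 (S (S n)) 0 + 27 * q18 n 0).
Proof.
intros Hc.
assert (E : forall N, 6 * (2 * INR n + 3) *
   sum_f_R0 (fun k => q18 (S n) k * (c (S k) / (INR k + 1))) N =
   sum_f_R0 (fun k => q18 (S (S n)) k * c k) (S N) + 27 * sum_f_R0 (fun k => q18 n k * c k) (S N)
     - c 0%nat * (q18 (S (S n)) 0 + 27 * q18 n 0)).
{ assert (K : forall k, 6 * (2 * INR n + 3) * (q18 (S n) k * (c (S k) / (INR k + 1))) =
    (q18 (S (S n)) (S k) + 27 * q18 n (S k)) * c (S k)).
  { intros k; assert (Hk := pos_INR k); generalize (p18_deriv_sum (S n) (Z.of_nat k)).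
    rewrite p18_prev_S, plus_IZR, <- INR_IZR_INZ, S_INR.
    replace (Z.of_nat k + 1)%Z with (Z.of_nat (S k)) by lia.
    change (p18 ?m (Z.of_nat ?k)) with (q18 m k); intros H.
    apply Rmult_eq_reg_l with (INR k + 1); [|lra].
    transitivity (6 * (2 * (INR n + 1) + 1) * q18 (S n) k * c (S k)); [field; lra|].
    rewrite <- H; ring. }
  induction N as [|N IH].
  - rewrite !tech5; unfold sum_f_R0; rewrite K; ring.
  - rewrite tech5, Rmult_plus_distr_l, IH, K, !(tech5 _ (S N)); ring. }
specialize (E (S (S n))).
rewrite !pair18_extend_le in E by lia.
rewrite E.
assert (Hc' : balanced (fun k => c (S k))) by (intros k; apply Hc).
enough (pair18 c (S (S n)) + 27 * pair18 c n = 0) by lra.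
rewrite !pair18_balanced_step by auto.
rewrite (pair18_ext (fun k => c (S (S k))) (fun k => -1 * c k + -1 * c (S k)))
  by (intros k; generalize (Hc k); lra).
rewrite pair18_lin; ring.
Qed.

Lemma pair18_rec (c : nat -> R) (n : nat) :
  (INR n + 2) * pair18 c (S (S n)) =
  3 * (2 * INR n + 3) * (pair18 c (S n) + 2 * pair18 (fun k => c (S k)) (S n))
    + 27 * (INR n + 1) * pair18 c n.
Proof.
assert (E : forall N, (INR n + 2) * sum_f_R0 (fun k => q18 (S (S n)) k * c k) N =
  3 * (2 * INR n + 3) * (sum_f_R0 (fun k => q18 (S n) k * c k) N +
     2 * (sum_f_R0 (fun k => q18 (S n) k * c (S k)) N - q18 (S n) N * c (S N)))
    + 27 * (INR n + 1) * sum_f_R0 (fun k => q18 n k * c k) N).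
{ induction N as [|N IH].
  - unfold sum_f_R0; generalize (p18_rec (S n) 0).
    destruct (p18_support (S n) (-1)) as [E _]; [lia|].
    simpl (0 - 1)%Z; rewrite E, p18_prev_S, S_INR.
    change (p18 ?m 0) with (q18 m 0); intros H.
    apply (f_equal (Rmult (c 0%nat))) in H; lra.
  - rewrite !tech5; generalize (p18_rec (S n) (Z.of_nat (S N))).
    replace (Z.of_nat (S N) - 1)%Z with (Z.of_nat N) by lia.
    rewrite p18_prev_S, S_INR.
    change (p18 ?m (Z.of_nat ?k)) with (q18 m k); intros H.
    apply (f_equal (Rmult (c (S N)))) in H; lra. }
specialize (E (S (S n))).
rewrite q18_support, (pair18_extend_le c (S (S n))), (pair18_extend_le c (S n)),
   (pair18_extend_le c n), (pair18_extend_le (fun k => c (S k)) (S n)) in E by lia.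
lra.
Qed.

Definition q18_total (n : nat) : R := pair18 (fun _ => 1) n.

Lemma q18_total_rec (n : nat) : (INR n + 2) * q18_total (S (S n)) =
  9 * (2 * INR n + 3) * q18_total (S n) + 27 * (INR n + 1) * q18_total n.
Proof. unfold q18_total; rewrite pair18_rec; ring. Qed.

Lemma q18_0_0 : q18 0 0 = 1.
Proof. reflexivity. Qed.

Lemma q18_1_0 : q18 1 0 = 3.
Proof.
generalize (p18_rec 0 0); rewrite !p18_0, p18_prev_0.
change (p18 1 0) with (q18 1 0); simpl INR; simpl Z.eqb; lra.
Qed.

Lemma q18_1_1 : q18 1 1 = 6.
Proof.
generalize (p18_rec 0 1); rewrite !p18_0, p18_prev_0.
change (p18 1 1) with (q18 1 1); simpl INR; simpl Z.eqb; lra.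
Qed.

Lemma q18_total_growth (n : nat) : 0 < q18_total n /\ 9 * q18_total n <= q18_total (S n).
Proof.
induction n as [|n [H1 H2]].
- unfold q18_total, pair18, sum_f_R0; rewrite q18_0_0, q18_1_0, q18_1_1; lra.
- assert (Hn := pos_INR n).
  split; [lra|].
  apply Rmult_le_reg_l with (INR n + 2); [lra|]; rewrite q18_total_rec; nra.
Qed.

Lemma q18_rec_0 (n : nat) : (INR n + 2) * q18 (S (S n)) 0 =
  3 * (2 * INR n + 3) * q18 (S n) 0 + 27 * (INR n + 1) * q18 n 0.
Proof.
generalize (p18_rec (S n) 0); destruct (p18_support (S n) (-1)) as [E _]; [lia|].
simpl (0 - 1)%Z; rewrite E, p18_prev_S, S_INR.
change (p18 ?m 0) with (q18 m 0); lra.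
Qed.

Lemma q18_rec_S (n k : nat) : (INR n + 2) * q18 (S (S n)) (S k) =
  3 * (2 * INR n + 3) * (q18 (S n) (S k) + 2 * q18 (S n) k) + 27 * (INR n + 1) * q18 n (S k).
Proof.
generalize (p18_rec (S n) (Z.of_nat (S k))).
replace (Z.of_nat (S k) - 1)%Z with (Z.of_nat k) by lia.
rewrite p18_prev_S, S_INR.
change (p18 ?m (Z.of_nat ?k)) with (q18 m k); lra.
Qed.

(** The total has leading coefficient [9 * (2 * INR n + 3)] in its recurrence, a single coefficient
    only [3 * (2 * INR n + 3)] plus what arrives from [k - 1], so each fixed [k] loses a geometric
    factor. With base 10 the arrivals cost [1 + 2 / 10 = 6 / 5], undoing one factor [5 / 6]. *)
Lemma q18_bound (n : nat) : forall k, q18 n k <= 10 ^ k * (5 / 6) ^ n * q18_total n.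
Proof.
enough (H : (forall k, q18 n k <= 10 ^ k * (5 / 6) ^ n * q18_total n) /\
  (forall k, q18 (S n) k <= 10 ^ k * (5 / 6) ^ S n * q18_total (S n))) by tauto.
induction n as [|n [IH0 IH1]].
- unfold q18_total, pair18, sum_f_R0; rewrite q18_0_0, q18_1_0, q18_1_1.
  split; [intros [|k] | intros [|[|k]]]; rewrite ?q18_0_0, ?q18_1_0, ?q18_1_1; try (simpl pow; lra);
    rewrite q18_support by lia; assert (0 < 10 ^ k) by (apply pow_lt; lra); simpl pow; lra.
- split; [exact IH1|]; intros k.
  assert (Hn := pos_INR n); destruct (q18_total_growth n) as [S0 S1].
  assert (Hk : 0 < 10 ^ k) by (apply pow_lt; lra).
  assert (Hq : 0 < (5 / 6) ^ n) by (apply pow_lt; lra).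
  assert (H1 := IH1 k); assert (H0 := IH0 k).
  assert (H : (INR n + 2) * q18 (S (S n)) k <=
     3 * (2 * INR n + 3) * (6 / 5 * (10 ^ k * (5 / 6) ^ S n * q18_total (S n)))
       + 27 * (INR n + 1) * (10 ^ k * (5 / 6) ^ n * q18_total n)).
  { destruct k as [|k].
    - rewrite q18_rec_0.
      assert (0 <= q18 (S n) 0) by apply q18_nonneg.
      apply Rplus_le_compat; apply Rmult_le_compat_l; nra.
    - rewrite q18_rec_S; assert (H2 := IH1 k).
      apply Rplus_le_compat; apply Rmult_le_compat_l; try nra.
      simpl (10 ^ S k) in *; lra. }
  apply Rmult_le_reg_l with (INR n + 2); [lra|].
  eapply Rle_trans; [exact H|].
  replace ((INR n + 2) * (10 ^ k * (5 / 6) ^ S (S n) * q18_total (S (S n)))) with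
    (10 ^ k * (5 / 6) ^ n * (25 / 36 * ((INR n + 2) * q18_total (S (S n))))) by (simpl; field).
  rewrite q18_total_rec; simpl ((5 / 6) ^ S n).
  replace (3 * (2 * INR n + 3) * (6 / 5 * (10 ^ k * (5 / 6 * (5 / 6) ^ n) * q18_total (S n))) +
    27 * (INR n + 1) * (10 ^ k * (5 / 6) ^ n * q18_total n)) with
   (10 ^ k * (5 / 6) ^ n * (3 * (2 * INR n + 3) * q18_total (S n) + 27 * (INR n + 1) * q18_total n)) by field.
  (* The loss in the term with [q18_total n] is paid by the surplus in the other one, as
     [9 * q18_total n <= q18_total (S n)]. *)
  apply Rmult_le_compat_l; [nra|].
  nra.
Qed.

(** The total of the weights [q18 n k / (k + 1)]; the divisor matches the decay of [e] like 1/k. *)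
Definition q18_mass (n : nat) : R := pair18 (fun k => / (INR k + 1)) n.

Lemma pair18_le (c d : nat -> R) (n : nat) :
  (forall k, (k <= n)%nat -> c k <= d k) -> pair18 c n <= pair18 d n.
Proof.
intros H; unfold pair18; apply sum_Rle; intros k Hk.
apply Rmult_le_compat_l; [apply q18_nonneg | now apply H].
Qed.

Lemma q18_mass_lower (n : nat) : q18_total n <= (INR n + 1) * q18_mass n.
Proof.
replace ((INR n + 1) * q18_mass n) with (pair18 (fun k => (INR n + 1) * / (INR k + 1) + 0 * 0) n).
- apply pair18_le; intros k Hk; assert (Hk0 := pos_INR k); apply le_INR in Hk.
  apply Rmult_le_reg_r with (INR k + 1); [lra|].
  rewrite Rmult_0_l, Rplus_0_r, Rmult_assoc, Rinv_l; lra.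
- rewrite (pair18_lin (fun k => / (INR k + 1)) (fun _ => 0)); unfold q18_mass; ring.
Qed.

Lemma q18_mass_pos (n : nat) : 0 < q18_mass n.
Proof.
assert (Hn := pos_INR n); destruct (q18_total_growth n) as [H _]; generalize (q18_mass_lower n).
intros; apply Rmult_lt_reg_l with (INR n + 1); lra.
Qed.

Lemma q18_small (k : nat) : is_lim_seq (fun n => q18 n k / q18_mass n) 0.
Proof.
apply is_lim_seq_le_le with (fun _ => 0) (fun n => 10 ^ k * (INR n + 1) * (5 / 6) ^ n).
- intros n; assert (H := q18_bound n k); assert (L := q18_mass_lower n); assert (Ep := q18_mass_pos n).
  split.
  + apply Rmult_le_pos; [apply q18_nonneg | left; now apply Rinv_0_lt_compat].
  + apply Rmult_le_reg_r with (q18_mass n); [lra|].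
    unfold Rdiv at 1; rewrite Rmult_assoc, Rinv_l, Rmult_1_r by lra.
    assert (Hk : 0 < 10 ^ k) by (apply pow_lt; lra).
    assert (Hq : 0 < (5 / 6) ^ n) by (apply pow_lt; lra).
    assert (0 < 10 ^ k * (5 / 6) ^ n) by nra.
    nra.
- apply is_lim_seq_const.
- apply is_lim_seq_poly_geom; lra.
Qed.

Lemma pair18_head_small (f : nat -> R) (K : nat) :
  is_lim_seq (fun n => sum_f_R0 (fun k => q18 n k * f k) K / q18_mass n) 0.
Proof.
assert (T : forall k, is_lim_seq (fun n => q18 n k * f k / q18_mass n) 0).
{ intros k; apply is_lim_seq_ext with (fun n => f k * (q18 n k / q18_mass n)).
  - intros n; generalize (q18_mass_pos n); intros; field; lra.
  - replace (Finite 0) with (Finite (f k * 0)) by (f_equal; ring).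
    apply is_lim_seq_mult'; [apply is_lim_seq_const | apply q18_small]. }
induction K as [|K IH]; [apply T|].
apply is_lim_seq_ext with (fun n => sum_f_R0 (fun k => q18 n k * f k) K / q18_mass n
   + q18 n (S K) * f (S K) / q18_mass n).
- intros n; rewrite tech5; generalize (q18_mass_pos n); intros; field; lra.
- replace (Finite 0) with (Finite (0 + 0)) by (f_equal; ring).
  apply is_lim_seq_plus'; [exact IH | apply T].
Qed.

Lemma pair18_Rabs (c : nat -> R) (n : nat) : Rabs (pair18 c n) <= pair18 (fun k => Rabs (c k)) n.
Proof.
unfold pair18; eapply Rle_trans; [apply Rsum_abs|].
apply sum_Rle; intros k _; rewrite Rabs_mult, (Rabs_pos_eq (q18 n k)); [lra | apply q18_nonneg].
Qed.

(** Silverman-Toeplitz averaging: the normalised weights are nonnegative with sum 1, and each one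
    tends to 0. *)
Lemma pair18_toeplitz (f : nat -> R) : is_lim_seq f 0 ->
  is_lim_seq (fun n => pair18 (fun k => f k / (INR k + 1)) n / q18_mass n) 0.
Proof.
intros Hf; apply is_lim_seq_spec; intros eps.
apply is_lim_seq_spec in Hf; destruct (Hf (pos_div_2 eps)) as [K HK].
assert (Hh := pair18_head_small (fun k => Rabs (f k)) K).
apply is_lim_seq_spec in Hh; destruct (Hh (pos_div_2 eps)) as [N HN].
exists N; intros n Hn; specialize (HN n Hn); simpl in HN.
assert (Ep := q18_mass_pos n); rewrite Rminus_0_r in *.
assert (B : Rabs (pair18 (fun k => f k / (INR k + 1)) n) <=
   eps / 2 * q18_mass n + sum_f_R0 (fun k => q18 n k * Rabs (f k)) K).
{ eapply Rle_trans; [apply pair18_Rabs|].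
  set (g := fun k : nat => if (k <=? K)%nat then Rabs (f k) else 0).
  apply Rle_trans with (pair18 (fun k => (eps / 2) * / (INR k + 1) + 1 * g k) n).
  - apply pair18_le; intros k _.
    assert (Hk := pos_INR k).
    assert (0 < / (INR k + 1)) by (apply Rinv_0_lt_compat; lra).
    assert (/ (INR k + 1) <= 1) by (rewrite <- Rinv_1; apply Rinv_le_contravar; lra).
    unfold Rdiv at 1; rewrite Rabs_mult, (Rabs_pos_eq (/ _)) by lra.
    assert (0 <= Rabs (f k)) by apply Rabs_pos.
    assert (He := cond_pos eps).
    unfold g; destruct (Nat.leb_spec k K) as [L|L]; [nra|].
    specialize (HK k ltac:(lia)); simpl in HK; rewrite Rminus_0_r in HK; nra.
  - rewrite pair18_lin; fold (q18_mass n); rewrite Rmult_1_l.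
    apply Rplus_le_compat_l.
    rewrite <- (pair18_extend_le g n (K + n)) by lia.
    right; generalize n at 2 as d; induction d as [|d IH].
    + rewrite Nat.add_0_r; apply sum_eq; intros k Hk; unfold g.
      now destruct (Nat.leb_spec k K); [|lia].
    + rewrite Nat.add_succ_r, tech5, IH; unfold g.
      destruct (Nat.leb_spec (S (K + d)) K); [lia|ring]. }
unfold Rdiv; rewrite Rabs_mult, Rabs_inv, (Rabs_pos_eq (q18_mass n)) by lra.
apply Rmult_lt_reg_r with (q18_mass n); [lra|].
rewrite Rmult_assoc, Rinv_l, Rmult_1_r by lra.
eapply Rle_lt_trans; [exact B|].
apply Rabs_def2 in HN; destruct HN as [HN _].
apply Rmult_lt_compat_r with (r := q18_mass n) in HN; [|lra].
unfold Rdiv in HN at 1; rewrite Rmult_assoc, Rinv_l, Rmult_1_r in HN by lra.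
lra.
Qed.

Lemma q18_mono_0 (n : nat) : q18 n 0 <= q18 (S n) 0.
Proof.
destruct n as [|n]; [rewrite q18_0_0, q18_1_0; lra|].
assert (Hn := pos_INR n); assert (H1 := q18_nonneg (S n) 0); assert (H0 := q18_nonneg n 0).
apply Rmult_le_reg_l with (INR n + 2); [lra|]; rewrite q18_rec_0; nra.
Qed.

(** Equidistribution modulo 3: by [pair18_balanced] only coefficients at 0 are left, and those are
    negligible by [q18_small]. *)
Lemma pair18_balanced_small (c : nat -> R) : balanced c ->
  is_lim_seq (fun n => pair18 (fun k => c (S k) / (INR k + 1)) n / q18_mass n) 0.
Proof.
intros Hc; apply is_lim_seq_incr_1, is_lim_seq_abs_0.
apply is_lim_seq_le_le with (fun _ => 0) (fun n => 60 * Rabs (c 0%nat) * (q18 (S n) 0 / q18_mass (S n))).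
- intros n; split; [apply Rabs_pos|].
  assert (Ep := q18_mass_pos (S n)); assert (Hn := pos_INR n).
  assert (B := pair18_balanced c n Hc).
  assert (R2 := q18_rec_0 n); assert (M := q18_mono_0 n); assert (P1 := q18_nonneg n 0).
  assert (P2 := q18_nonneg (S (S n)) 0).
  (* 33 bounds [(3 * (2 * n + 3) + 27 * (n + 1)) / (n + 2)]; adding the 27 of [B] gives 60. *)
  assert (L : q18 (S (S n)) 0 <= 33 * q18 (S n) 0).
  { apply Rmult_le_reg_l with (INR n + 2); [lra|]; rewrite R2; nra. }
  unfold Rdiv at 1; rewrite Rabs_mult, Rabs_inv, (Rabs_pos_eq (q18_mass (S n))) by lra.
  replace (60 * Rabs (c 0%nat) * (q18 (S n) 0 / q18_mass (S n))) with
   (60 * Rabs (c 0%nat) * q18 (S n) 0 * / q18_mass (S n)) by (field; lra).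
  apply Rmult_le_compat_r; [left; now apply Rinv_0_lt_compat|].
  apply Rmult_le_reg_l with (6 * (2 * INR n + 3)); [lra|].
  rewrite <- (Rabs_pos_eq (6 * (2 * INR n + 3))) at 1 by lra.
  rewrite <- Rabs_mult, B, Rabs_mult, Rabs_Ropp, (Rabs_pos_eq (_ + _)) by lra.
  assert (C := Rabs_pos (c 0%nat)).
  assert (X : q18 (S (S n)) 0 + 27 * q18 n 0 <= 60 * q18 (S n) 0) by lra.
  apply Rmult_le_compat_l with (r := Rabs (c 0%nat)) in X; [|exact C].
  assert (Y : 0 <= Rabs (c 0%nat) * q18 (S n) 0) by (apply Rmult_le_pos; lra).
  nra.
- apply is_lim_seq_const.
- replace (Finite 0) with (Finite (60 * Rabs (c 0%nat) * 0)) by (f_equal; ring).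
  apply is_lim_seq_mult'; [apply is_lim_seq_const|].
  apply (is_lim_seq_incr_1 (fun n => q18 n 0 / q18_mass n)), q18_small.
Qed.

Definition by_class (x0 x1 x2 : R) (k : nat) : R :=
  match (k mod 3)%nat with O => x0 | 1%nat => x1 | _ => x2 end.

Lemma by_class_S (x0 x1 x2 : R) (k : nat) : by_class x0 x1 x2 (S k) = by_class x1 x2 x0 k.
Proof.
unfold by_class.
assert (H : (S k mod 3 = match k mod 3 with 0 => 1 | 1 => 2 | _ => 0 end)%nat).
{ assert (L := Nat.mod_upper_bound k 3 ltac:(lia)).
  rewrite <- Nat.add_1_r, <- Nat.Div0.add_mod_idemp_l.
  destruct (k mod 3)%nat as [|[|[|r]]]; [reflexivity..|lia]. }
rewrite H; now destruct (k mod 3)%nat as [|[|[|r]]].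
Qed.

Lemma chi3_by_class (k : nat) : chi3 k = by_class 0 1 (-1) k.
Proof. reflexivity. Qed.

Lemma balanced_by_class (x0 x1 x2 : R) : x0 + x1 + x2 = 0 -> balanced (by_class x0 x1 x2).
Proof.
intros H k; rewrite !by_class_S; unfold by_class.
destruct (k mod 3)%nat as [|[|r]]; lra.
Qed.

Lemma is_lim_seq_classes (f : nat -> R) (x0 x1 x2 : R) :
  is_lim_seq (fun j => f (3 * j)%nat) x0 -> is_lim_seq (fun j => f (3 * j + 1)%nat) x1 ->
  is_lim_seq (fun j => f (3 * j + 2)%nat) x2 ->
  is_lim_seq (fun k => f k - by_class x0 x1 x2 k) 0.
Proof.
intros H0 H1 H2; apply is_lim_seq_spec in H0, H1, H2; apply is_lim_seq_spec; intros eps.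
destruct (H0 eps) as [N0 K0], (H1 eps) as [N1 K1], (H2 eps) as [N2 K2].
exists (3 * (N0 + N1 + N2) + 3)%nat; intros k Hk.
rewrite Rminus_0_r.
assert (L := Nat.mod_upper_bound k 3 ltac:(lia)).
assert (D := Nat.div_mod k 3 ltac:(lia)).
unfold by_class; destruct (k mod 3)%nat as [|[|[|r]]]; rewrite D; [| | |lia].
- rewrite Nat.add_0_r; apply K0; lia.
- apply K1; lia.
- apply K2; lia.
Qed.

(** The sequence splits into a null sequence, a balanced one and the mean [m] of the class limits;
    only [m] survives averaging. *)
Lemma pair18_class_limit (f : nat -> R) (x0 x1 x2 : R) :
  is_lim_seq (fun j => f (3 * j)%nat) x0 -> is_lim_seq (fun j => f (3 * j + 1)%nat) x1 ->
  is_lim_seq (fun j => f (3 * j + 2)%nat) x2 ->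
  is_lim_seq (fun n => pair18 (fun k => f k / (INR k + 1)) n / q18_mass n) ((x0 + x1 + x2) / 3).
Proof.
intros H0 H1 H2; set (m := (x0 + x1 + x2) / 3).
assert (A := pair18_toeplitz _ (is_lim_seq_classes f x0 x1 x2 H0 H1 H2)).
(* The classes are rotated by one because [pair18_balanced_small] reads its sequence at [S k]. *)
assert (B := pair18_balanced_small _ (balanced_by_class (x2 - m) (x0 - m) (x1 - m)
  ltac:(unfold m; lra))).
replace (Finite m) with (Finite (0 + (0 + m))) by (f_equal; ring).
eapply is_lim_seq_ext; [|exact (is_lim_seq_plus' _ _ _ _ A
  (is_lim_seq_plus' _ _ _ _ B (is_lim_seq_const m)))].
intros n; assert (Ep := q18_mass_pos n); simpl.
apply Rmult_eq_reg_r with (q18_mass n); [|lra].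
rewrite !Rmult_plus_distr_r; unfold Rdiv at 1 3 5.
rewrite !Rmult_assoc, !Rinv_l, !Rmult_1_r by lra.
rewrite (pair18_ext (fun k => f k / (INR k + 1)) (fun k =>
  1 * ((f k - by_class x0 x1 x2 k) / (INR k + 1)) + 1 *
  (1 * (by_class (x2 - m) (x0 - m) (x1 - m) (S k) / (INR k + 1)) + m * / (INR k + 1)))).
- rewrite !pair18_lin; fold (q18_mass n); ring.
- intros k; rewrite by_class_S; unfold by_class, Rdiv.
  destruct (k mod 3)%nat as [|[|r]]; ring.
Qed.

(** * Degree 18: the two solutions *)

Fixpoint e18 (c : R) (tau : nat -> R) (k : nat) : R := match k with
  | O => c
  | 1%nat => tau 0%nat
  | 2%nat => tau 1%nat / 4
  | S (S (S j)) => ((INR j + 2) * (INR j + 1) * e18 c tau j + tau (S (S j))) / (INR j + 3) ^ 2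
  end.

Lemma e18_rec (c : R) (tau : nat -> R) (k : nat) :
  (INR k + 1) ^ 2 * e18 c tau (S k) - INR k * (INR k - 1) * e18 c tau (k - 2)%nat = tau k.
Proof.
destruct k as [|[|j]]; [simpl; ring | simpl; field|].
replace (S (S j) - 2)%nat with j by lia.
cbn [e18]; rewrite !S_INR; assert (Hj := pos_INR j); field; lra.
Qed.

Definition a18 : nat -> R := pair18 (e18 1 (fun _ => 0)).
Definition tau18 (k : nat) : R := chi3 (S k) / (INR k + 1).
(** The factor [/ 6] makes the value at 1 equal to 1, since [q18 1 1 = 6]; the shape is that of
    [solves_lin]. *)
Definition b18 (n : nat) : R := / 6 * pair18 (e18 0 tau18) n + 0 * a18 n.

Lemma a18_solves : solves V18 a18.
Proof.
apply pair18_solves with (fun _ => 0); [apply e18_rec|].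
intros n; unfold pair18; rewrite (sum_eq _ (fun _ => 0) (S n)) by (intros; ring).
generalize (S n) as N; induction N as [|N IH]; simpl; [|rewrite IH]; ring.
Qed.

Lemma b18_solves : solves V18 b18.
Proof.
apply solves_lin; [|exact a18_solves].
apply pair18_solves with tau18; [apply e18_rec|].
intros n; assert (Hn := pos_INR n).
assert (H : balanced chi3) by (apply (balanced_by_class 0 1 (-1)); ring).
apply Rmult_eq_reg_l with (6 * (2 * INR n + 3)); [|lra].
unfold tau18; rewrite (pair18_balanced chi3 n H); unfold chi3 at 1; simpl; ring.
Qed.

(** In Pochhammer symbols, (1/3)_j (2/3)_j / (j!)^2. *)
Fixpoint w18 (j : nat) : R := match j with
  | O => 1
  | S i => w18 i * ((3 * INR i + 2) * (3 * INR i + 1) / (3 * INR i + 3) ^ 2)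
  end.

Fixpoint z18 (r : R) (j : nat) : R := match j with
  | O => / r ^ 3
  | S i => ((3 * INR i + 2 + r) * (3 * INR i + 1 + r) * z18 r i + / (3 * INR i + 3 + r))
       / (3 * INR i + 3 + r) ^ 2
  end.

Lemma e18_step (c : R) (tau : nat -> R) (j : nat) : e18 c tau (S (S (S j))) =
  ((INR j + 2) * (INR j + 1) * e18 c tau j + tau (S (S j))) / (INR j + 3) ^ 2.
Proof. reflexivity. Qed.

Lemma INR_3 (j : nat) : INR (3 * j) = 3 * INR j.
Proof. rewrite mult_INR; f_equal; simpl; ring. Qed.

Lemma e18_a (j : nat) : e18 1 (fun _ => 0) (3 * j) = w18 j /\
  e18 1 (fun _ => 0) (3 * j + 1) = 0 /\ e18 1 (fun _ => 0) (3 * j + 2) = 0.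
Proof.
induction j as [|j [H0 [H1 H2]]]; [simpl; repeat split; field|].
assert (Hj := pos_INR j).
replace (3 * S j)%nat with (S (S (S (3 * j)))) by lia; rewrite !Nat.add_succ_l, !e18_step.
rewrite H0, H1, H2, !plus_INR, INR_3; cbn [w18]; repeat split; simpl INR; field; lra.
Qed.

Lemma tau18_by_class (k : nat) : tau18 k = by_class 1 (-1) 0 k / (INR k + 1).
Proof. unfold tau18; rewrite chi3_by_class, by_class_S; reflexivity. Qed.

Lemma by_class_3 (x0 x1 x2 : R) (j : nat) : by_class x0 x1 x2 (3 * j) = x0.
Proof. unfold by_class; rewrite Nat.mul_comm, Nat.Div0.mod_mul; reflexivity. Qed.

Lemma e18_b (j : nat) : e18 0 tau18 (3 * j) = 0 /\
  e18 0 tau18 (3 * j + 1) = z18 1 j /\ e18 0 tau18 (3 * j + 2) = - z18 2 j.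
Proof.
induction j as [|j [H0 [H1 H2]]].
- simpl; rewrite !tau18_by_class; unfold by_class; simpl; repeat split; field.
- assert (Hj := pos_INR j).
  replace (3 * S j)%nat with (S (S (S (3 * j)))) by lia; rewrite !Nat.add_succ_l, !e18_step.
  rewrite H0, H1, H2, !tau18_by_class, !by_class_S.
  rewrite !Nat.add_1_r, (Nat.add_comm _ 2); change (2 + (3 * j))%nat with (S (S (3 * j))).
  rewrite !by_class_S, !by_class_3, !S_INR, INR_3; cbn [z18].
  repeat split; field; lra.
Qed.

(** The sequence [e] for [a] lives on class 0, the one for [b] on classes 1 and 2 with opposite
    signs. Relative to [q18_mass], averaging gives [P / 3] and [(Z1 - Z2) / 18]. *)
Lemma limit_V18_of_constants (a b : nat -> R) (P Z1 Z2 : R) :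
  is_lim_seq (fun j => (3 * INR j + 1) * w18 j) P -> P <> 0 ->
  is_lim_seq (fun j => (3 * INR j + 1) * z18 1 j) Z1 ->
  is_lim_seq (fun j => (3 * INR j + 2) * z18 2 j) Z2 ->
  solves V18 a -> solves V18 b -> a 0%nat = 1 -> a 1%nat = recP V18 1 ->
  b 0%nat = 0 -> b 1%nat = 1 ->
  is_lim_seq (fun n => b n / a n) ((Z1 - Z2) / (6 * P)).
Proof.
intros HP P0 HZ1 HZ2 Ha Hb a0 a1 b0 b1.
assert (Ea : forall n, a n = a18 n).
{ apply (solves_unique V18); auto using a18_solves.
  - rewrite a0; unfold a18, pair18; simpl; rewrite q18_0_0; ring.
  - rewrite a1; unfold a18, pair18; simpl; rewrite q18_1_0, q18_1_1; ring. }
assert (Eb : forall n, b n = b18 n).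
{ apply (solves_unique V18); auto using b18_solves.
  - rewrite b0; unfold b18, a18, pair18; simpl; rewrite q18_0_0; ring.
  - rewrite b1; unfold b18, a18, pair18; simpl.
    rewrite tau18_by_class, q18_1_0, q18_1_1; unfold by_class; simpl; field. }
assert (La : is_lim_seq (fun n => a n / q18_mass n) ((P + 0 + 0) / 3)).
{ eapply is_lim_seq_ext; [|apply (pair18_class_limit
    (fun k => (INR k + 1) * e18 1 (fun _ => 0) k))].
  - intros n; simpl; rewrite Ea; unfold a18; f_equal; apply pair18_ext; intros k.
    assert (Hk := pos_INR k); field; lra.
  - eapply is_lim_seq_ext; [|exact HP]; intros j; cbv beta.
    destruct (e18_a j) as [E _]; rewrite E, INR_3; reflexivity.
  - eapply is_lim_seq_ext; [|apply is_lim_seq_const]; intros j; cbv beta.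
    destruct (e18_a j) as [_ [E _]]; rewrite E; ring.
  - eapply is_lim_seq_ext; [|apply is_lim_seq_const]; intros j; cbv beta.
    destruct (e18_a j) as [_ [_ E]]; rewrite E; ring. }
(* Class limits are taken of [(k + 1) * e k], whereas [Z1] and [Z2] are limits of [k * e k]. *)
assert (Q : forall h, 0 < h -> is_lim_seq (fun j => (3 * INR j + h + 1) / (3 * INR j + h)) 1).
{ intros h Hh; apply is_lim_seq_ext with (fun j => 1 + / 3 * / (INR j + h / 3)).
  - intros j; assert (Hj := pos_INR j); field; lra.
  - replace (Finite 1) with (Finite (1 + / 3 * 0)) by (f_equal; ring).
    apply is_lim_seq_plus'; [apply is_lim_seq_const|].
    apply is_lim_seq_mult'; [apply is_lim_seq_const | apply is_lim_seq_inv_shift]. }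
assert (Lb : is_lim_seq (fun n => b n / q18_mass n) (/ 6 * ((0 + 1 * Z1 + 1 * (- Z2)) / 3))).
{ eapply is_lim_seq_ext; [|eapply is_lim_seq_mult'; [apply is_lim_seq_const |
    apply (pair18_class_limit (fun k => (INR k + 1) * e18 0 tau18 k))]].
  - intros n; simpl; rewrite Eb; unfold b18.
    rewrite (pair18_ext (e18 0 tau18) (fun k => (INR k + 1) * e18 0 tau18 k / (INR k + 1))).
    + assert (Ep := q18_mass_pos n); field; lra.
    + intros k; assert (Hk := pos_INR k); field; lra.
  - eapply is_lim_seq_ext; [|apply is_lim_seq_const]; intros j; cbv beta.
    destruct (e18_b j) as [E _]; rewrite E; ring.
  - eapply is_lim_seq_ext; [|exact (is_lim_seq_mult' _ _ _ _ (Q 1 ltac:(lra)) HZ1)].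
    intros j; cbv beta; destruct (e18_b j) as [_ [E _]]; rewrite E, plus_INR, INR_3.
    assert (Hj := pos_INR j); simpl INR; field; lra.
  - apply is_lim_seq_opp in HZ2.
    eapply is_lim_seq_ext; [|exact (is_lim_seq_mult' _ _ _ _ (Q 2 ltac:(lra)) HZ2)].
    intros j; cbv beta; destruct (e18_b j) as [_ [_ E]]; rewrite E, plus_INR, INR_3.
    assert (Hj := pos_INR j); simpl INR; field; lra. }
replace (Finite ((Z1 - Z2) / (6 * P))) with
  (Finite (/ 6 * ((0 + 1 * Z1 + 1 * (- Z2)) / 3) / ((P + 0 + 0) / 3))) by (f_equal; field; lra).
apply is_lim_seq_ext_loc with (fun n => (b n / q18_mass n) / (a n / q18_mass n)).
(* The quotients agree once [a n] is nonzero, which the nonzero limit of [a / q18_mass] ensures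
   eventually. *)
- assert (N : (P + 0 + 0) / 3 <> 0) by lra.
  assert (La' := La); apply is_lim_seq_spec in La'.
  assert (He : 0 < Rabs ((P + 0 + 0) / 3)) by (now apply Rabs_pos_lt).
  destruct (La' (mkposreal _ He)) as [M HM]; exists M; intros n Hn.
  specialize (HM n Hn); simpl in HM; assert (Ep := q18_mass_pos n).
  assert (a n <> 0).
  { intros E; rewrite E in HM; replace (0 / q18_mass n) with 0 in HM by (field; lra).
    rewrite Rminus_0_l, Rabs_Ropp in HM; lra. }
  field; lra.
- apply is_lim_seq_div'; auto; lra.
Qed.

(** * Degree 18: the difference of the limits in the two classes *)

(** Each step multiplies [(3 * INR j + 1) * w18 j] by 1 - 1/(3j+3)^2, a factor of the product
    [P]. *)
Lemma w18_bounds (j : nat) : 0 < w18 j /\ (3 * INR j + 1) * w18 j <= 1.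
Proof.
induction j as [|j [H0 H1]]; [simpl; lra|].
assert (Hj := pos_INR j); cbn [w18]; rewrite S_INR.
assert (Hd : 0 < (3 * INR j + 3) ^ 2) by (apply pow_lt; lra).
split.
- apply Rmult_lt_0_compat; [lra|]; apply Rdiv_lt_0_compat; nra.
- replace ((3 * (INR j + 1) + 1) * (w18 j * ((3 * INR j + 2) * (3 * INR j + 1) / (3 * INR j + 3) ^ 2)))
    with ((3 * INR j + 1) * w18 j * (1 - / (3 * INR j + 3) ^ 2)) by (field; lra).
  assert (0 < / (3 * INR j + 3) ^ 2) by now apply Rinv_0_lt_compat.
  assert (0 < (3 * INR j + 1) * w18 j) by nra.
  nra.
Qed.

Definition x18 (j : nat) : R := 3 * INR j * w18 j.

(** The sequence [x18] increases from [x18 1 = 2 / 3]. *)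
Lemma x18_lower (j : nat) : 2 / 3 <= x18 (S j).
Proof.
induction j as [|j IH]; [unfold x18; simpl; lra|].
eapply Rle_trans; [exact IH|].
unfold x18; cbn [w18]; rewrite !S_INR; assert (Hj := pos_INR j).
destruct (w18_bounds j) as [H0 _].
set (w := w18 j * _).
assert (Hw : 0 < w).
{ unfold w; apply Rmult_lt_0_compat; [lra|]; apply Rdiv_lt_0_compat; [nra|apply pow_lt; lra]. }
replace (3 * (INR j + 1 + 1) * (w * ((3 * (INR j + 1) + 2) * (3 * (INR j + 1) + 1) /
   (3 * (INR j + 1) + 3) ^ 2))) with
  (3 * (INR j + 1) * w + w * (2 / (3 * (INR j + 1) + 3))) by (field; lra).
assert (0 < 2 / (3 * (INR j + 1) + 3)) by (apply Rdiv_lt_0_compat; lra).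
nra.
Qed.

Lemma x18_upper (j : nat) : 0 <= x18 j <= 1.
Proof.
unfold x18; destruct (w18_bounds j); assert (Hj := pos_INR j); nra.
Qed.

Lemma is_lim_seq_inv_3 (c : R) : is_lim_seq (fun j => / (3 * INR j + c)) 0.
Proof.
apply is_lim_seq_ext with (fun j => / 3 * / (INR j + c / 3)).
- intros j; rewrite <- Rinv_mult; f_equal; field.
- replace (Finite 0) with (Finite (/ 3 * 0)) by (f_equal; ring).
  apply is_lim_seq_mult'; [apply is_lim_seq_const | apply is_lim_seq_inv_shift].
Qed.

Lemma x18_lim (P : R) : is_lim_seq (fun j => (3 * INR j + 1) * w18 j) P -> is_lim_seq x18 P.
Proof.
intros H.
replace (Finite P) with (Finite (P * (1 - 0))) by (f_equal; ring).
eapply is_lim_seq_ext; [|eapply is_lim_seq_mult'; [exact H|eapply is_lim_seq_minus';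
  [apply is_lim_seq_const|apply (is_lim_seq_inv_3 1)]]].
intros j; assert (Hj := pos_INR j); unfold x18; simpl; field; lra.
Qed.

(* [w18_sum] and [v18_sum] are meaningful only when [3] does not divide [k]: otherwise one summand has
   denominator [0].  The weights [v18] continue [w18] to negative indices. *)
Definition v18 (P : R) (s : nat) : R := P ^ 2 / (9 * (INR s + 1) ^ 2 * w18 (S s)).
Definition w18_sum (k : Z) : R := Series (fun j => w18 j / (IZR k - 3 * INR j)).
Definition v18_sum (P : R) (k : Z) : R := Series (fun s => v18 P s / (IZR k + 3 * (INR s + 1))).

Lemma v18_step (P : R) (s : nat) :
  (3 * INR s + 5) * (3 * INR s + 4) * v18 P (S s) = 9 * (INR s + 1) ^ 2 * v18 P s.
Proof.
unfold v18; destruct (w18_bounds (S s)) as [H0 _].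
change (w18 (S (S s))) with
  (w18 (S s) * ((3 * INR (S s) + 2) * (3 * INR (S s) + 1) / (3 * INR (S s) + 3) ^ 2)).
assert (Hs := pos_INR s); rewrite !S_INR; field; repeat split; lra.
Qed.

Lemma v18_x18 (P : R) (s : nat) : 3 * (INR s + 1) * v18 P s = P ^ 2 / x18 (S s).
Proof.
unfold v18, x18; destruct (w18_bounds (S s)) as [H0 _]; rewrite S_INR.
assert (Hs := pos_INR s); field; lra.
Qed.

Lemma v18_bound (P : R) (s : nat) : 0 <= 3 * (INR s + 1) * v18 P s <= 3 / 2 * P ^ 2.
Proof.
rewrite v18_x18; assert (H := x18_lower s).
assert (0 <= P ^ 2) by apply pow2_ge_0.
assert (0 < / x18 (S s)) by (apply Rinv_0_lt_compat; lra).
assert (/ x18 (S s) <= / (2 / 3)) by (apply Rinv_le_contravar; lra).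
unfold Rdiv; split; [nra|]. replace (/ (2 / 3)) with (3 / 2) in * by field; nra.
Qed.

(** For [j] large against [|k|] the hypothesis bounds [|m|] from below; for the remaining [j] a
    nonzero integer is at least 1 in absolute value. *)
Lemma integer_shift_bound (k m : Z) (j : nat) :
  (m <> 0)%Z -> (3 * Z.of_nat j - Z.abs k <= Z.abs m)%Z ->
  / Rabs (IZR m) <= (Rabs (IZR k) + 2) * / (INR j + 1).
Proof.
intros Hm H; rewrite !Rabs_Zabs, INR_IZR_INZ.
assert (1 <= Z.abs m)%Z by lia.
assert (A : (Z.of_nat j + 1 <= (Z.abs k + 2) * Z.abs m)%Z).
{ destruct (Z_le_gt_dec (Z.of_nat j) (Z.abs k + 1)); [nia|nia]. }
apply IZR_le in A; rewrite mult_IZR, !plus_IZR in A.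
assert (1 <= IZR (Z.abs m)) by (apply IZR_le; lia).
assert (0 <= IZR (Z.of_nat j)) by (apply IZR_le; lia).
apply Rmult_le_reg_r with (IZR (Z.abs m) * (IZR (Z.of_nat j) + 1)); [nra|].
replace (/ IZR (Z.abs m) * (IZR (Z.abs m) * (IZR (Z.of_nat j) + 1))) with
  (IZR (Z.of_nat j) + 1) by (field; lra).
replace ((IZR (Z.abs k) + 2) * / (IZR (Z.of_nat j) + 1) *
  (IZR (Z.abs m) * (IZR (Z.of_nat j) + 1))) with ((IZR (Z.abs k) + 2) * IZR (Z.abs m))
  by (field; lra).
exact A.
Qed.

Lemma w18_sum_den (k : Z) (j : nat) : IZR k - 3 * INR j = IZR (k - 3 * Z.of_nat j).
Proof. now rewrite minus_IZR, mult_IZR, <- INR_IZR_INZ. Qed.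

Lemma v18_sum_den (k : Z) (s : nat) : IZR k + 3 * (INR s + 1) = IZR (k + 3 * (Z.of_nat s + 1)).
Proof. now rewrite plus_IZR, mult_IZR, plus_IZR, <- INR_IZR_INZ. Qed.

Lemma w18_sum_den_neq (k : Z) (j : nat) : (k mod 3 <> 0)%Z -> IZR k - 3 * INR j <> 0.
Proof.
intros Hk; rewrite w18_sum_den; apply eq_IZR_contrapositive; intros E; apply Hk.
replace k with (Z.of_nat j * 3)%Z by lia; apply Z.mod_mul; lia.
Qed.

Lemma v18_sum_den_neq (k : Z) (s : nat) : (k mod 3 <> 0)%Z -> IZR k + 3 * (INR s + 1) <> 0.
Proof.
intros Hk; rewrite v18_sum_den; apply eq_IZR_contrapositive; intros E; apply Hk.
replace k with ((- (Z.of_nat s + 1)) * 3)%Z by lia; apply Z.mod_mul; lia.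
Qed.

Lemma ex_series_w18_sum (k : Z) : (k mod 3 <> 0)%Z ->
  ex_series (fun j => w18 j / (IZR k - 3 * INR j)).
Proof.
intros Hk; apply ex_series_bound_sq with 1 (Rabs (IZR k) + 2); [lra|]; intros j.
assert (Hd := w18_sum_den_neq k j Hk); rewrite w18_sum_den in *.
unfold Rdiv; rewrite Rabs_mult, Rabs_inv.
destruct (w18_bounds j) as [H0 H1]; assert (Hj := pos_INR j); rewrite (Rabs_pos_eq (w18 j)) by lra.
assert (B := integer_shift_bound k (k - 3 * Z.of_nat j) j).
assert (Hn : (k - 3 * Z.of_nat j <> 0)%Z) by (intros E; apply Hd; now rewrite E).
specialize (B Hn ltac:(lia)).
assert (0 < / (INR j + 1)) by (apply Rinv_0_lt_compat; lra).
assert (w18 j <= / (INR j + 1)).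
{ apply Rmult_le_reg_r with (INR j + 1); [lra|]; rewrite Rinv_l by lra; nra. }
assert (0 <= / Rabs (IZR (k - 3 * Z.of_nat j))).
{ left; apply Rinv_0_lt_compat; now apply Rabs_pos_lt. }
simpl pow; rewrite Rmult_1_r.
replace ((Rabs (IZR k) + 2) * (/ (INR j + 1) * / (INR j + 1))) with
  (/ (INR j + 1) * ((Rabs (IZR k) + 2) * / (INR j + 1))) by ring.
apply Rmult_le_compat; lra.
Qed.

Lemma ex_series_v18_sum (P : R) (k : Z) : (k mod 3 <> 0)%Z ->
  ex_series (fun s => v18 P s / (IZR k + 3 * (INR s + 1))).
Proof.
intros Hk; apply ex_series_bound_sq with 1 (P ^ 2 * (Rabs (IZR k) + 2)); [lra|]; intros s.
assert (Hd := v18_sum_den_neq k s Hk); rewrite v18_sum_den in *.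
unfold Rdiv; rewrite Rabs_mult, Rabs_inv.
assert (Hs := pos_INR s); destruct (v18_bound P s) as [H0 H1].
assert (0 <= P ^ 2) by apply pow2_ge_0.
assert (V0 : 0 <= v18 P s).
{ apply Rmult_le_reg_l with (3 * (INR s + 1)); lra. }
rewrite (Rabs_pos_eq (v18 P s)) by lra.
assert (B := integer_shift_bound k (k + 3 * (Z.of_nat s + 1)) s).
assert (Hn : (k + 3 * (Z.of_nat s + 1) <> 0)%Z) by (intros E; apply Hd; now rewrite E).
specialize (B Hn ltac:(lia)).
assert (0 < / (INR s + 1)) by (apply Rinv_0_lt_compat; lra).
assert (v18 P s <= P ^ 2 * / (INR s + 1)).
{ apply Rmult_le_reg_r with (INR s + 1); [lra|]; rewrite Rmult_assoc, Rinv_l by lra; nra. }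
assert (0 <= / Rabs (IZR (k + 3 * (Z.of_nat s + 1)))).
{ left; apply Rinv_0_lt_compat; now apply Rabs_pos_lt. }
simpl pow; rewrite !Rmult_1_r; simpl pow in *; rewrite !Rmult_1_r in *.
replace (P * P * (Rabs (IZR k) + 2) * (/ (INR s + 1) * / (INR s + 1))) with
  (P * P * / (INR s + 1) * ((Rabs (IZR k) + 2) * / (INR s + 1))) by ring.
apply Rmult_le_compat; lra.
Qed.

Lemma shift_mod_3 (k : Z) : (k mod 3 <> 0)%Z -> ((k + 3) mod 3 <> 0)%Z.
Proof. intros H; replace (k + 3)%Z with (k + 1 * 3)%Z by ring; now rewrite Z.mod_add. Qed.

(** Telescoping in [j] leaves exactly the boundary term at infinity, the limit of [x18]. *)
Lemma w18_sum_rec (P : R) (k : Z) : is_lim_seq x18 P -> (k mod 3 <> 0)%Z ->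
  (IZR k + 3) ^ 2 * w18_sum (k + 3) - (IZR k + 1) * (IZR k + 2) * w18_sum k = P.
Proof.
intros HP Hk.
set (g := fun j => - (x18 j * (3 * INR j / (IZR k + 3 - 3 * INR j)))).
assert (Hg : is_lim_seq g P).
{ replace (Finite P) with (Finite (P * (1 + (IZR k + 3) * 0))) by (f_equal; ring).
  eapply is_lim_seq_ext; [|apply is_lim_seq_mult'; [exact HP|apply is_lim_seq_plus';
    [apply is_lim_seq_const|apply is_lim_seq_mult'; [apply is_lim_seq_const|
    apply (is_lim_seq_inv_3 (- (IZR k + 3)))]]]].
  intros j; assert (Hd := w18_sum_den_neq _ j (shift_mod_3 k Hk)); rewrite plus_IZR in Hd.
  unfold g; field; split; lra. }
apply is_series_telescope in Hg.
assert (H1 := Series_correct _ (ex_series_w18_sum k Hk)).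
assert (H2 := Series_correct _ (ex_series_w18_sum (k + 3) (shift_mod_3 k Hk))).
assert (H := is_series_lin _ _ ((IZR k + 3) ^ 2) (- ((IZR k + 1) * (IZR k + 2))) _ _ H2 H1).
fold (w18_sum k) (w18_sum (k + 3)) in H.
replace P with (P - g 0%nat) by (unfold g, x18; simpl INR; field;
  assert (Hd := w18_sum_den_neq _ 0 (shift_mod_3 k Hk)); rewrite plus_IZR in Hd; simpl INR in Hd; lra).
rewrite <- (is_series_unique _ _ Hg).
transitivity ((IZR k + 3) ^ 2 * w18_sum (k + 3) + - ((IZR k + 1) * (IZR k + 2)) * w18_sum k); [ring|].
symmetry; apply is_series_unique.
eapply is_series_ext; [|exact H]; intros j; cbv beta.
match goal with |- ?x = ?y => change (@eq R x y) end.
assert (D1 := w18_sum_den_neq _ j Hk); assert (D2 := w18_sum_den_neq _ j (shift_mod_3 k Hk)).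
rewrite plus_IZR in *; unfold g, x18; cbn [w18]; rewrite S_INR; assert (Hj := pos_INR j).
field; repeat split; lra.
Qed.

(** The weights continue [w18], so the same operator telescopes. The normalisation [P ^ 2] in [v18]
    makes the term at infinity again [P]; the cut between indices -1 and 0 contributes the rest. *)
Lemma v18_sum_rec (P : R) (k : Z) : P <> 0 -> is_lim_seq x18 P -> (k mod 3 <> 0)%Z ->
  (IZR k + 3) ^ 2 * v18_sum P (k + 3) - (IZR k + 1) * (IZR k + 2) * v18_sum P k = P - P ^ 2 / (IZR k + 3).
Proof.
intros P0 HP Hk.
set (g := fun s => (3 * INR s + 1) * (3 * INR s + 2) * v18 P s / (IZR k + 3 * (INR s + 1))).
assert (Hg : is_lim_seq g P).
{ replace (Finite P) with (Finite (P ^ 2 / P * ((1 - 2 * 0) * (1 + (- IZR k - 1) * 0))))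
    by (f_equal; field; lra).
  eapply is_lim_seq_ext; [|apply is_lim_seq_mult'; [apply is_lim_seq_div'; [apply is_lim_seq_const|
    exact (proj1 (is_lim_seq_incr_1 x18 P) HP)|exact P0]|apply is_lim_seq_mult'; [
    apply is_lim_seq_minus'; [apply is_lim_seq_const|apply is_lim_seq_mult';
      [apply is_lim_seq_const | apply (is_lim_seq_inv_3 3)]]|
    apply is_lim_seq_plus'; [apply is_lim_seq_const|apply is_lim_seq_mult';
      [apply is_lim_seq_const | apply (is_lim_seq_inv_3 (IZR k + 3))]]]]].
  intros s; assert (Hd := v18_sum_den_neq _ s Hk); assert (Hs := pos_INR s).
  cbv beta; rewrite <- v18_x18; unfold g; field; repeat split; lra. }
apply is_series_telescope in Hg.
assert (H1 := Series_correct _ (ex_series_v18_sum P k Hk)).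
assert (H2 := Series_correct _ (ex_series_v18_sum P (k + 3) (shift_mod_3 k Hk))).
assert (H := is_series_lin _ _ ((IZR k + 3) ^ 2) (- ((IZR k + 1) * (IZR k + 2))) _ _ H2 H1).
fold (v18_sum P k) (v18_sum P (k + 3)) in H.
assert (D := w18_sum_den_neq _ 0 (shift_mod_3 k Hk)); rewrite plus_IZR in D; simpl INR in D.
replace (P ^ 2 / (IZR k + 3)) with (g 0%nat) by (unfold g, v18; simpl INR; simpl w18; field; lra).
rewrite <- (is_series_unique _ _ Hg).
transitivity ((IZR k + 3) ^ 2 * v18_sum P (k + 3) + - ((IZR k + 1) * (IZR k + 2)) * v18_sum P k); [ring|].
symmetry; apply is_series_unique.
eapply is_series_ext; [|exact H]; intros s; cbv beta.
match goal with |- ?x = ?y => change (@eq R x y) end.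
assert (D1 := v18_sum_den_neq _ s Hk); assert (D2 := v18_sum_den_neq _ s (shift_mod_3 k Hk)).
rewrite plus_IZR in *; assert (Hs := pos_INR s).
assert (Ev : v18 P (S s) = 9 * (INR s + 1) ^ 2 * v18 P s / ((3 * INR s + 5) * (3 * INR s + 4))).
{ rewrite <- v18_step; field; lra. }
unfold g; rewrite Ev, S_INR; field; repeat split; lra.
Qed.

(** In the difference of the two sums the terms [P] cancel and [P ^ 2 / (k + 3)] remains, the source
    in [z18]. No initial value is needed: [k = r - 3] is -2 or -1, where [(k + 1) * (k + 2)]
    vanishes. *)
Lemma z18_rep (P : R) (r : Z) (i : nat) : P <> 0 -> is_lim_seq x18 P -> (r = 1 \/ r = 2)%Z ->
  P ^ 2 * z18 (IZR r) i = w18_sum (3 * Z.of_nat i + r) - v18_sum P (3 * Z.of_nat i + r).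
Proof.
intros P0 HP Hr.
assert (Rk : forall k : Z, (k mod 3 <> 0)%Z -> (IZR k + 3) ^ 2 * (w18_sum (k + 3) - v18_sum P (k + 3)) =
  (IZR k + 1) * (IZR k + 2) * (w18_sum k - v18_sum P k) + P ^ 2 / (IZR k + 3)).
{ intros k Hk; generalize (w18_sum_rec P k HP Hk), (v18_sum_rec P k P0 HP Hk); lra. }
induction i as [|i IH].
- specialize (Rk (r - 3)%Z).
  replace (r - 3 + 3)%Z with r in Rk by ring.
  simpl (3 * Z.of_nat 0 + r)%Z.
  assert (Hm : ((r - 3) mod 3 <> 0)%Z) by (destruct Hr as [-> | ->]; discriminate).
  specialize (Rk Hm); simpl z18.
  destruct Hr as [-> | ->]; simpl (_ - 3)%Z in Rk; lra.
- specialize (Rk (3 * Z.of_nat i + r)%Z).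
  replace (3 * Z.of_nat (S i) + r)%Z with (3 * Z.of_nat i + r + 3)%Z by lia.
  assert (Hm : ((3 * Z.of_nat i + r) mod 3 <> 0)%Z).
  { rewrite Z.add_comm, Z.mul_comm, Z.mod_add by lia; destruct Hr as [-> | ->]; discriminate. }
  specialize (Rk Hm); rewrite <- IH, plus_IZR, mult_IZR, <- INR_IZR_INZ in Rk.
  assert (Hi := pos_INR i).
  assert (0 < IZR r) by (apply IZR_lt; lia).
  apply Rmult_eq_reg_l with ((3 * INR i + IZR r + 3) ^ 2); [|apply pow_nonzero; lra].
  rewrite Rk; cbn [z18]; field; lra.
Qed.

Lemma Series_tannery (f : nat -> nat -> R) (g h : nat -> R) :
  ex_series g -> (forall i l, Rabs (f i l) <= g l) ->
  (forall l, is_lim_seq (fun i => f i l) (h l)) ->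
  is_lim_seq (fun i => Series (f i)) (Series h).
Proof.
intros Eg B L.
assert (Bh : forall l, Rabs (h l) <= g l).
{ intros l; assert (A := is_lim_seq_abs _ _ (L l)); simpl in A.
  apply (is_lim_seq_le (fun i => Rabs (f i l)) (fun _ => g l) (Finite (Rabs (h l))) (Finite (g l)));
    auto using is_lim_seq_const. }
assert (Ex : forall u : nat -> R, (forall l, Rabs (u l) <= g l) -> ex_series u).
{ intros u Hu; exact (ex_series_le (K := R_AbsRing) (V := R_CompleteNormedModule) u g Hu Eg). }
assert (Tail : forall u : nat -> R, (forall l, Rabs (u l) <= g l) -> forall N,
  Rabs (Series u - sum_f_R0 u N) <= Series g - sum_f_R0 g N).
{ intros u Hu N.
  rewrite (Series_incr_n u (S N)), (Series_incr_n g (S N)) by (auto; lia); simpl pred.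
  replace (_ + _ - sum_f_R0 u N) with (Series (fun k => u (S N + k)%nat)) by ring.
  replace (_ + _ - sum_f_R0 g N) with (Series (fun k => g (S N + k)%nat)) by ring.
  assert (Eg' : ex_series (fun k => g (S N + k)%nat)) by now apply ex_series_incr_n.
  eapply Rle_trans; [apply Series_Rabs|apply Series_le; auto using Rabs_pos].
  apply (ex_series_le (K := R_AbsRing) (V := R_CompleteNormedModule)) with (2 := Eg').
  intros m; unfold norm; simpl; unfold abs; simpl; rewrite Rabs_Rabsolu; apply Hu. }
apply is_lim_seq_spec; intros eps.
assert (He : 0 < eps / 3) by (generalize (cond_pos eps); lra).
assert (TG := Series_correct _ Eg); apply is_lim_series, is_lim_seq_spec in TG.
destruct (TG (mkposreal _ He)) as [N HN]; specialize (HN N (Nat.le_refl _)); simpl in HN.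
rewrite sum_n_Reals in HN.
assert (F : is_lim_seq (fun i => sum_f_R0 (f i) N) (sum_f_R0 h N)).
{ clear - L; induction N as [|N IH]; [apply L|].
  simpl; apply is_lim_seq_plus'; auto. }
apply is_lim_seq_spec in F; destruct (F (mkposreal _ He)) as [M HM].
exists M; intros i Hi; specialize (HM i Hi); simpl in HM.
assert (T1 := Tail (f i) (B i) N); assert (T2 := Tail h Bh N).
apply Rabs_def2 in HN; apply Rabs_def2 in HM.
apply Rabs_le_between in T1; apply Rabs_le_between in T2.
apply Rabs_def1; lra.
Qed.

Definition kappa (l : nat) : R := / ((3 * INR l + 1) * (3 * INR l + 2)).

Lemma kappa_pos (l : nat) : 0 < kappa l.
Proof. assert (H := pos_INR l); apply Rinv_0_lt_compat; nra. Qed.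

Lemma ex_series_kappa : ex_series kappa.
Proof.
apply ex_series_bound_sq with 1 1; [lra|]; intros l; assert (H := pos_INR l).
rewrite Rabs_pos_eq by (left; apply kappa_pos).
rewrite Rmult_1_l, pow_inv; unfold kappa; apply Rinv_le_contravar; nra.
Qed.

Lemma sum_f_R0_reverse (f : nat -> R) (i : nat) :
  sum_f_R0 (fun l => f (i - l)%nat) i = sum_f_R0 f i.
Proof.
induction i as [|i IH]; [reflexivity|].
rewrite decomp_sum by lia; simpl pred; rewrite tech5, Nat.sub_0_r, Rplus_comm; f_equal.
rewrite <- IH; apply sum_eq; intros l Hl; now replace (S i - S l)%nat with (i - l)%nat by lia.
Qed.

Lemma is_series_finite (f : nat -> R) (i : nat) :
  is_series (fun l => if (l <=? i)%nat then f l else 0) (sum_f_R0 f i).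
Proof.
apply is_series_lim, is_lim_seq_ext_loc with (fun _ => sum_f_R0 f i); [|apply is_lim_seq_const].
exists i; intros n Hn; rewrite sum_n_Reals.
replace n with (i + (n - i))%nat by lia; generalize (n - i)%nat as d; clear.
induction d as [|d IH].
- rewrite Nat.add_0_r; apply sum_eq; intros l Hl; now destruct (Nat.leb_spec l i); [|lia].
- rewrite Nat.add_succ_r, tech5, <- IH; destruct (Nat.leb_spec (S (i + d)) i); [lia|ring].
Qed.

Definition d18 (P : R) (i l : nat) : R :=
  (if (l <=? i)%nat then x18 (i - l) else 0) * kappa l + x18 (S i + l) * kappa l
   + 3 * (INR l + 1) * v18 P l * kappa (i + l + 1).

(** With d = 3(i-j), (3i+1)/(d+1) - (3i+2)/(d+2) = 3j/((d+1)(d+2)). The denominator is the same for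
    j = i-l and j = i+1+l, which folds the sum around [i] into two sums against [kappa]. *)
Lemma w18_sum_difference (i : nat) :
  is_series (fun l => (if (l <=? i)%nat then x18 (i - l) else 0) * kappa l + x18 (S i + l) * kappa l)
   ((3 * INR i + 1) * w18_sum (3 * Z.of_nat i + 1) - (3 * INR i + 2) * w18_sum (3 * Z.of_nat i + 2)).
Proof.
assert (M1 : ((3 * Z.of_nat i + 1) mod 3 <> 0)%Z)
  by (rewrite Z.add_comm, Z.mul_comm, Z.mod_add by lia; discriminate).
assert (M2 : ((3 * Z.of_nat i + 2) mod 3 <> 0)%Z)
  by (rewrite Z.add_comm, Z.mul_comm, Z.mod_add by lia; discriminate).
assert (H := is_series_lin _ _ (3 * INR i + 1) (- (3 * INR i + 2)) _ _
  (Series_correct _ (ex_series_w18_sum _ M1)) (Series_correct _ (ex_series_w18_sum _ M2))).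
fold (w18_sum (3 * Z.of_nat i + 1)) (w18_sum (3 * Z.of_nat i + 2)) in H.
set (t := fun j => _) in H.
replace ((3 * INR i + 1) * w18_sum (3 * Z.of_nat i + 1) - (3 * INR i + 2) * w18_sum (3 * Z.of_nat i + 2))
 with (Series t) by (rewrite (is_series_unique _ _ H); ring).
assert (Et : ex_series t) by (eexists; exact H).
assert (T : forall j, t j = x18 j / ((3 * (INR i - INR j) + 1) * (3 * (INR i - INR j) + 2))).
{ intros j; unfold t, x18; assert (D1 := w18_sum_den_neq _ j M1); assert (D2 := w18_sum_den_neq _ j M2).
  rewrite !plus_IZR, !mult_IZR, <- INR_IZR_INZ in *; field; repeat split; lra. }
rewrite (Series_incr_n t (S i)) by (auto; lia); simpl pred.
rewrite <- sum_f_R0_reverse.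
assert (H3 := is_series_lin _ _ 1 1 _ _ (is_series_finite (fun l => t (i - l)%nat) i)
  (Series_correct _ (proj1 (ex_series_incr_n t (S i)) Et))).
rewrite !Rmult_1_l in H3.
eapply is_series_ext; [|exact H3]; intros l; cbv beta.
match goal with |- ?x = ?y => change (@eq R x y) end.
rewrite !Rmult_1_l, !T; unfold kappa; assert (Hl := pos_INR l); apply (f_equal2 Rplus).
- destruct (Nat.leb_spec l i) as [L|L]; [|ring].
  rewrite minus_INR by lia; field; lra.
- replace (S i + l)%nat with (i + l + 1)%nat by lia; rewrite !plus_INR; simpl INR.
  field; lra.
Qed.

Lemma v18_sum_difference (P : R) (i : nat) :
  is_series (fun s => 3 * (INR s + 1) * v18 P s * kappa (i + s + 1))
   (- ((3 * INR i + 1) * v18_sum P (3 * Z.of_nat i + 1) - (3 * INR i + 2) * v18_sum P (3 * Z.of_nat i + 2))).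
Proof.
assert (M1 : ((3 * Z.of_nat i + 1) mod 3 <> 0)%Z)
  by (rewrite Z.add_comm, Z.mul_comm, Z.mod_add by lia; discriminate).
assert (M2 : ((3 * Z.of_nat i + 2) mod 3 <> 0)%Z)
  by (rewrite Z.add_comm, Z.mul_comm, Z.mod_add by lia; discriminate).
assert (H := is_series_lin _ _ (- (3 * INR i + 1)) (3 * INR i + 2) _ _
  (Series_correct _ (ex_series_v18_sum P _ M1)) (Series_correct _ (ex_series_v18_sum P _ M2))).
fold (v18_sum P (3 * Z.of_nat i + 1)) (v18_sum P (3 * Z.of_nat i + 2)) in H.
match goal with |- is_series _ ?l => replace l with
 (- (3 * INR i + 1) * v18_sum P (3 * Z.of_nat i + 1) + (3 * INR i + 2) * v18_sum P (3 * Z.of_nat i + 2))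
 by ring end.
eapply is_series_ext; [|exact H]; intros s; cbv beta.
match goal with |- ?x = ?y => change (@eq R x y) end.
rewrite !plus_IZR, !mult_IZR, <- INR_IZR_INZ; unfold kappa; rewrite !plus_INR; simpl (INR 1).
assert (Hs := pos_INR s); assert (Hi := pos_INR i); field; repeat split; lra.
Qed.

(** Each folded half tends to [P * Series kappa], as [x18] is read ever farther out; in the third
    part [kappa] moves off to infinity. *)
Lemma d18_lim (P : R) : is_lim_seq x18 P ->
  is_lim_seq (fun i => Series (d18 P i)) (2 * P * Series kappa).
Proof.
intros HP; rewrite <- Series_scal_l.
apply Series_tannery with (fun l => (2 + 3 / 2 * P ^ 2) * kappa l).
- apply ex_series_Rscal, ex_series_kappa.
- intros i l; assert (K := kappa_pos l); assert (V := v18_bound P l).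
  assert (X2 := x18_upper (S i + l)).
  assert (X1 : 0 <= (if (l <=? i)%nat then x18 (i - l) else 0) <= 1).
  { destruct (l <=? i)%nat; [apply x18_upper | lra]. }
  assert (K2 : 0 < kappa (i + l + 1) <= kappa l).
  { split; [apply kappa_pos|]; unfold kappa; rewrite !plus_INR; simpl (INR 1).
    assert (Hl := pos_INR l); assert (Hi := pos_INR i); apply Rinv_le_contravar; nra. }
  unfold d18; rewrite Rabs_pos_eq; nra.
- intros l; replace (2 * P * kappa l) with (P * kappa l + P * kappa l + 0) by ring.
  apply is_lim_seq_plus'; [apply is_lim_seq_plus'|].
  + apply is_lim_seq_mult'; [|apply is_lim_seq_const].
    apply (is_lim_seq_incr_n _ l).
    eapply is_lim_seq_ext; [|exact HP]; intros n; cbv beta.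
    destruct (Nat.leb_spec l (n + l)); [f_equal; lia|lia].
  + apply is_lim_seq_mult'; [|apply is_lim_seq_const].
    apply is_lim_seq_ext with (fun n => x18 (n + S l)); [intros n; f_equal; lia|].
    apply (is_lim_seq_incr_n x18), HP.
  + replace (Finite 0) with (Finite (3 * (INR l + 1) * v18 P l * 0)) by (f_equal; ring).
    apply is_lim_seq_mult'; [apply is_lim_seq_const|].
    apply is_lim_seq_ext with (fun n => kappa (n + (l + 1))); [intros n; f_equal; lia|].
    apply (is_lim_seq_incr_n kappa); apply ex_series_lim_0, ex_series_kappa.
Qed.

(** Only the difference of the limits for [r = 1] and [r = 2] gets evaluated, so the existence of
    each is proved apart: the sequence increases and stays below 4. *)
Lemma z18_cvg (r : R) : 1 <= r <= 2 -> ex_finite_lim_seq (fun i => (3 * INR i + r) * z18 r i).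
Proof.
intros Hr.
(* With m = 3i + r, the bound is attained at m = 1 and preserved because (m+1)(m+2)(4m-3)/m^2 +
   1/(m+3) <= 4m + 9 = 4(m+3) - 3. *)
assert (B : forall i, 0 <= z18 r i /\ z18 r i <= (4 * (3 * INR i + r) - 3) / (3 * INR i + r) ^ 2).
{ induction i as [|i [IH0 IH]].
  - simpl INR; simpl z18; assert (0 < r ^ 3) by (apply pow_lt; lra).
    split; [left; now apply Rinv_0_lt_compat|].
    replace (/ (r * (r * (r * 1)))) with (/ r / (r * r)) by (field; lra).
    replace ((4 * (3 * 0 + r) - 3) / (3 * 0 + r) ^ 2) with ((4 * r - 3) / (r * r)) by (field; lra).
    apply Rmult_le_compat_r; [left; apply Rinv_0_lt_compat; nra|].
    apply Rmult_le_reg_r with r; [lra|]; rewrite Rinv_l by lra; nra.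
  - cbn [z18]; rewrite S_INR; assert (Hi := pos_INR i).
    set (m := 3 * INR i + r) in *; assert (Hm : 1 <= m) by (unfold m; lra).
    replace (3 * INR i + 2 + r) with (m + 2) by (unfold m; ring).
    replace (3 * INR i + 1 + r) with (m + 1) by (unfold m; ring).
    replace (3 * INR i + 3 + r) with (m + 3) by (unfold m; ring).
    replace (3 * (INR i + 1) + r) with (m + 3) by (unfold m; ring).
    assert (0 < / (m + 3)) by (apply Rinv_0_lt_compat; lra).
    assert (0 < / (m + 3) ^ 2) by (apply Rinv_0_lt_compat, pow_lt; lra).
    assert (0 <= (m + 2) * (m + 1) * z18 r i) by (apply Rmult_le_pos; nra).
    split; [apply Rmult_le_pos; lra|].
    apply Rmult_le_compat_r; [lra|].
    apply Rle_trans with ((m + 2) * (m + 1) * ((4 * m - 3) / m ^ 2) + / (m + 3)).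
    + apply Rplus_le_compat_r, Rmult_le_compat_l; [nra|exact IH].
    + replace ((m + 2) * (m + 1) * ((4 * m - 3) / m ^ 2)) with (4 * m + 9 - / m - 6 * / m ^ 2)
        by (field; lra).
      assert (/ (m + 3) <= / m) by (apply Rinv_le_contravar; lra).
      assert (0 < / m ^ 2) by (apply Rinv_0_lt_compat, pow_lt; lra). lra. }
apply ex_finite_lim_seq_incr with 4.
- intros i; destruct (B i) as [Z0 _]; cbn [z18]; rewrite S_INR; assert (Hi := pos_INR i).
  set (m := 3 * INR i + r) in *; assert (Hm : 1 <= m) by (unfold m; lra).
  replace (3 * INR i + 2 + r) with (m + 2) by (unfold m; ring).
  replace (3 * INR i + 1 + r) with (m + 1) by (unfold m; ring).
  replace (3 * INR i + 3 + r) with (m + 3) by (unfold m; ring).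
  replace (3 * (INR i + 1) + r) with (m + 3) by (unfold m; ring).
  replace ((m + 3) * (((m + 2) * (m + 1) * z18 r i + / (m + 3)) / (m + 3) ^ 2)) with
    (m * z18 r i + 2 * z18 r i * / (m + 3) + / (m + 3) ^ 2) by (field; lra).
  assert (0 < / (m + 3)) by (apply Rinv_0_lt_compat; lra).
  assert (0 < / (m + 3) ^ 2) by (apply Rinv_0_lt_compat, pow_lt; lra). nra.
- intros i; destruct (B i) as [_ Z1]; assert (Hi := pos_INR i).
  set (m := 3 * INR i + r) in *; assert (Hm : 1 <= m) by (unfold m; lra).
  apply Rmult_le_compat_l with (r := m) in Z1; [|lra].
  replace (m * ((4 * m - 3) / m ^ 2)) with (4 - 3 * / m) in Z1 by (field; lra).
  assert (0 < / m) by (apply Rinv_0_lt_compat; lra). lra.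
Qed.

Lemma limit_V18_of_P (a b : nat -> R) (P : R) :
  is_lim_seq (fun j => (3 * INR j + 1) * w18 j) P -> P <> 0 ->
  solves V18 a -> solves V18 b -> a 0%nat = 1 -> a 1%nat = recP V18 1 ->
  b 0%nat = 0 -> b 1%nat = 1 ->
  is_lim_seq (fun n => b n / a n) (Series kappa / (3 * P ^ 2)).
Proof.
intros HP P0 Ha Hb a0 a1 b0 b1.
destruct (z18_cvg 1) as [Z1 H1]; [lra|]; destruct (z18_cvg 2) as [Z2 H2]; [lra|].
assert (Hx := x18_lim P HP).
assert (E : P ^ 2 * (Z1 - Z2) = 2 * P * Series kappa).
{ assert (L1 : is_lim_seq (fun i => P ^ 2 * ((3 * INR i + 1) * z18 1 i - (3 * INR i + 2) * z18 2 i))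
    (P ^ 2 * (Z1 - Z2))).
  { apply is_lim_seq_mult'; [apply is_lim_seq_const | now apply is_lim_seq_minus']. }
  assert (L2 := d18_lim P Hx).
  apply is_lim_seq_unique in L1; apply is_lim_seq_unique in L2.
  enough (Finite (P ^ 2 * (Z1 - Z2)) = Finite (2 * P * Series kappa)) by congruence.
  rewrite <- L1, <- L2; apply Lim_seq_ext; intros i.
  symmetry; apply is_series_unique.
  generalize (is_series_plus _ _ _ _ (w18_sum_difference i) (v18_sum_difference P i)).
  unfold plus at 2; cbn -[INR Z.mul Z.of_nat].
  assert (R1 := z18_rep P 1 i P0 Hx ltac:(lia)); assert (R2 := z18_rep P 2 i P0 Hx ltac:(lia)).
  match goal with |- is_series _ ?x -> is_series _ ?y => replace x with y end; [exact (fun H => H)|].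
  transitivity ((3 * INR i + 1) * (P ^ 2 * z18 1 i) - (3 * INR i + 2) * (P ^ 2 * z18 2 i)); [ring|].
  rewrite R1, R2; ring. }
replace (Series kappa / (3 * P ^ 2)) with ((Z1 - Z2) / (6 * P)).
- now apply limit_V18_of_constants.
- apply Rmult_eq_reg_l with (6 * P ^ 2); [|assert (0 < P ^ 2) by (apply pow2_gt_0; lra); lra].
  transitivity (P ^ 2 * (Z1 - Z2) / P); [field; lra|]; rewrite E; field; lra.
Qed.

(** * Evaluation of the constants *)

Definition cos_moment (a : R) (n : nat) : R := RInt (fun t => cos (a * t) * cos t ^ n) 0 (PI / 2).

Lemma ex_RInt_cos_moment (a : R) (n : nat) :
  ex_RInt (fun t => cos (a * t) * cos t ^ n) 0 (PI / 2).
Proof.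
apply (ex_RInt_continuous (V := R_CompleteNormedModule)); intros t _.
apply (ex_derive_continuous (K := R_AbsRing) (V := R_NormedModule)); auto_derive; trivial.
Qed.

(** Two integrations by parts, condensed into the function [F], which vanishes at both ends. *)
Lemma cos_moment_rec (a : R) (n : nat) :
  ((INR n + 2) ^ 2 - a ^ 2) * cos_moment a (S (S n)) = (INR n + 2) * (INR n + 1) * cos_moment a n.
Proof.
set (F := fun t => (INR n + 2) * (cos t ^ S n * sin t * cos (a * t)) - a * (cos t ^ S (S n) * sin (a * t))).
set (f := fun t => ((INR n + 2) ^ 2 - a ^ 2) * (cos (a * t) * cos t ^ S (S n))
   + - ((INR n + 2) * (INR n + 1)) * (cos (a * t) * cos t ^ n)).
assert (I : is_RInt f 0 (PI / 2) (F (PI / 2) - F 0)).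
{ apply (is_RInt_derive (V := R_CompleteNormedModule) F f); intros t _.
  - unfold F; auto_derive; [trivial|].
    unfold f; change (match n with O => 1 | S _ => INR n + 1 end) with (INR (S n)).
    rewrite S_INR; simpl (cos t ^ S _).
    assert (E := sin2_cos2 t); unfold Rsqr in E.
    replace (- ((INR n + 2) * (INR n + 1)) * (cos (a * t) * cos t ^ n)) with
     (- ((INR n + 2) * (INR n + 1)) * (cos (a * t) * cos t ^ n) * (sin t * sin t + cos t * cos t))
     by (rewrite E; ring).
    ring.
  - apply (ex_derive_continuous (K := R_AbsRing) (V := R_NormedModule)); unfold f; auto_derive; trivial. }
assert (E0 : F (PI / 2) - F 0 = 0).
{ unfold F; rewrite cos_PI2, Rmult_0_r, sin_0, !pow_i by lia; ring. }
rewrite E0 in I.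
assert (J := is_RInt_plus _ _ _ _ _ _
  (is_RInt_scal _ _ _ ((INR n + 2) ^ 2 - a ^ 2) _ (RInt_correct _ _ _ (ex_RInt_cos_moment a (S (S n)))))
  (is_RInt_scal _ _ _ (- ((INR n + 2) * (INR n + 1))) _ (RInt_correct _ _ _ (ex_RInt_cos_moment a n)))).
apply (is_RInt_unique (V := R_CompleteNormedModule)) in I, J.
fold (cos_moment a n) (cos_moment a (S (S n))) in J.
assert (K : 0 = ((INR n + 2) ^ 2 - a ^ 2) * cos_moment a (S (S n))
   + - ((INR n + 2) * (INR n + 1)) * cos_moment a n) by (rewrite <- I; exact J).
lra.
Qed.

Lemma cos_moment_0_pos (m : nat) : 0 < cos_moment 0 (2 * m).
Proof.
induction m as [|m IH].
- unfold cos_moment; rewrite (RInt_ext _ (fun _ => 1)).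
  + rewrite RInt_const; unfold scal; simpl; unfold mult; simpl; generalize PI_RGT_0; lra.
  + intros t _; simpl; rewrite Rmult_0_l, cos_0; ring.
- replace (2 * S m)%nat with (S (S (2 * m))) by lia.
  assert (R0 := cos_moment_rec 0 (2 * m)); assert (Hn := pos_INR (2 * m)).
  apply Rmult_lt_reg_l with ((INR (2 * m) + 2) ^ 2 - 0 ^ 2); [nra|]; rewrite R0; nra.
Qed.

(** On the interval, cos(t)^2 <= cos(2t/3) <= 1. *)
Lemma cos_moment_squeeze (n : nat) :
  cos_moment 0 (S (S n)) <= cos_moment (2 / 3) n <= cos_moment 0 n.
Proof.
assert (Hpi := PI_RGT_0).
split; (apply RInt_le; [lra|apply ex_RInt_cos_moment|apply ex_RInt_cos_moment|]);
intros t Ht; rewrite Rmult_0_l, cos_0, ?Rmult_1_l;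
assert (C0 : 0 <= cos t) by (apply cos_ge_0; lra);
assert (Cn : 0 <= cos t ^ n) by now apply pow_le.
- assert (C1 := COS_bound t).
  assert (D : cos t <= cos (2 / 3 * t)) by (apply cos_decr_1; lra).
  assert (Q : cos t * cos t <= cos (2 / 3 * t)) by nra.
  apply Rmult_le_compat_r with (r := cos t ^ n) in Q; [|exact Cn]; simpl pow; lra.
- assert (D := COS_bound (2 / 3 * t)); nra.
Qed.

(** For a = 2/3 the moment recurrences differ by 1 - a^2/(2m+2)^2 = 1 - 1/(3m+3)^2, the factor of
    [w18_bounds]; at [m = 0] the moments are (3/2) sin(pi/3) and pi/2. *)
Lemma w18_cos_moment (m : nat) : (3 * INR m + 1) * w18 m * cos_moment (2 / 3) (2 * m) =
  sin (PI / 3) / (PI / 3) * cos_moment 0 (2 * m).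
Proof.
induction m as [|m IH].
- assert (Hpi := PI_RGT_0).
  assert (E1 : cos_moment (2 / 3) (2 * 0) = 3 / 2 * sin (PI / 3)).
  { unfold cos_moment; apply is_RInt_unique.
    replace (3 / 2 * sin (PI / 3)) with
      (minus (3 / 2 * sin (2 / 3 * (PI / 2))) (3 / 2 * sin (2 / 3 * 0))).
    - apply (is_RInt_derive (V := R_CompleteNormedModule) (fun t => 3 / 2 * sin (2 / 3 * t)));
      intros t _.
      + auto_derive; [trivial|]; simpl; field.
      + apply (ex_derive_continuous (K := R_AbsRing) (V := R_NormedModule)); auto_derive; trivial.
    - rewrite Rmult_0_r, sin_0; replace (2 / 3 * (PI / 2)) with (PI / 3) by field.
      unfold minus, plus, opp; simpl; ring. }
  assert (E2 : cos_moment 0 (2 * 0) = PI / 2).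
  { unfold cos_moment; rewrite (RInt_ext _ (fun _ => 1)).
    + rewrite RInt_const; unfold scal; simpl; unfold mult; simpl; ring.
    + intros t _; simpl; rewrite Rmult_0_l, cos_0; ring. }
  rewrite E1, E2; simpl; field; lra.
- replace (2 * S m)%nat with (S (S (2 * m))) by lia.
  assert (Hm := pos_INR m).
  assert (R1 := cos_moment_rec (2 / 3) (2 * m)); assert (R0 := cos_moment_rec 0 (2 * m)).
  rewrite mult_INR in R0, R1; change (INR 2) with 2 in R0, R1.
  cbn [w18]; rewrite S_INR.
  apply Rmult_eq_reg_l with ((2 * INR m + 2) ^ 2); [|apply pow_nonzero; lra].
  transitivity ((3 * INR m + 1) * w18 m *
     (((2 * INR m + 2) ^ 2 - (2 / 3) ^ 2) * cos_moment (2 / 3) (S (S (2 * m))))); [field; lra|].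
  rewrite R1.
  transitivity (sin (PI / 3) / (PI / 3) * (((2 * INR m + 2) ^ 2 - 0 ^ 2) *
     cos_moment 0 (S (S (2 * m))))); [|ring].
  rewrite R0.
  transitivity ((2 * INR m + 2) * (2 * INR m + 1) *
    ((3 * INR m + 1) * w18 m * cos_moment (2 / 3) (2 * m))); [ring|].
  rewrite IH; ring.
Qed.

Lemma w18_lim : is_lim_seq (fun j => (3 * INR j + 1) * w18 j) (sin (PI / 3) / (PI / 3)).
Proof.
set (P := sin (PI / 3) / (PI / 3)).
assert (P0 : 0 < P).
{ assert (Hpi := PI_RGT_0); apply Rdiv_lt_0_compat; [apply sin_gt_0; lra | lra]. }
apply is_lim_seq_le_le with (fun _ => P) (fun j => P * (1 + / 2 * / (INR j + 1 / 2))).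
- intros j; assert (Hj := pos_INR j); assert (E := w18_cos_moment j); fold P in E.
  assert (S := cos_moment_squeeze (2 * j)); assert (C0 := cos_moment_0_pos j).
  assert (R0 := cos_moment_rec 0 (2 * j)); rewrite mult_INR in R0; change (INR 2) with 2 in R0.
  set (c := cos_moment 0 (2 * j)) in *; set (d := cos_moment (2 / 3) (2 * j)) in *.
  set (u := (3 * INR j + 1) * w18 j) in *.
  assert (Hd : (2 * INR j + 1) / (2 * INR j + 2) * c <= d).
  { replace ((2 * INR j + 1) / (2 * INR j + 2) * c) with (cos_moment 0 (Datatypes.S (Datatypes.S (2 * j)))).
    - apply S.
    - apply Rmult_eq_reg_l with ((2 * INR j + 2) ^ 2 - 0 ^ 2); [|nra]; rewrite R0; field; lra. }
  assert (D0 : 0 < d).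
  { eapply Rlt_le_trans; [|exact Hd]; apply Rmult_lt_0_compat; [apply Rdiv_lt_0_compat|]; lra. }
  assert (U0 : 0 < u).
  { apply Rmult_lt_reg_r with d; [lra|]; rewrite E, Rmult_0_l; nra. }
  split.
  + apply Rmult_le_reg_r with c; [lra|]; rewrite <- E; nra.
  + replace (1 + / 2 * / (INR j + 1 / 2)) with ((2 * INR j + 2) / (2 * INR j + 1)) by (field; lra).
    apply Rmult_le_reg_r with ((2 * INR j + 1) / (2 * INR j + 2) * c).
    * apply Rmult_lt_0_compat; [apply Rdiv_lt_0_compat|]; lra.
    * replace (P * ((2 * INR j + 2) / (2 * INR j + 1)) * ((2 * INR j + 1) / (2 * INR j + 2) * c))
        with (P * c) by (field; lra).
      rewrite <- E; apply Rmult_le_compat_l; lra.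
- apply is_lim_seq_const.
- replace (Finite P) with (Finite (P * (1 + / 2 * 0))) by (f_equal; ring).
  apply is_lim_seq_mult'; [apply is_lim_seq_const|].
  apply is_lim_seq_plus'; [apply is_lim_seq_const|].
  apply is_lim_seq_mult'; [apply is_lim_seq_const | apply is_lim_seq_inv_shift].
Qed.

(** * The series of [kappa] as the integral of 1/(1 + x + x^2) over the unit interval *)

Lemma derive_nonneg_le (f df : R -> R) : (forall x, 0 <= x <= 1 -> is_derive f x (df x)) ->
  (forall x, 0 <= x <= 1 -> 0 <= df x) -> f 0 <= f 1.
Proof.
intros D P.
destruct (MVT_gen f 0 1 df) as [c [Hc E]].
- intros x; rewrite Rmin_left, Rmax_right by lra; intros Hx; apply D; lra.
- intros x; rewrite Rmin_left, Rmax_right by lra; intros Hx.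
  apply derivable_continuous_pt; exists (df x); apply is_derive_Reals, D; lra.
- rewrite Rmin_left, Rmax_right in Hc by lra.
  specialize (P c Hc); lra.
Qed.

Lemma is_derive_pow_div (m : nat) (x : R) :
  is_derive (fun x => x ^ S m / (INR m + 1)) x (x ^ m).
Proof.
assert (Hm := pos_INR m); auto_derive; [trivial|].
change (match m with O => 1 | S _ => INR m + 1 end) with (INR (S m)); rewrite S_INR; field; lra.
Qed.

Definition kappa_poly (N : nat) (x : R) : R :=
  sum_f_R0 (fun l => x ^ (3 * l + 1) / (3 * INR l + 1) - x ^ (3 * l + 2) / (3 * INR l + 2)) N.

Lemma kappa_poly_derive (N : nat) (x : R) : 0 <= x ->
  is_derive (kappa_poly N) x ((1 - x ^ (3 * N + 3)) / (1 + x + x ^ 2)).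
Proof.
intros Hx; unfold kappa_poly; induction N as [|N IH].
- simpl sum_f_R0; auto_derive; [trivial|]; simpl; field; nra.
- apply (is_derive_ext (fun x => plus (kappa_poly N x) (x ^ (3 * S N + 1) / (3 * INR (S N) + 1)
     - x ^ (3 * S N + 2) / (3 * INR (S N) + 2)))); [reflexivity|].
  assert (HN := pos_INR (S N)).
  replace ((1 - x ^ (3 * S N + 3)) / (1 + x + x ^ 2)) with
    (plus ((1 - x ^ (3 * N + 3)) / (1 + x + x ^ 2)) (x ^ (3 * S N) - x ^ (3 * S N + 1))).
  + apply (is_derive_plus (K := R_AbsRing) (V := R_NormedModule)); [exact IH|].
    apply (is_derive_minus (K := R_AbsRing) (V := R_NormedModule)).
    * rewrite <- INR_3, Nat.add_1_r; apply is_derive_pow_div.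
    * replace (3 * S N + 2)%nat with (S (3 * S N + 1)) by lia.
      replace (3 * INR (S N) + 2) with (INR (3 * S N + 1) + 1)
        by (rewrite plus_INR, INR_3; simpl (INR 1); ring).
      apply is_derive_pow_div.
  + unfold plus; cbn -[Nat.mul pow].
    replace (3 * S N + 3)%nat with (3 * N + 3 + 3)%nat by lia.
    replace (3 * S N)%nat with (3 * N + 3)%nat by lia.
    rewrite !(pow_add x (3 * N + 3)); simpl (x ^ 1); simpl (x ^ 2); simpl (x ^ 3); field; nra.
Qed.

(** The integral appears through the antiderivative [A]: monotonicity compares [A] with
    [kappa_poly N], the error being at most 1/(3N+4), the integral of x^(3N+3). *)
Lemma Series_kappa : Series kappa = PI / (3 * sqrt 3).
Proof.
assert (S3 : 0 < sqrt 3) by (apply sqrt_lt_R0; lra).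
assert (Q3 : sqrt 3 * sqrt 3 = 3) by (apply sqrt_sqrt; lra).
set (A := fun x => 2 / sqrt 3 * atan ((2 * x + 1) / sqrt 3)).
assert (DA : forall x, 0 <= x -> is_derive A x (/ (1 + x + x ^ 2))).
{ intros x Hx; unfold A; auto_derive; [trivial|].
  replace (1 + (2 * x + 1) * / sqrt 3 * ((2 * x + 1) * / sqrt 3 * 1)) with
    (1 + (2 * x + 1) ^ 2 * (/ sqrt 3 * / sqrt 3)) by ring.
  transitivity (4 * (/ sqrt 3 * / sqrt 3) * / (1 + (2 * x + 1) ^ 2 * (/ sqrt 3 * / sqrt 3)));
    [unfold Rdiv; ring|].
  rewrite <- Rinv_mult, Q3; field; nra. }
assert (A10 : A 1 - A 0 = PI / (3 * sqrt 3)).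
{ unfold A; replace ((2 * 1 + 1) / sqrt 3) with (tan (PI / 3)).
  - replace ((2 * 0 + 1) / sqrt 3) with (tan (PI / 6)) by (rewrite tan_PI6; f_equal; ring).
    assert (Hpi := PI_RGT_0); rewrite !atan_tan by lra; field; lra.
  - rewrite tan_PI3; apply Rmult_eq_reg_r with (sqrt 3); [|lra]; rewrite Q3; field; lra. }
apply is_series_unique, is_series_lim.
apply is_lim_seq_le_le with (fun N => PI / (3 * sqrt 3) - / (3 * INR N + 4))
  (fun _ => PI / (3 * sqrt 3)).
- intros N; rewrite sum_n_Reals, <- A10; assert (HN := pos_INR N).
  assert (K1 : kappa_poly N 1 = sum_f_R0 kappa N).
  { apply sum_eq; intros l _; assert (Hl := pos_INR l); rewrite !pow1; unfold kappa; field; lra. }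
  assert (K0 : kappa_poly N 0 = 0).
  { unfold kappa_poly; rewrite (sum_eq _ (fun _ => 0)).
    - clear; induction N as [|N IH]; simpl; lra.
    - intros l _; rewrite !pow_i by lia; unfold Rdiv; ring. }
  rewrite <- K1; split.
  + assert (M := derive_nonneg_le (fun x => kappa_poly N x - A x + x ^ (3 * N + 4) / (3 * INR N + 4))
      (fun x => (1 - x ^ (3 * N + 3)) / (1 + x + x ^ 2) - / (1 + x + x ^ 2) + x ^ (3 * N + 3))).
    cbv beta in M; rewrite K0, pow1, pow_i in M by lia.
    enough (0 - A 0 + 0 / (3 * INR N + 4) <= kappa_poly N 1 - A 1 + 1 / (3 * INR N + 4))
      by (unfold Rdiv in *; lra).
    apply M; clear M.
    * intros x Hx; apply (is_derive_plus (K := R_AbsRing) (V := R_NormedModule)).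
      -- apply (is_derive_minus (K := R_AbsRing) (V := R_NormedModule));
           [apply kappa_poly_derive | apply DA]; lra.
      -- replace (3 * N + 4)%nat with (S (3 * N + 3)) by lia.
         replace (3 * INR N + 4) with (INR (3 * N + 3) + 1)
           by (rewrite plus_INR, INR_3; simpl (INR 3); ring).
         apply is_derive_pow_div.
    * intros x Hx; assert (0 <= x ^ (3 * N + 3)) by (apply pow_le; lra).
      replace (_ + _) with (x ^ (3 * N + 3) * ((x + x ^ 2) / (1 + x + x ^ 2))) by (field; nra).
      apply Rmult_le_pos; [lra|]; apply Rdiv_le_0_compat; nra.
  + assert (M := derive_nonneg_le (fun x => A x - kappa_poly N x)
      (fun x => / (1 + x + x ^ 2) - (1 - x ^ (3 * N + 3)) / (1 + x + x ^ 2))).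
    cbv beta in M; rewrite K0 in M.
    enough (A 0 - 0 <= A 1 - kappa_poly N 1) by lra.
    apply M; clear M.
    * intros x Hx; apply (is_derive_minus (K := R_AbsRing) (V := R_NormedModule));
        [apply DA | apply kappa_poly_derive]; lra.
    * intros x Hx; assert (0 <= x ^ (3 * N + 3)) by (apply pow_le; lra).
      replace (_ - _) with (x ^ (3 * N + 3) * / (1 + x + x ^ 2)) by (field; nra).
      apply Rmult_le_pos; [lra|]; left; apply Rinv_0_lt_compat; nra.
- replace (Finite (PI / (3 * sqrt 3))) with (Finite (PI / (3 * sqrt 3) - 0)) by (f_equal; ring).
  apply is_lim_seq_minus'; [apply is_lim_seq_const | apply is_lim_seq_inv_3].
- apply is_lim_seq_const.
Qed.

(** * The sum of inverse cubes, the cotangent and [L_chi3 3] *)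

(* The Herglotz trick: the duplication formula contracts the weight [1 / x + 1 / (1 - x)] by [3/8]. *)
Lemma herglotz_unique (h : R -> R) (C : R) :
  (forall x, 0 < x < 1 -> h (x / 2) + h ((x + 1) / 2) = 8 * h x) ->
  (forall x, 0 < x < 1 -> Rabs (h x) <= C * (/ x + / (1 - x))) ->
  forall x, 0 < x < 1 -> h x = 0.
Proof.
intros E B.
assert (K : forall n x, 0 < x < 1 -> Rabs (h x) <= C * (3 / 8) ^ n * (/ x + / (1 - x))).
{ induction n as [|n IH]; intros x Hx; [simpl; rewrite Rmult_1_r; now apply B|].
  assert (H1 := IH (x / 2) ltac:(lra)); assert (H2 := IH ((x + 1) / 2) ltac:(lra)).
  set (c := C * (3 / 8) ^ n) in *.
  assert (Ix : 0 < / x) by (apply Rinv_0_lt_compat; lra).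
  assert (Iy : 0 < / (1 - x)) by (apply Rinv_0_lt_compat; lra).
  assert (Hc : 0 <= c).
  { assert (P := Rabs_pos (h x)); assert (Q := IH x Hx); fold c in Q.
    apply Rmult_le_reg_r with (/ x + / (1 - x)); lra. }
  replace (C * (3 / 8) ^ S n) with (c * (3 / 8)) by (unfold c; simpl; ring).
  apply Rmult_le_reg_l with 8; [lra|].
  rewrite <- (Rabs_pos_eq 8) at 1 by lra; rewrite <- Rabs_mult, <- E by exact Hx.
  eapply Rle_trans; [apply Rabs_triang|].
  replace (/ (x / 2)) with (2 * / x) in H1 by (field; lra).
  replace (/ (1 - (x + 1) / 2)) with (2 * / (1 - x)) in H2 by (field; lra).
  (* Of the four terms for the halved arguments, two give twice the weight; the other two are at
     most 2 each, together at most 4, hence at most the weight. So 3 stands against 8. *)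
  assert (J1 : / (1 - x / 2) <= 2).
  { replace 2 with (/ (1 / 2)) by field; apply Rinv_le_contravar; lra. }
  assert (J2 : / ((x + 1) / 2) <= 2).
  { replace 2 with (/ (1 / 2)) by field; apply Rinv_le_contravar; lra. }
  assert (J3 : 1 <= / x) by (rewrite <- Rinv_1; apply Rinv_le_contravar; lra).
  assert (J4 : 4 <= / x + / (1 - x)).
  { replace (/ x + / (1 - x)) with (/ (x * (1 - x))) by (field; lra).
    replace 4 with (/ (1 / 4)) by field; assert (Q := pow2_ge_0 (x - 1 / 2)).
    apply Rinv_le_contravar; nra. }
  apply Rle_trans with (c * (2 * / x + / (1 - x / 2)) + c * (/ ((x + 1) / 2) + 2 * / (1 - x)));
    [apply Rplus_le_compat; [exact H1 | exact H2] |].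
  rewrite <- Rmult_plus_distr_l.
  replace (8 * (c * (3 / 8) * (/ x + / (1 - x)))) with (c * (3 * (/ x + / (1 - x)))) by (field; lra).
  apply Rmult_le_compat_l; lra. }
intros x Hx; apply Rabs_eq_0, Rle_antisym; [|apply Rabs_pos].
assert (L : is_lim_seq (fun n => C * (/ x + / (1 - x)) * (3 / 8) ^ n) 0).
{ replace (Finite 0) with (Finite (C * (/ x + / (1 - x)) * 0)) by (f_equal; ring).
  apply is_lim_seq_mult'; [apply is_lim_seq_const|].
  apply is_lim_seq_geom; rewrite Rabs_pos_eq; lra. }
apply (is_lim_seq_le (fun _ => Rabs (h x)) (fun n => C * (/ x + / (1 - x)) * (3 / 8) ^ n)
  (Rabs (h x)) 0); [|apply is_lim_seq_const|exact L].
intros n; replace (C * _ * _) with (C * (3 / 8) ^ n * (/ x + / (1 - x))) by ring; now apply K.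
Qed.

(** The two-sided sum of 1/(n+x)^3 over the integers, with the terms for n and -(n+1) paired. *)
Definition cube_term (x : R) (n : nat) : R := (/ (INR n + x)) ^ 3 - (/ (INR n + 1 - x)) ^ 3.
Definition cube_sum (x : R) : R := Series (cube_term x).

Lemma inv_cube_bound (n : nat) (x : R) : 0 < x -> 0 < (/ (INR n + 1 + x)) ^ 3 <= (/ (INR n + 1)) ^ 2.
Proof.
intros Hx; assert (Hn := pos_INR n).
assert (0 < / (INR n + 1 + x)) by (apply Rinv_0_lt_compat; lra).
assert (/ (INR n + 1 + x) <= / (INR n + 1)) by (apply Rinv_le_contravar; lra).
assert (/ (INR n + 1) <= 1) by (rewrite <- Rinv_1; apply Rinv_le_contravar; lra).
split; [now apply pow_lt|].
apply Rle_trans with ((/ (INR n + 1)) ^ 3); [apply pow_incr; lra|]; simpl; nra.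
Qed.

Lemma cube_term_bound (x : R) (n : nat) : 0 < x < 1 ->
  Rabs (cube_term x (S n)) <= 1 * (/ (INR n + 1)) ^ 2.
Proof.
intros Hx; unfold cube_term; rewrite S_INR, Rmult_1_l.
assert (A := inv_cube_bound n x ltac:(lra)); assert (B := inv_cube_bound n (1 - x) ltac:(lra)).
replace (INR n + 1 + 1 - x) with (INR n + 1 + (1 - x)) by ring.
apply Rabs_le; lra.
Qed.

Lemma ex_series_cube_term (x : R) : 0 < x < 1 -> ex_series (cube_term x).
Proof.
intros Hx; apply ex_series_incr_1, ex_series_bound_sq with 1 1; [lra|].
intros n; now apply cube_term_bound.
Qed.

Lemma cube_sum_near (x : R) : 0 < x < 1 ->
  Rabs (cube_sum x - ((/ x) ^ 3 - (/ (1 - x)) ^ 3)) <= Series (fun m => (/ (INR m + 1)) ^ 2).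
Proof.
intros Hx; unfold cube_sum; rewrite Series_incr_1 by now apply ex_series_cube_term.
unfold cube_term at 1; simpl (INR 0); rewrite !Rplus_0_l.
replace (_ + _ - _) with (Series (fun n => cube_term x (S n))) by ring.
rewrite <- (Rmult_1_l (Series (fun m => (/ (INR m + 1)) ^ 2))).
apply Series_bound_sq; [lra|]; intros n; now apply cube_term_bound.
Qed.

(** Splitting the integers by parity; the identity is exact for each two consecutive pairs, hence
    for partial sums. *)
Lemma cube_sum_double (x : R) : 0 < x < 1 ->
  cube_sum (x / 2) + cube_sum ((x + 1) / 2) = 8 * cube_sum x.
Proof.
intros Hx.
assert (H1 := Series_correct _ (ex_series_cube_term (x / 2) ltac:(lra))).
assert (H2 := Series_correct _ (ex_series_cube_term ((x + 1) / 2) ltac:(lra))).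
assert (H3 := is_lim_seq_even_odd_sum _ _ (Series_correct _ (ex_series_cube_term x Hx))).
fold (cube_sum (x / 2)) in H1; fold (cube_sum ((x + 1) / 2)) in H2; fold (cube_sum x) in H3.
apply is_lim_series in H1, H2.
assert (H4 := is_lim_seq_plus' _ _ _ _ H1 H2).
assert (H5 := is_lim_seq_mult' _ _ _ _ (is_lim_seq_const 8) H3).
apply is_lim_seq_unique in H4, H5.
enough (Finite (cube_sum (x / 2) + cube_sum ((x + 1) / 2)) = Finite (8 * cube_sum x)) by congruence.
rewrite <- H4, <- H5; apply Lim_seq_ext; intros N.
induction N as [|N IH].
- rewrite !sum_O; unfold cube_term; simpl (2 * 0)%nat; simpl (0 + 1)%nat; simpl INR; field; lra.
- rewrite !sum_Sn; unfold plus; cbn -[INR Nat.mul cube_term sum_n Rmult] in *.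
  transitivity (sum_n (cube_term (x / 2)) N + sum_n (cube_term ((x + 1) / 2)) N +
   (cube_term (x / 2) (S N) + cube_term ((x + 1) / 2) (S N))); [ring|].
  rewrite IH.
  enough (cube_term (x / 2) (S N) + cube_term ((x + 1) / 2) (S N) =
    8 * (cube_term x (2 * S N) + cube_term x (2 * S N + 1))) by lra.
  assert (HN := pos_INR (S N)); unfold cube_term; rewrite plus_INR, mult_INR.
  change (INR 2) with 2; change (INR 1) with 1; field; repeat split; lra.
Qed.

(** Half the second derivative of pi cot(pi x). *)
Definition cot_cube (x : R) : R := PI ^ 3 * cos (PI * x) / sin (PI * x) ^ 3.

Lemma cot_cube_double (x : R) : 0 < x < 1 ->
  cot_cube (x / 2) + cot_cube ((x + 1) / 2) = 8 * cot_cube x.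
Proof.
intros Hx; assert (Hpi := PI_RGT_0); unfold cot_cube.
set (u := PI * (x / 2)).
replace (PI * ((x + 1) / 2)) with (PI / 2 + u) by (unfold u; field).
replace (PI * x) with (2 * u) by (unfold u; field).
assert (0 < u < PI / 2) by (unfold u; split; nra).
assert (0 < sin u) by (apply sin_gt_0; lra).
assert (0 < cos u) by (apply cos_gt_0; lra).
assert (E1 : sin (PI / 2 + u) = cos u) by (rewrite sin_plus, sin_PI2, cos_PI2; ring).
assert (E2 : cos (PI / 2 + u) = - sin u) by (rewrite cos_plus, sin_PI2, cos_PI2; ring).
rewrite E1, E2, sin_2a, cos_2a.
assert (E := sin2_cos2 u); unfold Rsqr in E.
replace (cos u * cos u - sin u * sin u) with
  ((cos u * cos u - sin u * sin u) * (sin u * sin u + cos u * cos u)) by (rewrite E; ring).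
field; lra.
Qed.

(** Both u^3 cos u and sin(u)^3 lie between u^3 - u^5/2 and u^3. Up to u = 2, u - u^3/6 >= u/3, so
    sin u >= u/3, which gives the 27. *)
Lemma cos_sin_cube (u : R) : 0 < u <= 2 ->
  0 < sin u /\ Rabs (cos u / sin u ^ 3 - / u ^ 3) <= 27 / 2 * / u.
Proof.
intros Hu.
assert (S1 : u - u ^ 3 / 6 <= sin u).
{ destruct (pre_sin_bound u 0 ltac:(lra) ltac:(lra)) as [H _].
  eapply Rle_trans; [|exact H]; right.
  unfold sin_approx, sin_term; simpl; field. }
assert (S2 : sin u < u) by (apply sin_lt_x; lra).
assert (C1 : 1 - u ^ 2 / 2 <= cos u).
{ destruct (pre_cos_bound u 0 ltac:(lra) ltac:(lra)) as [H _].
  eapply Rle_trans; [|exact H]; right.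
  unfold cos_approx, cos_term; simpl; field. }
assert (C2 := COS_bound u).
assert (S3 : u / 3 <= sin u) by nra.
assert (S0 : 0 < sin u) by lra.
split; [exact S0|].
assert (U3 : 0 < u ^ 3) by (apply pow_lt; lra).
assert (Q1 : u ^ 3 / 27 <= sin u ^ 3).
{ replace (u ^ 3 / 27) with ((u / 3) ^ 3) by field; apply pow_incr; lra. }
assert (Q2 : sin u ^ 3 <= u ^ 3) by (apply pow_incr; lra).
assert (Q3 : u ^ 3 - u ^ 5 / 2 <= sin u ^ 3).
{ apply Rle_trans with ((u - u ^ 3 / 6) ^ 3).
  - replace ((u - u ^ 3 / 6) ^ 3) with
     (u ^ 3 - u ^ 5 / 2 + u ^ 7 / 12 * (1 - u ^ 2 / 18)) by field.
    assert (0 < u ^ 7) by (apply pow_lt; lra).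
    assert (0 <= 1 - u ^ 2 / 18) by nra.
    assert (0 <= u ^ 7 / 12 * (1 - u ^ 2 / 18)) by (apply Rmult_le_pos; lra). lra.
  - apply pow_incr; split; [|exact S1].
    replace (u - u ^ 3 / 6) with (u * (1 - u ^ 2 / 6)) by field; apply Rmult_le_pos; nra. }
assert (Q4 : u ^ 3 - u ^ 5 / 2 <= u ^ 3 * cos u).
{ replace (u ^ 3 - u ^ 5 / 2) with (u ^ 3 * (1 - u ^ 2 / 2)) by field.
  apply Rmult_le_compat_l; lra. }
assert (Q5 : u ^ 3 * cos u <= u ^ 3).
{ rewrite <- (Rmult_1_r (u ^ 3)) at 2; apply Rmult_le_compat_l; lra. }
assert (Q6 : Rabs (u ^ 3 * cos u - sin u ^ 3) <= u ^ 5 / 2) by (apply Rabs_le; lra).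
replace (cos u / sin u ^ 3 - / u ^ 3) with ((u ^ 3 * cos u - sin u ^ 3) / (u ^ 3 * sin u ^ 3))
  by (field; lra).
apply Rabs_div_le; [apply Rmult_lt_0_compat; lra|].
eapply Rle_trans; [exact Q6|].
replace (u ^ 5 / 2) with (27 / 2 * / u * (u ^ 3 * (u ^ 3 / 27))) by (field; lra).
apply Rmult_le_compat_l; [|apply Rmult_le_compat_l; lra].
assert (0 < / u) by (apply Rinv_0_lt_compat; lra); lra.
Qed.

Lemma cot_cube_near_half (x : R) : 0 < x <= 1 / 2 ->
  Rabs (cot_cube x - (/ x) ^ 3) <= 27 / 2 * PI ^ 2 * / x.
Proof.
intros Hx; assert (Hpi := PI_RGT_0); assert (Hpi4 := PI_4).
destruct (cos_sin_cube (PI * x)) as [S0 B]; [split; nra|].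
unfold cot_cube.
replace (PI ^ 3 * cos (PI * x) / sin (PI * x) ^ 3 - (/ x) ^ 3) with
  (PI ^ 3 * (cos (PI * x) / sin (PI * x) ^ 3 - / (PI * x) ^ 3)) by (field; lra).
assert (P3 : 0 < PI ^ 3) by (apply pow_lt; lra).
rewrite Rabs_mult, (Rabs_pos_eq (PI ^ 3)) by lra.
replace (27 / 2 * PI ^ 2 * / x) with (PI ^ 3 * (27 / 2 * / (PI * x))) by (field; lra).
apply Rmult_le_compat_l; lra.
Qed.

Lemma cot_cube_sym (x : R) : cot_cube (1 - x) = - cot_cube x.
Proof.
unfold cot_cube; replace (PI * (1 - x)) with (PI - PI * x) by ring.
rewrite sin_PI_x.
replace (cos (PI - PI * x)) with (- cos (PI * x)) by (rewrite cos_minus, cos_PI, sin_PI; ring).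
unfold Rdiv; ring.
Qed.

Lemma cot_cube_near (x : R) : 0 < x < 1 ->
  Rabs (cot_cube x - ((/ x) ^ 3 - (/ (1 - x)) ^ 3)) <= (27 / 2 * PI ^ 2 + 8) * (/ x + / (1 - x)).
Proof.
assert (K : forall y, 0 < y <= 1 / 2 ->
  Rabs (cot_cube y - ((/ y) ^ 3 - (/ (1 - y)) ^ 3)) <= (27 / 2 * PI ^ 2 + 8) * (/ y + / (1 - y))).
{ intros y Hy; assert (H := cot_cube_near_half y Hy).
  assert (I1 : 1 <= / y) by (rewrite <- Rinv_1; apply Rinv_le_contravar; lra).
  assert (I2 : 0 < / (1 - y)) by (apply Rinv_0_lt_compat; lra).
  assert (I3 : / (1 - y) <= 2).
  { replace 2 with (/ (1 / 2)) by field; apply Rinv_le_contravar; lra. }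
  assert (I4 : 0 < (/ (1 - y)) ^ 3 <= 2 ^ 3).
  { split; [apply pow_lt; lra | apply pow_incr; lra]. }
  assert (Hp : 0 <= PI ^ 2) by apply pow2_ge_0.
  apply Rabs_le_between in H; apply Rabs_le.
  assert (0 <= PI ^ 2 * / (1 - y)) by (apply Rmult_le_pos; lra).
  lra. }
intros Hx; destruct (Rle_dec x (1 / 2)) as [L|L]; [apply K; lra|].
assert (H := K (1 - x) ltac:(lra)); rewrite cot_cube_sym in H.
replace (1 - (1 - x)) with x in H by ring.
rewrite <- Rabs_Ropp.
replace (- (cot_cube x - ((/ x) ^ 3 - (/ (1 - x)) ^ 3))) with
  (- cot_cube x - ((/ (1 - x)) ^ 3 - (/ x) ^ 3)) by ring.
rewrite (Rplus_comm (/ x)); exact H.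
Qed.

(** Both sides obey the same duplication formula and have the same cubic poles at 0 and 1, so the
    difference satisfies the bound of [herglotz_unique]. *)
Lemma cube_sum_cot (x : R) : 0 < x < 1 -> cube_sum x = cot_cube x.
Proof.
intros Hx.
set (S := Series (fun m => (/ (INR m + 1)) ^ 2)).
enough (H : cube_sum x - cot_cube x = 0) by lra.
apply (herglotz_unique (fun x => cube_sum x - cot_cube x) (S + (27 / 2 * PI ^ 2 + 8))); [| |exact Hx].
- clear x Hx; intros x Hx; generalize (cube_sum_double x Hx), (cot_cube_double x Hx); lra.
- clear x Hx; intros x Hx; assert (A := cube_sum_near x Hx); assert (B := cot_cube_near x Hx).
  fold S in A.
  assert (I1 : 1 <= / x) by (rewrite <- Rinv_1; apply Rinv_le_contravar; lra).
  assert (I2 : 0 < / (1 - x)) by (apply Rinv_0_lt_compat; lra).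
  assert (S0 : 0 <= S) by (eapply Rle_trans; [apply Rabs_pos | exact A]).
  assert (S <= S * (/ x + / (1 - x))) by nra.
  rewrite Rmult_plus_distr_r.
  apply Rabs_le_between in A, B; apply Rabs_le; lra.
Qed.

Lemma sum_n_mod_3 (f : nat -> R) (N : nat) :
  sum_n f (3 * N + 2) = sum_n (fun n => f (3 * n)%nat + f (3 * n + 1)%nat + f (3 * n + 2)%nat) N.
Proof.
induction N as [|N IH].
- simpl (3 * 0 + 2)%nat; rewrite !sum_Sn, !sum_O; reflexivity.
- replace (3 * S N + 2)%nat with (S (S (S (3 * N + 2)))) by lia.
  rewrite !sum_Sn, IH.
  replace (S (3 * N + 2)) with (3 * S N)%nat by lia.
  replace (S (3 * S N)) with (3 * S N + 1)%nat by lia.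
  replace (S (3 * S N + 1)) with (3 * S N + 2)%nat by lia.
  unfold plus; cbn -[Nat.mul Nat.add]; ring.
Qed.

(** As [chi3] and the cube are both odd, the series is 1/27 of the two-sided sum at x = 1/3. *)
Lemma L_chi3_3 : L_chi3 3 = 4 * PI ^ 3 / (81 * sqrt 3).
Proof.
set (f := fun n : nat => chi3 (S n) / INR (S n) ^ 3).
assert (Ef : ex_series f).
{ apply ex_series_bound_sq with 1 1; [lra|]; intros n; unfold f; rewrite S_INR.
  assert (Hn := pos_INR n).
  assert (C : Rabs (chi3 (S n)) <= 1).
  { unfold chi3; destruct (S n mod 3)%nat as [|[|r]];
      unfold Rabs; destruct Rcase_abs; lra. }
  apply Rabs_div_le; [apply pow_lt; lra|].
  eapply Rle_trans; [exact C|].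
  replace (1 * (/ (INR n + 1)) ^ 2 * (INR n + 1) ^ 3) with (INR n + 1) by (field; lra); lra. }
assert (H1 := Series_correct _ Ef); fold (L_chi3 3) in H1; change (Series f) with (L_chi3 3) in H1.
assert (H2 := Series_correct _ (ex_series_cube_term (1 / 3) ltac:(lra))).
fold (cube_sum (1 / 3)) in H2; rewrite cube_sum_cot in H2 by lra.
apply is_lim_series in H1, H2.
assert (H3 : is_lim_seq (fun N => sum_n f (3 * N + 2)) (L_chi3 3)).
{ apply (is_lim_seq_subseq (sum_n f) (L_chi3 3) (fun N => (3 * N + 2)%nat)); [|exact H1].
  intros P [n Hn]; exists n; intros m Hm; apply Hn; lia. }
assert (H4 := is_lim_seq_mult' _ _ _ _ (is_lim_seq_const (/ 27)) H2).
apply is_lim_seq_unique in H3, H4.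
assert (E : L_chi3 3 = / 27 * cot_cube (1 / 3)).
{ enough (Finite (L_chi3 3) = Finite (/ 27 * cot_cube (1 / 3))) by congruence.
  rewrite <- H3, <- H4; apply Lim_seq_ext; intros N.
  rewrite sum_n_mod_3, <- (sum_n_mult_l (K := R_Ring)); apply sum_n_ext; intros n.
  change (f (3 * n)%nat + f (3 * n + 1)%nat + f (3 * n + 2)%nat = / 27 * cube_term (1 / 3) n).
  unfold f, cube_term; rewrite !Nat.add_1_r, (Nat.add_comm _ 2).
  change (2 + 3 * n)%nat with (S (S (3 * n))).
  rewrite (chi3_by_class (S (3 * n))), (chi3_by_class (S (S (3 * n)))),
    (chi3_by_class (S (S (S (3 * n))))), !by_class_S, !by_class_3, !S_INR, INR_3.
  assert (Hn := pos_INR n); field; repeat split; lra. }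
rewrite E; unfold cot_cube.
replace (PI * (1 / 3)) with (PI / 3) by field; rewrite cos_PI3, sin_PI3.
assert (S3 : 0 < sqrt 3) by (apply sqrt_lt_R0; lra).
assert (Q3 : sqrt 3 * sqrt 3 = 3) by (apply sqrt_sqrt; lra).
replace ((sqrt 3 / 2) ^ 3) with (sqrt 3 * (sqrt 3 * sqrt 3) / 8) by field.
rewrite Q3; field; lra.
Qed.

(** With P^2 = 27/(4 pi^2), both expressions for the limit are 4 pi^3 / (243 sqrt 3). *)
Lemma limit_V18 (a b : nat -> R) :
  solves V18 a -> solves V18 b -> a 0%nat = 1 -> a 1%nat = recP V18 1 ->
  b 0%nat = 0 -> b 1%nat = 1 -> is_lim_seq (fun n => b n / a n) (L_chi3 3 / 3).
Proof.
intros Ha Hb a0 a1 b0 b1.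
assert (S3 : 0 < sqrt 3) by (apply sqrt_lt_R0; lra).
assert (Q3 : sqrt 3 * sqrt 3 = 3) by (apply sqrt_sqrt; lra).
assert (Hpi := PI_RGT_0).
replace (L_chi3 3 / 3) with (Series kappa / (3 * (sin (PI / 3) / (PI / 3)) ^ 2)).
- apply limit_V18_of_P; auto using w18_lim.
  rewrite sin_PI3; apply Rgt_not_eq; apply Rdiv_lt_0_compat; lra.
- rewrite L_chi3_3, Series_kappa, sin_PI3.
  replace ((sqrt 3 / 2 / (PI / 3)) ^ 2) with (9 * (sqrt 3 * sqrt 3) / (4 * PI ^ 2)) by (field; lra).
  rewrite Q3; field; lra.
Qed.

Theorem theorem2p4 (V : Mukai) (a b : nat -> R) :
  (* a: a_0 = 1, recurrence for all n >= 1 with a_{-1} = 0 *)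
  a 0%nat = 1 ->
  INR 1 ^ 3 * a 1%nat = recP V (INR 1) * a 0%nat + recQ V (INR 1) * 0 ->
  (forall n : nat, (2 <= n)%nat ->
     INR n ^ 3 * a n = recP V (INR n) * a (n - 1)%nat + recQ V (INR n) * a (n - 2)%nat) ->
  (* b: b_0 = 0, b_1 = 1, recurrence for all n >= 2 *)
  b 0%nat = 0 ->
  b 1%nat = 1 ->
  (forall n : nat, (2 <= n)%nat ->
     INR n ^ 3 * b n = recP V (INR n) * b (n - 1)%nat + recQ V (INR n) * b (n - 2)%nat) ->
  is_lim_seq (fun n : nat => b n / a n) (mukai_limit V).
Proof.
intros a0 a1 Ha b0 b1 Hb.
apply solves_of_shifted in Ha; apply solves_of_shifted in Hb.
rewrite a0 in a1; simpl INR in a1.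
assert (a1' : a 1%nat = recP V 1) by lra; clear a1.
destruct V; simpl mukai_limit.
- now apply limit_V10.
- now apply limit_V12.
- now apply limit_V14.
- now apply limit_V16.
- now apply limit_V18.
Qed.
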